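(* Let $p$ be an odd prime, $H \subset \mathbb{F}_p^*$ a subgroup of index $n$, and $c : H \to \mathbb{C}^*$ a non-trivial character. Then, counted with multiplicities, the number of $(H,c)$-equivariant $\mathcal{C}$-functions $f$ on $\mathbb{F}_p$ with $f(1)=1$ is equal to the binomial coefficient $\binom{2n-2}{n-1}$.
   Context: A function $f:\mathbb{F}_p\to\mathbb{C}$ is $(H,c)$-equivariant if $f(hx) = c(h) f(x)$ for all $h\in H$, $x \in \mathbb{F}_p$ (such $f$ vanish at $0$); $V_{H,c}$ denotes the space of these. A $\mathcal{C}$-function is a function $f$ with $f(0)=0$, $f(x)\neq 0$ for $x\neq 0$, and $\sum_{x\neq 0} f(x-\ell)f(x)^{-1} = -1$ for all $\ell\neq 0$. Fourier transform: $\widehat{f}(x) = p^{-1/2}\sum_{y} e^{2i\pi xy/p} f(y)$; $\check g(x):=g(-x)$. Multiplicity: let $V_1 = \{f\in V_{H,c} : f(1)=1\}$, $\overline{V}_1 = \{g \in V_{H,\bar c} : g(1)=1\}$, and $W_1$ the set of pairs $(f_0,g_0)$ of $H$-invariant functions on $\mathbb{F}_p$ vanishing at $0$ with $f_0(1)=1$ and $\sum_x f_0(x) = \sum_x g_0(x)$. Let $\Phi : V_1\times\overline{V}_1 \to W_1$, $\Phi(f,g) = (fg, \widehat f\,\widehat{\check g})$. An $f\in V_1$ is a $\mathcal{C}$-function iff there is a (unique) $g\in \overline V_1$ with $\Phi(f,g) = (\mathbf{1}_{\mathbb{F}_p^*},\mathbf{1}_{\mathbb{F}_p^*})$; the multiplicity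 of $f$ is the complex dimension of $\mathcal{O}_{(f,g)}/\mathcal{J}$, where $\mathcal{O}_{(f,g)}$ is the ring of germs of holomorphic functions on $V_1\times \overline V_1$ at $(f,g)$ and $\mathcal{J}$ is the ideal generated by the components (in affine coordinates) of $\Phi - (\mathbf{1}_{\mathbb{F}_p^*},\mathbf{1}_{\mathbb{F}_p^*})$. *)

(* Defs.v *)
From HB Require Import structures.
From mathcomp Require Import all_boot all_order all_algebra all_fingroup.
From mathcomp Require Import complex.
From mathcomp Require Import all_classical all_reals.
From mathcomp Require Import topology normedtype derive trigo.

Set Implicit Arguments.
Unset Strict Implicit.
Unset Printing Implicit Defensive.

Import Order.TTheory GRing.Theory Num.Theory.
Import numFieldNormedType.Exports.

Local Open Scope classical_set_scope.
Local Open Scope ring_scope.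

(* dim V / W = d, for subspaces W of V: the classes of e_0, ..., e_(d-1) form *)
(* a basis of the quotient.                                                   *)
Definition has_quotient_dim (K : fieldType) (E : lmodType K) (V W : set E)
    (d : nat) : Prop :=
  exists e : 'I_d -> E, (forall i, V (e i)) /\
    forall F, V F -> exists! a : 'rV[K]_d, W (F - \sum_(i < d) a 0 i *: e i).

(* A germ at w is represented by a function defined on the whole of K^m; two  *)
(* functions that agree near w have the same germ. For K = R[i],              *)
(* differentiability (in the sense of Frechet, over K) near w is holomorphy.  *)
Definition holomorphic_at (K : numClosedFieldType) (m : nat) (w : 'rV[K]_m) :
    set ('rV[K]_m -> K) :=
  [set F | \forall u \near w, differentiable F u].

(* The functions whose germ at w lies in the ideal generated by the germs of  *)
(* the P k in the ring of germs of holomorphic functions. Since the equality  *)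
(* is only required near w, the quotient of holomorphic_at w by germ_ideal w P*)
(* is the quotient of that ring by that ideal.                                *)
Definition germ_ideal (K : numClosedFieldType) (m q : nat) (w : 'rV[K]_m)
    (P : 'I_q -> 'rV[K]_m -> K) : set ('rV[K]_m -> K) :=
  [set F | exists2 A : 'I_q -> 'rV[K]_m -> K,
      forall k, holomorphic_at w (A k) &
      \forall u \near w, F u = \sum_(k < q) A k u * P k u].

(* An affine system of coordinates on an affine subspace A of E: pt is an     *)
(* affine bijection from K^m onto A, and coord is its inverse (the values of  *)
(* coord outside of A are irrelevant).                                        *)
Record affine_coordinates (K : fieldType) (E : lmodType K) (A : set E)
    (m : nat) := AffineCoordinates {
  pt : 'rV[K]_m -> E;
  coord : E -> 'rV[K]_m;
  pt_affine : forall (t : K) (u v : 'rV[K]_m),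
    pt (t *: u + (1 - t) *: v) = t *: pt u + (1 - t) *: pt v;
  pt_in : forall u, A (pt u);
  ptK : forall u, coord (pt u) = u;
  coordK : forall a, A a -> pt (coord a) = a
}.

Section Functions.
Variables (R : realType) (p : nat).
Local Notation C := R[i].
Local Notation Fun := {ffun 'F_p -> C^o}.
Implicit Types (H : {group {unit 'F_p}}) (c : {unit 'F_p} -> C) (f g : Fun).

(* Only the values of c on H matter. *)
Definition is_character H c : Prop :=
  {in H &, forall h k, c (h * k)%g = c h * c k} /\ {in H, forall h, c h != 0}.

Definition equivariant H c : set Fun :=
  [set f : Fun | forall h, h \in H -> forall x : 'F_p, f (val h * x) = c h * f x].

Definition C_function : set Fun :=
  [set f : Fun | [/\ f 0 = 0, forall x, x != 0 -> f x != 0 &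
    forall l : 'F_p, l != 0 ->
      \sum_(x : 'F_p | x != 0) f (x - l) * (f x)^-1 = -1]].

Definition fourier f : Fun :=
  [ffun x : 'F_p => ((Num.sqrt p%:R)^-1)%:C%C * \sum_(y : 'F_p)
     (let t : R := 2 * pi * (x * y)%:R / p%:R in (cos t +i* sin t)%C) * f y].

Definition reflect_fun f : Fun := [ffun x : 'F_p => f (- x)].

Definition mul_fun f g : Fun := [ffun x : 'F_p => f x * g x].

Definition indic_units : Fun := [ffun x : 'F_p => (x != 0)%:R].

Definition V1 H c : set Fun :=
  [set f : Fun | equivariant H c f /\ f 1 = 1].

Definition V1bar H c : set Fun := V1 H (fun h => (c h)^*).

Definition W1 H : set (Fun * Fun) :=
  [set w : Fun * Fun | [/\ equivariant H (fun=> 1) w.1 /\ w.1 0 = 0,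
      equivariant H (fun=> 1) w.2 /\ w.2 0 = 0,
      w.1 1 = 1 & \sum_(x : 'F_p) w.1 x = \sum_(x : 'F_p) w.2 x]].

Definition Phi (fg : Fun * Fun) : Fun * Fun :=
  (mul_fun fg.1 fg.2, mul_fun (fourier fg.1) (fourier (reflect_fun fg.2))).

Definition Phi_target : Fun * Fun := (indic_units, indic_units).

(* The affine coordinates X on the source and Y on the target of Phi exist and *)
(* d depends neither on them nor on g, which is determined by f.               *)
Definition has_multiplicity H c f (d : nat) : Prop :=
  exists g, [/\ V1bar H c g, Phi (f, g) = Phi_target &
    exists (m q : nat) (X : affine_coordinates (V1 H c `*` V1bar H c) m)
           (Y : affine_coordinates (W1 H) q),
      let w := coord X (f, g) in
      let P (k : 'I_q) (u : 'rV[C]_m) : C :=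
        coord Y (Phi (pt X u)) 0 k - coord Y Phi_target 0 k in
      has_quotient_dim (holomorphic_at w) (germ_ideal w P) d].

End Functions.

(* Main.v *)
(* Let n = N + 1 be the index of H. A function in V_(H,c) is determined by its values
   x_0 = 1, x_1, .., x_N on the cosets of H, and the equation Phi(f, g) = (1, 1) becomes
   a system lx_k(x) ly_k(y) = 1 of 2N equations in 2N unknowns, where the linear forms
   lx_k, ly_k are the values of f, g and of their Fourier transforms on the non-trivial
   cosets. By Chebotarev's theorem on the minors of the Fourier matrix, a non-zero x
   annihilates at most N of the 2n forms lx_k (values and Fourier values together).

   Deform the system into lx_k(x) ly_k(y) = t. For every pair (lx_k, ly_k) a choice of one
   of the two forms leads to a set of n independent forms in x or in y; together with
   Parseval's identity this makes the coordinates integral over C[t], so the family of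
   quotient algebras is finite, and its dimension is constant: the Bezoutian gives
   a dual basis, hence an idempotent matrix over C[t] with constant trace. At t = 0 the
   solutions are simple and correspond to the choice of the N forms lx_k that vanish,
   which gives binomial(2N, N).

   It remains to identify the local algebra at a solution in the sense of holomorphic
   germs with the localization of the polynomial quotient. This uses Hadamard's
   lemma F(u) - F(w) = sum (u_i - w_i) A_i(u) with A_i holomorphic, which is derived from
   Cauchy's estimates. As no complex integral is available, these come from Goursat's
   bisection argument for the discrete boundary sums of a square. *)

Require Import Defs.
From HB Require Import structures.
From mathcomp Require Import all_boot all_order all_algebra all_fingroup.
From mathcomp Require Import ring lra zify.
From mathcomp Require Import boolp classical_sets.
From mathcomp Require ssrcomplements mpoly.

Set Implicit Arguments.
Unset Strict Implicit.
Unset Printing Implicit Defensive.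

Import Order.TTheory GRing.Theory Num.Theory.

Local Open Scope ring_scope.

(** * Chebotarev's theorem on the minors of the Fourier matrix *)

(** Finiteness over C[t] alone only makes the fibre dimension semicontinuous; constancy needs
    projectivity, and this comes from having as many equations as unknowns. Integrality supplies
    monic polynomials g_i(X_i) in the ideal; their residue functional is explicit, and Bezoutians
    carry it over to the bilinear system. Integrality itself is a degree count. The values of f and
    g at the trivial coset are 1; the Fourier values there are not among the equations, but
    Parseval, with N equations on each side, forces their product to be 1 too. So all 2n pairs have
    scalar products, and a term containing both forms of a pair drops in degree. Chebotarev's
    theorem bounds zeros in F_p. Apart from 0, those of an equivariant function and of its transform
    fill whole cosets, and p - 1 = n|H|, so fewer than p zeros means at most N cosets. Holomorphic
    and polynomial quotients agree because the localized ideal contains all monomials of high degree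
    in u - w: only finite Taylor expansions matter, and power series never have to converge. *)

Section PrimeRoot.
Variables (K : numFieldType) (p : nat) (zeta : K).
Hypotheses (p_prime : prime p) (zetap : zeta ^+ p = 1) (zeta1 : zeta != 1).

(** This is [((1 + X)^p - 1) / X], the p-th cyclotomic polynomial at [1 + X]: Eisenstein at p, with
    constant term p. *)
Let q : {poly int} := \poly_(i < p) ('C(p, i.+1))%:Z.

Let p_gt0 : (0 < p)%N. Proof. exact: prime_gt0. Qed.

Let size_q : size q = p.
Proof. by rewrite size_poly_eq// prednK// binn. Qed.

Let q_monic : q \is monic.
Proof. by rewrite monicE lead_coefE size_q coef_poly prednK// leqnn binn. Qed.

Let q_irr : irreducible_poly q.
Proof.
apply: (eisenstein_crit p_prime).
- by rewrite size_q neq_ltn prime_gt1// orbT.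
- rewrite (monicP q_monic) dvdz1 /=; apply: contraTneq p_prime => ->; by [].
- rewrite coef_poly p_gt0 bin1 dvdzE !absz_nat natrXE gtnNdvd//.
  by rewrite -[X in (X < _)%N]expn1 ltn_exp2l// prime_gt1.
- rewrite size_q => i ip; rewrite coef_poly (leq_trans ip (leq_pred p)) /dvdz/=.
  by apply: prime_dvd_bin => //; rewrite /= -ltn_predRL.
Qed.

Let q_root : root (map_poly intr q) (zeta - 1).
Proof.
have : (zeta - 1) * (map_poly intr q).[zeta - 1] = 0.
  rewrite (_ : map_poly intr q = \poly_(i < p) ('C(p, i.+1))%:R); last first.
    by apply/polyP => i; rewrite coef_map !coef_poly; case: ifP.
  rewrite horner_poly mulr_sumr; transitivity (zeta ^+ p - 1); last by rewrite zetap subrr.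
  have zE : zeta = 1 + (zeta - 1) by rewrite addrC subrK.
  rewrite [in RHS]zE; move: (zeta - 1) => t.
  rewrite exprDn big_ord_recl bin0 expr1n mul1r expr0 mulr1n addrAC subrr add0r; apply: eq_bigr => i _.
  by rewrite lift0 expr1n mul1r -[RHS]mulr_natl mulrCA -exprS.
by move/eqP; rewrite mulf_eq0 subr_eq0 (negPf zeta1).
Qed.

(** The substitution [X + 1] moves the root to [zeta - 1], a root of the monic irreducible [q].
    Hence [q] divides [P(X + 1)] over the integers, and the value at 0 is a multiple of
    [q(0) = p]. *)
Lemma prime_root_eval (P : {poly int}) : root (map_poly intr P) zeta -> (p %| P.[1])%Z.
Proof.
move=> Pz; pose P1 := P \Po ('X + 1).
have P1z : root (map_poly intr P1) (zeta - 1).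
  by rewrite rootE map_comp_poly horner_comp rmorphD/= map_polyX rmorph1 hornerD hornerX hornerC subrK.
have P10 : P1.[0] = P.[1] by rewrite horner_comp hornerD hornerX hornerC add0r.
have PE := Pdiv.RingMonic.rdivp_eq q_monic P1.
set g := Pdiv.Ring.rdivp P1 q in PE; set r := Pdiv.Ring.rmodp P1 q in PE.
have r_lt : (size r < size q)%N by rewrite Pdiv.Ring.ltn_rmodp monic_neq0.
suff r0 : r = 0.
  rewrite -P10 PE r0 addr0 hornerM !horner_coef0 coef_poly p_gt0 bin1.
  by apply: dvdz_mull; exact: dvdzz.
apply/eqP; apply: contraT => r0.
have rz : root (map_poly intr r) (zeta - 1).
  move: P1z; rewrite PE rmorphD rmorphM/= rootE hornerD hornerM.
  by have /eqP -> := q_root; rewrite mulr0 add0r.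
(* Over the rationals a non-zero remainder of smaller degree would be coprime to [q], although both
   vanish at [zeta - 1]. *)
pose toQ := map_poly (intr : int -> rat).
have qQ : irreducible_poly (toQ q) by apply/irreducible_rat_int; exact: q_irr.
have cop : coprimep (toQ q) (toQ r).
  rewrite (irreducible_poly_coprime _ qQ); apply/negP => /dvdp_leq.
  rewrite !size_map_inj_poly//; try exact: intr_inj.
  by rewrite map_poly_eq0_id0 ?intr_eq0 ?lead_coef_eq0// => /(_ r0); rewrite leqNgt r_lt.
have toK (h : {poly int}) : map_poly ratr (toQ h) = map_poly intr h :> {poly K}.
  by rewrite -map_poly_comp; apply: eq_map_poly => x; rewrite /= ratr_int.
have : coprimep (map_poly ratr (toQ q) : {poly K}) (map_poly ratr (toQ r)) by rewrite coprimep_map.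
by rewrite !toK => /coprimep_root/(_ q_root); rewrite (eqP rz) eqxx.
Qed.

End PrimeRoot.

(* The divided difference of X^a at the points ys, computed by Leibniz' rule for X * X^a. *)
Fixpoint divdiff (T : comNzRingType) (a : nat) (ys : seq T) : T :=
  match a, ys with
  | 0%N, _ => (size ys == 1%N)%:R
  | a'.+1, [::] => 0
  | a'.+1, y :: ys' => y * divdiff a' ys + divdiff a' ys'
  end.

Section DividedDifferences.
Variable T : comNzRingType.
Implicit Types (a : nat) (y : T) (ys : seq T) (g : {poly T}).

Lemma divdiff_nil a : divdiff a ([::] : seq T) = 0. Proof. by case: a. Qed.

Lemma divdiffS a y ys : divdiff a.+1 (y :: ys) = y * divdiff a (y :: ys) + divdiff a ys.
Proof. by []. Qed.

Lemma divdiff_morph (T' : comNzRingType) (phi : {rmorphism T -> T'}) a ys :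
  phi (divdiff a ys) = divdiff a (map phi ys).
Proof.
elim: a ys => [|a IH] [|y ys]; rewrite ?divdiff_nil ?rmorph0//.
  by rewrite /= size_map rmorph_nat.
by rewrite /= rmorphD rmorphM !IH.
Qed.

(** When all j + 1 nodes coincide, the divided difference is the j-th derivative divided by j!, and
    at the node 1 the recursion is Pascal's rule. *)
Lemma divdiff1 a j : divdiff a (nseq j.+1 (1 : T)) = 'C(a, j)%:R.
Proof.
elim: a j => [|a IH] j; first by rewrite /= size_nseq eqSS; case: j.
rewrite -[nseq _ _]/(1 :: nseq j 1) divdiffS -[1 :: _]/(nseq j.+1 1) IH mul1r.
case: j => [|j]; first by rewrite divdiff_nil addr0 !bin0.
by rewrite IH -natrD binS.
Qed.

Definition divdiff_poly g ys : T := \sum_(a < size g) g`_a * divdiff a ys.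

Lemma divdiff_poly_widen n g ys : (size g <= n)%N ->
  divdiff_poly g ys = \sum_(a < n) g`_a * divdiff a ys.
Proof.
move=> gn; rewrite /divdiff_poly (big_ord_widen n (fun a => g`_a * divdiff a ys) gn) big_mkcond.
apply: eq_bigr => a _; case: ltnP => // ga; by rewrite nth_default// mul0r.
Qed.

(** The recursion is linear in the coefficients: multiplying by [X - y] cancels the term of Leibniz'
    rule that keeps the node [y]. *)
Lemma divdiff_poly_factor g y ys : divdiff_poly (('X - y%:P) * g) (y :: ys) = divdiff_poly g ys.
Proof.
pose n := size g.
have s1 : (size (('X - y%:P) * g)%R <= n.+1)%N.
  by apply: leq_trans (size_polyMleq _ _) _; rewrite size_XsubC.
rewrite (divdiff_poly_widen _ s1) (divdiff_poly_widen ys (leqnn n)).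
under eq_bigr do rewrite mulrBl coefB mulrBl coefXM coefCM.
rewrite sumrB big_ord_recl /= mul0r add0r big_ord_recr /= [g`_n]nth_default// mulr0 mul0r addr0.
rewrite -sumrB; apply: eq_bigr => a _ /=; ring.
Qed.

End DividedDifferences.

Lemma divdiff_poly_roots (K : fieldType) (g : {poly K}) ys : uniq ys -> all (root g) ys ->
  divdiff_poly g ys = 0.
Proof.
elim: ys g => [|y ys IH] g; first by rewrite /divdiff_poly big1// => i _; rewrite divdiff_nil mulr0.
move=> /= /andP[yys uys] /andP[/factor_theorem[h ->] gys].
rewrite mulrC divdiff_poly_factor; apply: IH => //; apply/allP => z zys.
have /allP/(_ z zys) := gys; rewrite rootM root_XsubC => /orP[//|/eqP zy].
by rewrite -zy zys in yys.
Qed.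

(** A row vector killed by the matrix is a combination of the binomial polynomials of degree j < k
    that has k distinct roots in F_p, as the [a i] are below p; so it is zero. The factorials j! are
    invertible because k <= p. *)
Lemma binomial_matrix_unit p k (a : 'I_k -> nat) : prime p -> (forall i, (a i < p)%N) -> injective a ->
  \det (\matrix_(j < k, i < k) ('C(a i, j)%:R : 'F_p)) != 0.
Proof.
move=> pp ap a_inj; apply/det0P => -[v v0 vM]; case/negP: v0; apply/eqP.
have kp : (k <= p)%N.
  rewrite -[k]card_ord -[p]card_ord; apply: (leq_card (fun i => Ordinal (ap i))).
  by move=> i j /(congr1 val)/= /a_inj.
have natF n : (n%:R == 0 :> 'F_p) = (p %| n)%N by rewrite -(dvdn_pcharf (pchar_Fp pp)).
have fact0 j : (j < k)%N -> j`!%:R != 0 :> 'F_p.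
  elim: j => [|j IH] jk; first by rewrite oner_eq0.
  by rewrite factS natrM mulf_neq0 ?IH ?(ltnW jk)// natF gtnNdvd// (leq_trans jk).
pose Q : {poly 'F_p} := \sum_(j < k) (v 0 j / j`!%:R) *: \prod_(l < j) ('X - l%:R%:P).
have QE (n : nat) : Q.[n%:R] = \sum_(j < k) v 0 j * 'C(n, j)%:R.
  rewrite horner_sum; apply: eq_bigr => j _; rewrite hornerZ horner_prod.
  have -> : \prod_(l < j) ('X - l%:R%:P).[n%:R] = (n ^_ j)%:R :> 'F_p.
    have [jn|nj] := leqP j n; last first.
      by rewrite ffact_small// (bigD1 (Ordinal nj))//= hornerXsubC subrr mul0r.
    rewrite ffact_prod natr_prod; apply: eq_bigr => l _.
    by rewrite hornerXsubC natrB// ltnW// (leq_trans (ltn_ord l)).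
  by rewrite -bin_ffact natrM mulrACA mulVf ?mulr1// fact0.
have Q0 : Q = 0.
  apply/eqP/negPn/negP => Qn0.
  have : (size [seq (a i)%:R : 'F_p | i <- enum 'I_k] < size Q)%N.
    apply: (max_poly_roots Qn0).
      apply/allP => _ /mapP[i _ ->]; rewrite rootE QE.
      have := congr1 (fun A : 'rV_k => A 0 i) vM; rewrite !mxE => E; apply/eqP; rewrite -[RHS]E.
      by apply: eq_bigr => j _; rewrite mxE.
    rewrite map_inj_uniq ?enum_uniq// => i j E; apply: a_inj.
    move/(congr1 val): E; rewrite /= !val_Fp_nat// !modn_small//.
  rewrite size_map size_enum_ord ltnNge; apply/negP/negPn.
  apply: leq_trans (size_sum _ _ _) _; apply/bigmax_leqP => j _.
  apply: leq_trans (size_scale_leq _ _) _; rewrite size_prod_XsubC.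
  by rewrite -[index_enum _]enumT size_enum_ord.
(* The binomial polynomials are triangular on 0, 1, 2, ...: at [n] those of degree above [n] vanish,
   and the one of degree [n] is 1. *)
suff vj n : forall j : 'I_k, (j < n)%N -> v 0 j = 0 by apply/rowP => j; rewrite mxE (vj k).
elim: n => // n IH j; rewrite ltnS leq_eqVlt => /orP[/eqP jn|]; last exact: IH.
have := QE n; rewrite Q0 horner0 (bigD1 j)//= jn binn mulr1 big1 ?addr0// => i ij.
have [ni|] := ltnP n i; first by rewrite bin_small// mulr0.
by rewrite leq_eqVlt => /orP[/eqP E|/IH->]; [case/eqP: ij; apply: val_inj; rewrite /= E jn | rewrite mul0r].
Qed.

Definition coef_support (K : fieldType) p (g : {poly K}) : {set 'I_p} := [set a : 'I_p | g`_a != 0].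

(* Divided differences at the roots give relations with coefficients in Z[zeta]
   whose determinant specializes, at zeta = 1, to a determinant of binomial coefficients. *)
Theorem chebotarev (K : numFieldType) (p : nat) (zeta : K) (g : {poly K}) (B : {set 'I_p}) :
  prime p -> p.-primitive_root zeta -> g != 0 -> (size g <= p)%N ->
  (forall b, b \in B -> root g (zeta ^+ b)) -> (#|B| < #|coef_support p g|)%N.
Proof.
move=> pp zp g0 gp gB; set A := coef_support p g; rewrite ltnNge; apply/negP => AB.
have zetap := prim_expr_order zp.
have zeta1 : zeta != 1.
  have := eq_prim_root_expr zp 1 0; rewrite expr0 expr1 => ->.
  by rewrite !modn_small ?prime_gt0 ?prime_gt1.
pose k := #|A|; pose a (i : 'I_k) : 'I_p := enum_val i.
pose b (j : nat) : 'I_p := nth (Ordinal (prime_gt0 pp)) (enum B) j.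
pose pts (T : comNzRingType) (y : nat -> T) j := rev [seq y l | l <- iota 0 j].
have ptsS (T : comNzRingType) (y : nat -> T) j : pts T y j.+1 = y j :: pts T y j.
  by rewrite /pts -addn1 iotaD map_cat rev_cat.
have pts_map (T T' : comNzRingType) (phi : {rmorphism T -> T'}) y j :
    map phi (pts T y j) = pts T' (phi \o y) j by rewrite /pts map_rev -map_comp.
(* Row j has the nodes [X^(b 0), ..., X^(b j)]. At [X = zeta] they are distinct roots of [g]; at
   [X = 1] they all collapse to 1. *)
pose N : 'M[{poly int}]_k := \matrix_(j, i) divdiff (a i) (pts _ (fun l => 'X^(b l)) j.+1).
pose ev : {rmorphism {poly int} -> K} := horner_eval zeta \o map_poly intr.
pose ev1 : {rmorphism {poly int} -> int} := horner_eval 1.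
pose c : 'cV[K]_k := \col_i g`_(a i).
have Nc : map_mx ev N *m c = 0.
  apply/colP => j; rewrite !mxE.
  transitivity (divdiff_poly g (pts K (fun l => zeta ^+ b l) j.+1)).
    rewrite (divdiff_poly_widen _ gp) (bigID (mem A))/= [X in _ = _ + X]big1 ?addr0; last first.
      by move=> x; rewrite inE negbK => /eqP ->; rewrite mul0r.
    rewrite [RHS]big_enum_val; apply: eq_bigr => i _; rewrite !mxE mulrC divdiff_morph pts_map.
    congr (_ * divdiff _ (pts _ _ _)); apply/funext => l.
    by rewrite /ev /= map_polyXn /horner_eval hornerXn.
  have lB l : (l < j.+1)%N -> (l < size (enum B))%N.
    by move=> lj; rewrite -cardE; apply: leq_trans AB; apply: leq_trans lj (ltn_ord j).
  apply: divdiff_poly_roots; rewrite /pts ?rev_uniq ?all_rev.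
    rewrite map_inj_in_uniq ?iota_uniq// => l l'; rewrite !mem_iota !add0n /= => lj lj' /eqP.
    rewrite (eq_prim_root_expr zp) !modn_small ?ltn_ord// => /eqP/val_inj/eqP.
    by rewrite nth_uniq ?enum_uniq ?lB// => /eqP.
  apply/allP => _ /mapP[l + ->]; rewrite mem_iota add0n /= => /lB lj.
  by apply: gB; rewrite -mem_enum mem_nth.
have detN : \det (map_mx ev N) = 0.
  apply/eqP; apply: contraT; rewrite -unitfE -unitmxE => Nu.
  have c0 : c = 0 by rewrite -(mulKmx Nu c) Nc mulmx0.
  have gs : ((size g).-1 < p)%N by rewrite prednK ?size_poly_gt0.
  have gA : Ordinal gs \in A by rewrite inE /= -lead_coefE lead_coef_eq0.
  have := congr1 (fun M : 'cV_k => M (enum_rank_in gA (Ordinal gs)) 0) c0.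
  by rewrite !mxE /a enum_rankK_in// => /eqP; move: gA; rewrite inE => /negPf ->.
(* The determinant vanishes at [zeta], so its value at 1 is divisible by p; but that value is a
   determinant of binomial coefficients, invertible in F_p. *)
have : (p %| (\det N).[1])%Z.
  by apply: (prime_root_eval pp zetap zeta1); rewrite rootE -[_.[_]]/(ev (\det N)) -det_map_mx detN.
rewrite -[_.[1]]/(ev1 (\det N)) -det_map_mx => /dvdzP[q qE].
have /eqP := binomial_matrix_unit pp (fun i => ltn_ord (a i)) (inj_comp val_inj enum_val_inj).
case; transitivity ((\det (map_mx ev1 N))%:~R : 'F_p); last first.
  by rewrite qE intrM -[p%:~R]/(p%:R) pchar_Fp_0// mulr0.
rewrite -det_map_mx; congr (\det _); apply/matrixP => j i; rewrite !mxE divdiff_morph pts_map.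
have -> : pts int (ev1 \o (fun l => 'X^(b l))) j.+1 = nseq j.+1 1.
  by elim: j.+1 => // l IH; rewrite ptsS IH /= /horner_eval hornerXn expr1n.
by rewrite divdiff1 rmorph_nat.
Qed.

Module CompleteIntersections.
Import ssrcomplements mpoly.

(** * Ideals and dual bases of complete intersections *)

Definition is_ideal (S : comNzRingType) (J : set S) : Prop :=
  [/\ J 0, forall p q, J p -> J q -> J (p + q) & forall p q, J q -> J (p * q)].

Definition span (S : comNzRingType) (I : finType) (f : I -> S) : set S :=
  [set p | exists h : I -> S, p = \sum_i h i * f i].

Section Ideals.
Variables (S : comNzRingType).
Implicit Types (J : set S) (p q : S).

Lemma span_ideal (I : finType) (f : I -> S) : is_ideal (span f).
Proof.
split.
- by exists (fun=> 0); rewrite big1// => i _; rewrite mul0r.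
- move=> _ _ [h ->] [k ->]; exists (fun i => h i + k i).
  by rewrite -big_split; apply: eq_bigr => i _; rewrite mulrDl.
- move=> p _ [h ->]; exists (fun i => p * h i).
  by rewrite mulr_sumr; apply: eq_bigr => i _; rewrite mulrA.
Qed.

Lemma span_gen (I : finType) (f : I -> S) i : span f (f i).
Proof.
exists (fun j => (j == i)%:R); rewrite (bigD1 i)//= eqxx mul1r big1 ?addr0// => j /negPf->.
by rewrite mul0r.
Qed.

Lemma span_sub (I : finType) (f : I -> S) J : is_ideal J -> (forall i, J (f i)) ->
  forall p, span f p -> J p.
Proof. by case=> J0 JD JM fJ _ [h ->]; elim/big_ind: _ => // i _; exact: JM. Qed.

Lemma idealM J : is_ideal J -> forall p q, J p -> J (p * q).
Proof. by case=> _ _ JM p q Jp; rewrite mulrC; exact: JM. Qed.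

Lemma idealN J : is_ideal J -> forall p, J p -> J (- p).
Proof. by case=> _ _ JM p Jp; rewrite -mulN1r; exact: JM. Qed.

Lemma idealB J : is_ideal J -> forall p q, J p -> J q -> J (p - q).
Proof. by move=> JI p q Jp Jq; have [_ JD _] := JI; apply: JD => //; exact: idealN. Qed.

Lemma ideal_sum J (I : Type) (r : seq I) (P : pred I) (F : I -> S) : is_ideal J ->
  (forall i, P i -> J (F i)) -> J (\sum_(i <- r | P i) F i).
Proof. by case=> J0 JD _ H; elim/big_ind: _. Qed.

Definition add_ideal J J' : set S := [set p | exists a b, [/\ J a, J' b & p = a + b]].

Lemma add_idealP J J' : is_ideal J -> is_ideal J' -> is_ideal (add_ideal J J').
Proof.
move=> [J0 JD JM] [J0' JD' JM']; split.
- by exists 0, 0; rewrite addr0.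
- move=> _ _ [a [b [Ja Jb ->]]] [c [d [Jc Jd ->]]]; exists (a + c), (b + d).
  by split; [exact: JD | exact: JD' | rewrite addrACA].
- move=> p _ [a [b [Ja Jb ->]]]; exists (p * a), (p * b).
  by split; [exact: JM | exact: JM' | rewrite mulrDr].
Qed.

Lemma add_ideal_l J J' p : is_ideal J' -> J p -> add_ideal J J' p.
Proof. by case=> J0 _ _ Jp; exists p, 0; rewrite addr0. Qed.

Lemma add_ideal_r J J' p : is_ideal J -> J' p -> add_ideal J J' p.
Proof. by case=> J0 _ _ Jp; exists 0, p; rewrite add0r. Qed.

End Ideals.
Arguments ideal_sum {S J I r P F}.

(** * Determinants with Koszul rows modulo an ideal *)

Section KoszulRows.
Variables (T : comNzRingType) (m : nat) (J : set T) (z : 'I_m -> T).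
Hypothesis JI : is_ideal J.
Implicit Types M : 'M[T]_m.

Let zv : 'cV[T]_m := \col_j z j.

(* Expand [adj M' * (M' z) = det M' * z] for the matrix M' obtained from M by
   replacing row i by the unit row e_j: its cofactors along row i are those of M. *)
Lemma cofactor_koszul M i j l : (forall k, k != i -> J ((M *m zv) k 0)) ->
  J (z l * cofactor M i j - z j * cofactor M i l).
Proof.
move=> MJ; have [_ _ JM] := JI.
pose M' : 'M[T]_m := \matrix_(k, c) if k == i then (c == j)%:R else M k c.
have rM : row' i M' = row' i M.
  by apply/matrixP => k c; rewrite !mxE eq_sym (negPf (neq_lift _ _)).
have cM c : cofactor M' i c = cofactor M i c.
  rewrite /cofactor; congr (_ * \det _).
  by apply/matrixP => k d; have := congr1 (fun A : 'M_(_, _) => A k (lift c d)) rM; rewrite !mxE.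
have M'z k : (M' *m zv) k 0 = if k == i then z j else (M *m zv) k 0.
  rewrite !mxE; case: eqP => [->|/eqP ki].
    under eq_bigr do rewrite !mxE eqxx.
    rewrite (bigD1 j)//= eqxx mul1r big1 ?addr0// => c /negPf->.
    by rewrite mul0r.
  by apply: eq_bigr => c _; rewrite !mxE (negPf ki).
have detM' : \det M' = cofactor M i j.
  rewrite (expand_det_row M' i) (bigD1 j)//= !mxE !eqxx mul1r cM big1 ?addr0// => c cj.
  by rewrite !mxE eqxx (negPf cj) mul0r.
have := congr1 (fun A : 'cV[T]_m => A l 0) (mulmxA (\adj M') M' zv).
rewrite mul_adj_mx mul_scalar_mx [RHS]mxE [zv l 0]mxE detM' => E.
have -> : z l * cofactor M i j - z j * cofactor M i l =
    \sum_(k | k != i) (\adj M') l k * (M' *m zv) k 0.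
  rewrite [z l * _]mulrC -E mxE (bigD1 i)//= M'z eqxx mxE cM.
  by rewrite addrAC [_ * z j]mulrC subrr add0r.
by apply: ideal_sum => // k ki; apply: JM; rewrite M'z (negPf ki); exact: MJ.
Qed.

Lemma det_row_ideal M i : (forall j, J (M i j)) -> J (\det M).
Proof.
move=> MJ; rewrite (expand_det_row M i); apply: ideal_sum => // j _.
by apply: idealM.
Qed.

Variables (I : Type) (r : seq I) (p q : I -> 'I_m -> T).

(** Row [i] is antisymmetric in the pairs (l, j), so its expansion groups the terms into the
    two-term expressions of [cofactor_koszul]. *)
Lemma det_koszul_row M i : (forall k, k != i -> J ((M *m zv) k 0)) ->
  (forall j, M i j = \sum_(k <- r) (\sum_(l < m | (l < j)%N) z l * p k j * q k l -
                       \sum_(l < m | (j < l)%N) z l * p k l * q k j)) ->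
  J (\det M).
Proof.
move=> MJ ME; have [_ _ JM] := JI.
have -> : \det M = \sum_(k <- r) \sum_(l < m) \sum_(j < m | (l < j)%N)
     p k j * q k l * (z l * cofactor M i j - z j * cofactor M i l).
  rewrite (expand_det_row M i).
  under eq_bigr do rewrite ME mulr_suml.
  rewrite exchange_big/=; apply: eq_bigr => k _.
  transitivity (\sum_(j < m) (\sum_(l < m | (l < j)%N) z l * p k j * q k l * cofactor M i j)
     - \sum_(j < m) (\sum_(l < m | (j < l)%N) z l * p k l * q k j * cofactor M i j)).
    by rewrite -sumrB; apply: eq_bigr => j _; rewrite mulrBl !mulr_suml.
  rewrite (exchange_big_dep xpredT)//= -sumrB; apply: eq_bigr => l _.
  by rewrite -sumrB; apply: eq_bigr => j _; ring.
apply: ideal_sum => // k _; apply: ideal_sum => // l _; apply: ideal_sum => // j _.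
by apply: JM; exact: cofactor_koszul.
Qed.

End KoszulRows.

(** The rows of [B] are exchanged for those of [A] one at a time; by multilinearity each exchange
    changes the determinant by one whose row [i] is the difference of the two rows. *)
Lemma det_rows_congr (T : comNzRingType) m (J : set T) (A B : 'M[T]_m) : is_ideal J ->
  (forall i (M : 'M[T]_m), (forall k, k != i -> row k M = row k A \/ row k M = row k B) ->
     row i M = row i A - row i B -> J (\det M)) ->
  J (\det A - \det B).
Proof.
move=> JI H; have [J0 JD JM] := JI.
pose M r : 'M[T]_m := \matrix_(k, j) if (k < r)%N then A k j else B k j.
suff : forall r, (r <= m)%N -> J (\det (M r) - \det (M 0%N)).
  have MA : M m = A by apply/matrixP => k j; rewrite mxE ltn_ord.
  have MB : M 0%N = B by apply/matrixP => k j; rewrite mxE.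
  by move=> /(_ m (leqnn m)); rewrite MA MB.
elim=> [_|r IH rm]; first by rewrite subrr.
have -> : \det (M r.+1) - \det (M 0%N) = (\det (M r.+1) - \det (M r)) + (\det (M r) - \det (M 0%N)).
  by rewrite addrA subrK.
apply: JD; last exact/IH/ltnW.
pose i := Ordinal rm.
pose N : 'M[T]_m := \matrix_(k, j) if k == i then A k j - B k j else M r k j.
have ltE (k : 'I_m) : k != i -> (k < r.+1)%N = (k < r)%N.
  move=> ki; rewrite ltnS leq_eqVlt; case: eqP => // kr.
  by case/eqP: ki; exact: val_inj.
have -> : \det (M r.+1) - \det (M r) = \det N.
  have -> : \det (M r.+1) = 1 * \det (M r) + 1 * \det N.
    apply: (determinant_multilinear (i0 := i)).
    - apply/rowP => j; rewrite !mxE eqxx ltnS leqnn ltnn !mul1r; ring.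
    - by apply/matrixP => k j; rewrite !mxE ltE// eq_sym neq_lift.
    - apply/matrixP => k j; have ki : lift i k != i by rewrite eq_sym neq_lift.
      by rewrite !mxE ltE// (negPf ki).
  by rewrite !mul1r addrAC subrr add0r.
apply: (H i) => [k ki|].
  have [kr|kr] := boolP (k < r)%N; [left|right]; apply/rowP => j;
  by rewrite !mxE (negPf ki) ?kr ?(negPf kr).
by apply/rowP => j; rewrite !mxE eqxx.
Qed.


Lemma mpoly_ring_ind (A : comNzRingType) m (P : {mpoly A[m]} -> Prop) :
  (forall c, P c%:MP) -> (forall i p, P p -> P ('X_i * p)) ->
  (forall p q, P p -> P q -> P (p + q)) -> forall p, P p.
Proof.
move=> PC PX PD; elim/mpolyind => [|c a p _ _ Pp]; first by rewrite -(mpolyC0 m); exact: PC.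
apply: PD => //; rewrite -mul_mpolyC mulrC mpolyXE_id.
elim: (index_enum _) => [|i s IH]; first by rewrite big_nil mul1r.
rewrite big_cons -mulrA; move: (_ * c%:MP) IH => q Pq.
by elim: (a i) => [|k IH]; rewrite ?expr0 ?mul1r// exprS -mulrA; exact: PX.
Qed.

(* The residue functional of the monic polynomials g_i(X_i): on one variable it
   sends X^k to the coefficient of degree [size g - 2] of X^k mod g. *)
Section Residue.
Variables (A : comNzRingType) (m : nat) (c : 'I_m -> nat -> A).
Local Notation S := {mpoly A[m]}.

Definition residue (p : S) : A := \sum_(a <- msupp p) p@_a * \prod_i c i (a i).

Lemma residue_is_additive : additive residue.
Proof.
have E k (p : S) : (msize p <= k)%N ->
    residue p = \sum_(a : 'X_{1..m < k}) p@_a * \prod_i c i (a i).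
  move=> pk; rewrite /residue (big_mksub 'X_{1..m < k}) ?msupp_uniq//=; first last.
    by move=> x /msize_mdeg_lt /leq_trans; apply.
  by rewrite big_rmcond//= => i /memN_msupp_eq0->; rewrite mul0r.
move=> p q; pose k := maxn (msize (p - q)) (maxn (msize p) (msize q)).
rewrite !(E k) ?leq_max ?leqnn ?orbT// -sumrB; apply: eq_bigr => a _.
by rewrite mcoeffB mulrBl.
Qed.
HB.instance Definition _ := GRing.isZmodMorphism.Build S A residue residue_is_additive.

Lemma residueX a : residue 'X_[a] = \prod_i c i (a i).
Proof. by rewrite /residue msuppX big_seq1 mcoeffX eqxx mul1r. Qed.

Lemma residueCM x p : residue (x%:MP * p) = x * residue p.
Proof.
elim/mpolyind: p => [|y a p _ _ IH]; first by rewrite mulr0 raddf0 mulr0.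
rewrite mulrDr !raddfD/= mulrDr IH; congr (_ + _).
have resZ z : residue (z *: 'X_[a]) = z * \prod_i c i (a i).
  have [->|z0] := eqVneq z 0; first by rewrite scale0r raddf0 mul0r.
  by rewrite /residue msuppMCX// big_seq1 mcoeffZ mcoeffX eqxx mulr1.
by rewrite mul_mpolyC scalerA !resZ mulrA.
Qed.

(** The condition on [c i] is the linear recurrence with characteristic polynomial [q]; it kills the
    multiples of [q(X_i)] monomial by monomial. *)
Lemma residue_kill (q : {poly A}) i : (forall k, \sum_(j < size q) q`_j * c i (k + j) = 0) ->
  forall p, residue ((map_poly (@mpolyC m A) q).['X_i] * p) = 0.
Proof.
move=> q0; elim/mpolyind => [|y a p _ _ IH]; first by rewrite mulr0 raddf0.
rewrite mulrDr raddfD/= IH addr0 -mul_mpolyC mulrCA residueCM.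
suff -> : residue ((map_poly (@mpolyC m A) q).['X_i] * 'X_[a]) = 0 by rewrite mulr0.
have sz : (size (map_poly (@mpolyC m A) q) <= size q)%N by exact: size_poly.
rewrite (horner_coef_wide _ sz) mulr_suml raddf_sum/=.
transitivity ((\sum_(j < size q) q`_j * c i (a i + j)%N) * \prod_(j | j != i) c j (a j)).
  rewrite mulr_suml.
  apply: eq_bigr => j _; rewrite coef_map/= -mulrA residueCM -mulrA; congr (_ * _).
  rewrite mpolyXn -mpolyXD residueX (bigD1 i)//=; congr (_ * _).
    by rewrite mnmDE mulmnE mnm1E eqxx mul1n addnC.
  apply: eq_bigr => l li; rewrite mnmDE mulmnE mnm1E.
  by rewrite eq_sym (negPf li) mul0n add0n.
by rewrite q0 mul0r.
Qed.

End Residue.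

Section ResidueCoefficients.
Variables (A : comNzRingType) (g : {poly A}).
Hypotheses (gm : g \is monic) (g1 : (1 < size g)%N).
Import Pdiv.RingMonic Pdiv.Ring.

Definition residue_coef (k : nat) : A := (rmodp 'X^k g)`_(size g).-2.

Lemma residue_coef_small k : (k < (size g).-1)%N -> residue_coef k = (k == (size g).-2)%:R.
Proof.
move=> kg; rewrite /residue_coef rmodp_small ?size_polyXn; last by case: (size g) kg => //= d; rewrite ltnS.
by rewrite coefXn eq_sym.
Qed.

Lemma residue_coef_rec k : \sum_(j < size g) g`_j * residue_coef (k + j) = 0.
Proof.
transitivity ((rmodp ('X^k * g) g)`_(size g).-2); last first.
  by rewrite rmodp_mull// coef0.
have -> : 'X^k * g = \sum_(j < size g) 'X^k * (g`_j *: 'X^j).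
  by rewrite -mulr_sumr -poly_def coefK.
rewrite rmodp_sum// coef_sum.
by apply: eq_bigr => j _; rewrite -scalerAr -exprD rmodpZ// coefZ.
Qed.

End ResidueCoefficients.


(** Leibniz' rule takes the left factor after, and the right factor before, the change of variable
    j. Moving the left one on to all new variables and the right one back to all old ones costs two
    telescoping sums, which make up the Koszul part. *)
Lemma koszul_entry (A : comNzRingType) m (z p q : 'I_m -> A) (j : 'I_m) (x' x'' y y0 : A) :
  y - y0 = \sum_(l < m | (l < j)%N) z l * q l ->
  x'' - x' = \sum_(l < m | (j < l)%N) z l * p l ->
  x' * q j + p j * y = (\sum_(l < m | (l < j)%N) z l * p j * q l -
    \sum_(l < m | (j < l)%N) z l * p l * q j) + p j * y0 + x'' * q j.
Proof.
move=> e2 e1; under eq_bigr do rewrite mulrAC.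
by rewrite -!mulr_suml -e1 -e2; ring.
Qed.

Lemma shift_mul (A : comNzRingType) (x y g h : A) : y * (g * h) = x * (g * h) + (y - x) * g * h.
Proof. ring. Qed.

Lemma shift_mul2 (A : comNzRingType) (x G g g' h p : A) :
  (x * G + (g - g') * h) * p = x * (p * G) + (g * (p * h) - g' * (p * h)).
Proof. ring. Qed.

Lemma shift_mul3 (A : comNzRingType) (x t g h p : A) :
  x * t - g * h - x * p = x * (t - p) - h * g.
Proof. ring. Qed.

Lemma mul_rot (A : comNzRingType) (x y z : A) : x * (y * z) = z * (x * y).
Proof. ring. Qed.

Lemma mul_rot4 (A : comNzRingType) (d h f x : A) : d * (h * f) * x = d * f * (h * x).
Proof. ring. Qed.

Lemma mulrAC_A (A : comNzRingType) (a g x : A) : a * g * x = g * (a * x).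
Proof. ring. Qed.

Lemma mul_rot5 (A : comNzRingType) (p d x c : A) : p * d * (c * x) = c * (d * p * x).
Proof. ring. Qed.

Lemma mul_rot6 (A : comNzRingType) (d x p y : A) : d * (x * p) * y = x * (d * p * y).
Proof. ring. Qed.

Lemma mulr_sum2 (A : comNzRingType) (I : finType) (h : A) (F G : I -> A) :
  h * (\sum_i F i + \sum_i G i) = \sum_i h * F i + \sum_i h * G i.
Proof. by rewrite mulrDr !mulr_sumr. Qed.

Lemma sub_swap (V : zmodType) (p s t : V) : p - s = t - s - (t - p).
Proof. by rewrite opprB [RHS]addrC addrA subrK. Qed.

Lemma add_quotient (A : comNzRingType) (x x' y y' z d e : A) :
  x' - x = z * e -> y' - y = z * d -> x' + y' - (x + y) = z * (e + d).
Proof. by move=> xe yd; rewrite mulrDr -xe -yd opprD addrACA. Qed.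

Lemma row_mulmx_congr (A : comNzRingType) m n (z : 'M[A]_(m, n)) (M N : 'M[A]_m) k l :
  row k M = row k N -> (M *m z) k l = (N *m z) k l.
Proof.
move=> /rowP H; rewrite !mxE; apply: eq_bigr => j _.
by have := H j; rewrite !mxE => ->.
Qed.

Lemma leibniz_quotient (A : comNzRingType) (x x' y y' z d e : A) :
  x' - x = z * e -> y' - y = z * d -> x' * y' - x * y = z * (x' * d + e * y).
Proof.
by move=> xe yd; rewrite mulrDr mulrCA -yd mulrA -xe mulrBr mulrBl addrA subrK.
Qed.

(** This is the transformation law of Bezoutians. Row [i] of [G - E *m D] is a Koszul row plus
    multiples of the [f0 k]; modulo [J] neither part contributes to a determinant. *)
Lemma det_bezoutian_congr (T : comNzRingType) m (J : set T) (z : 'I_m -> T)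
    (G D E : 'M[T]_m) (dE : 'I_m -> 'I_m -> 'I_m -> T) (f0 : 'I_m -> T) :
  is_ideal J -> (forall k, J (f0 k)) ->
  (forall i, J ((G *m (\col_j z j)) i 0)) ->
  (forall i, J ((E *m D *m (\col_j z j)) i 0)) ->
  (forall i j, G i j = \sum_k
     ((\sum_(l < m | (l < j)%N) z l * dE i k j * D k l -
       \sum_(l < m | (j < l)%N) z l * dE i k l * D k j) + dE i k j * f0 k + E i k * D k j)) ->
  J (\det G - \det (E *m D)).
Proof.
move=> JI Jf Gz EDz GE; have [_ JD JM] := JI.
apply: det_rows_congr => // i M Mk Mi.
have MJ k : k != i -> J ((M *m (\col_j z j)) k 0).
  by move=> ki; case: (Mk k ki) => /(row_mulmx_congr (\col_j z j)) ->.
pose A : 'M[T]_m := \matrix_(k, j) if k == i then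
  \sum_(l <- index_enum 'I_m) (\sum_(l' < m | (l' < j)%N) z l' * dE i l j * D l l' -
   \sum_(l' < m | (j < l')%N) z l' * dE i l l' * D l j) else M k j.
pose B : 'M[T]_m := \matrix_(k, j) if k == i then \sum_l dE i l j * f0 l else M k j.
have -> : \det M = 1 * \det A + 1 * \det B.
  apply: (determinant_multilinear (i0 := i)).
  - rewrite !scale1r Mi; apply/rowP => j; rewrite !mxE eqxx GE.
    by rewrite -sumrB -big_split; apply: eq_bigr => k _; rewrite addrK.
  - by apply/matrixP => k j; rewrite !mxE eq_sym (negPf (neq_lift _ _)).
  - by apply/matrixP => k j; rewrite !mxE eq_sym (negPf (neq_lift _ _)).
rewrite !mul1r; apply: JD.
  apply: (det_koszul_row (z := z) (i := i) (r := index_enum 'I_m) (p := dE i) (q := D) JI).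
    move=> k ki; rewrite (_ : (A *m _) k 0 = (M *m (\col_j z j)) k 0); first exact: MJ.
    by rewrite !mxE; apply: eq_bigr => j _; rewrite !mxE (negPf ki).
  by move=> j; rewrite mxE eqxx.
apply: (det_row_ideal JI (i := i)) => j; rewrite mxE eqxx.
by apply: ideal_sum => // l _; exact: JM.
Qed.

(* Two sets of variables: 'X_i of [{mpoly S[m]}] is written u_i below, while X_i
   is the constant ['X_i%:MP]; [mixed j] evaluates at (u_0, .., u_(j-1), X_j, ..). *)
Section Bezoutian.
Variables (R : idomainType) (m : nat).
Local Notation S := {mpoly R[m]}.
Local Notation T := {mpoly S[m]}.

Let emb : {rmorphism R -> T} := (@mpolyC m S \o @mpolyC m R).

Definition mixed (j : nat) (p : S) : T :=
  mmap emb (fun i : 'I_m => if (i < j)%N then 'X_i else ('X_i)%:MP) p.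

HB.instance Definition _ j := GRing.RMorphism.copy (mixed j)
  (mmap emb (fun i : 'I_m => if (i < j)%N then 'X_i else ('X_i)%:MP)).

Lemma mixedC j c : mixed j c%:MP = (c%:MP)%:MP.
Proof. exact: mmapC. Qed.

Lemma mixedX j i : mixed j 'X_i = if (i < j)%N then 'X_i else ('X_i)%:MP.
Proof. by rewrite /mixed mmapX mmap1U. Qed.

Lemma mixed0 p : mixed 0 p = p%:MP.
Proof.
elim/mpoly_ring_ind: p => [c|i p IH|p q IHp IHq]; first exact: mixedC.
  by rewrite rmorphM/= mixedX IH rmorphM.
by rewrite rmorphD/= IHp IHq rmorphD.
Qed.

Definition var_diff (j : 'I_m) : T := 'X_j - ('X_j)%:MP.

Lemma var_diff_neq0 j : var_diff j != 0.
Proof.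
apply/eqP => /(congr1 (mcoeff U_(j))) /eqP.
rewrite mcoeffB mcoeff0 mcoeffX mcoeffC eqxx (_ : (U_(j)%MM == 0%MM) = false) ?mulr0 ?subr0 ?oner_eq0//.
by apply/negP => /eqP/(congr1 mdeg); rewrite mdeg1 mdeg0.
Qed.

Lemma divided_difference_exists (j : 'I_m) (p : S) :
  exists d, mixed j.+1 p - mixed j p = var_diff j * d.
Proof.
elim/mpoly_ring_ind: p => [c|i p [d IH]|p q [d IHp] [e IHq]].
- by exists 0; rewrite !mixedC subrr mulr0.
- rewrite !rmorphM/=.
  have [e E] : exists e, mixed j.+1 'X_i - mixed j 'X_i = var_diff j * e.
    rewrite !mixedX ltnS; case: (ltngtP i j) => ij; try by exists 0; rewrite subrr mulr0.
    by exists 1; rewrite mulr1 /var_diff (val_inj ij).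
  by exists (mixed j.+1 'X_i * d + e * mixed j p); exact: leibniz_quotient.
- by exists (d + e); rewrite !rmorphD/=; exact: add_quotient.
Qed.

Definition divided_difference (j : 'I_m) (p : S) : T :=
  projT1 (cid (divided_difference_exists j p)).

Lemma divided_differenceE (j : 'I_m) p :
  mixed j.+1 p - mixed j p = var_diff j * divided_difference j p.
Proof. by rewrite /divided_difference; case: cid. Qed.

Lemma divided_difference_uniq (j : 'I_m) p d :
  mixed j.+1 p - mixed j p = var_diff j * d -> divided_difference j p = d.
Proof.
move=> E; apply: (mulfI (var_diff_neq0 j)).
exact: etrans (esym (divided_differenceE j p)) E.
Qed.

Lemma divided_differenceD (j : 'I_m) p q :
  divided_difference j (p + q) = divided_difference j p + divided_difference j q.
Proof.
by apply: divided_difference_uniq; rewrite !rmorphD/=; apply: add_quotient; exact: divided_differenceE.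
Qed.

Lemma divided_difference0 (j : 'I_m) : divided_difference j 0 = 0.
Proof. by apply: divided_difference_uniq; rewrite !rmorph0 subrr mulr0. Qed.

Lemma divided_differenceM (j : 'I_m) p q : divided_difference j (p * q) =
  mixed j.+1 p * divided_difference j q + divided_difference j p * mixed j q.
Proof.
apply: divided_difference_uniq; rewrite !rmorphM/=.
by apply: leibniz_quotient; exact: divided_differenceE.
Qed.

Lemma mixed_le (i j : nat) p : (i <= j <= m)%N ->
  mixed j p - mixed i p = \sum_(l < m | (i <= l < j)%N) var_diff l * divided_difference l p.
Proof.
move=> /andP[ij]; elim: j ij => [|j IH].
  by rewrite leqn0 => /eqP-> _; rewrite subrr big1// => l; rewrite ltn0 andbF.
rewrite leq_eqVlt => /orP[/eqP<-|]; first by rewrite subrr big1// => l; lia.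
rewrite ltnS => ij jm.
rewrite (bigD1 (Ordinal jm))/= ?ij ?ltnS ?leqnn// -divided_differenceE/=.
rewrite -[LHS](subrKA (mixed j p)); congr (_ + _).
rewrite IH//; last exact: ltnW.
apply: eq_bigl => l; rewrite -val_eqE/=; lia.
Qed.

Variables (f : 'I_m -> S) (g : 'I_m -> {poly R}) (F : 'M[S]_m).
Hypothesis gm : forall i, g i \is monic.
Hypothesis g1 : forall i, (1 < size (g i))%N.
Local Notation gX i := ((map_poly (@mpolyC m R) (g i)).['X_i]).
Hypothesis gF : forall i, gX i = \sum_k F i k * f k.

(** Modulo [J] the old variables satisfy the [f i] and the new ones the [gX i]. The residue [tau] in
    the new variables kills the second family and sends multiples of the first into [span f]. *)
Let J : set T := add_ideal (span (fun i => (f i)%:MP)) (span (fun i => mixed m (gX i))).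

Let J_ideal : is_ideal J.
Proof. by apply: add_idealP; exact: span_ideal. Qed.

Let J_f i p : J (p * (f i)%:MP).
Proof.
have [_ _ JM] := J_ideal; apply: JM; apply: add_ideal_l; first exact: span_ideal.
exact: (span_gen (fun i => (f i)%:MP)).
Qed.

Let J_g i : J (mixed m (gX i)).
Proof.
apply: add_ideal_r; first exact: span_ideal.
exact: (span_gen (fun i => mixed m (gX i))).
Qed.

Let J_gX i : J (mixed 0 (gX i)).
Proof.
rewrite mixed0 gF rmorph_sum/=; apply: ideal_sum => // k _.
by rewrite rmorphM; exact: J_f.
Qed.

Variables G D Fu : 'M[T]_m.
Hypothesis GE : forall i j, G i j = divided_difference j (gX i).
Hypothesis DE : forall k j, D k j = divided_difference j (f k).
Hypothesis FuE : forall i k, Fu i k = mixed m (F i k).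
Let z : 'cV[T]_m := \col_j var_diff j.
Let diffE p : \sum_j divided_difference j p * var_diff j = mixed m p - mixed 0 p.
Proof.
rewrite mixed_le ?leqnn//.
transitivity (\sum_j var_diff j * divided_difference j p).
  by apply: eq_bigr => j _; rewrite mulrC.
by apply: eq_bigl => l; rewrite ltn_ord.
Qed.

Let Gz i : J ((G *m z) i 0).
Proof.
have -> : (G *m z) i 0 = mixed m (gX i) - mixed 0 (gX i).
  by rewrite mxE -diffE; apply: eq_bigr => j _; rewrite mxE GE.
by apply: idealB; [exact: J_ideal | exact: J_g | exact: J_gX].
Qed.

Let FDz i : J ((Fu *m D *m z) i 0).
Proof.
have -> : (Fu *m D *m z) i 0 = mixed m (gX i) - \sum_j mixed m (F i j) * (f j)%:MP.
  rewrite -mulmxA mxE gF rmorph_sum -sumrB; apply: eq_bigr => j _.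
  rewrite rmorphM/= -mulrBr FuE; congr (_ * _); rewrite -mixed0 -diffE mxE.
  by apply: eq_bigr => k _; rewrite mxE DE.
apply: idealB; [exact: J_ideal | exact: J_g |].
by apply: ideal_sum => [|j _]; [exact: J_ideal | exact: J_f].
Qed.

Let det_G : J (\det G - \det (Fu *m D)).
Proof.
apply: (det_bezoutian_congr (z := var_diff) (dE := fun i k j => divided_difference j (F i k))
  (f0 := fun k => (f k)%:MP) J_ideal _ Gz FDz).
  by move=> k; rewrite -[_%:MP]mul1r; exact: J_f.
move=> i j; rewrite GE gF.
have -> : divided_difference j (\sum_k F i k * f k) = \sum_k divided_difference j (F i k * f k).
  by elim/big_rec2: _ => [|k x y _ <-]; rewrite ?divided_difference0 ?divided_differenceD.
apply: eq_bigr => k _; rewrite divided_differenceM DE FuE.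
have e1 : mixed m (F i k) - mixed j.+1 (F i k) =
    \sum_(l < m | (j < l)%N) var_diff l * divided_difference l (F i k).
  by rewrite mixed_le ?ltn_ord ?leqnn//; apply: eq_bigl => l; rewrite ltn_ord andbT.
have e2 : mixed j (f k) - (f k)%:MP =
    \sum_(l < m | (l < j)%N) var_diff l * divided_difference l (f k).
  by rewrite -(mixed0 (f k)); apply: mixed_le; rewrite leq0n ltnW.
under [in RHS]eq_bigr do rewrite DE.
exact: (koszul_entry (z := var_diff) (p := fun l => divided_difference l (F i k))
  (q := fun l => divided_difference l (f k)) e2 e1).
Qed.

Let c i k := residue_coef (g i) k.
Let tau : T -> S := residue (fun i k => (c i k)%:MP).
Let tau0 : S -> R := residue c.

Let tauD p q : tau (p + q) = tau p + tau q. Proof. exact: raddfD. Qed.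
Let tauB p q : tau (p - q) = tau p - tau q. Proof. exact: raddfB. Qed.
Let tauCM x p : tau (x%:MP * p) = x * tau p. Proof. exact: residueCM. Qed.
Let tau_sum (I : Type) (r : seq I) (P : pred I) (H : I -> T) :
  tau (\sum_(i <- r | P i) H i) = \sum_(i <- r | P i) tau (H i).
Proof. exact: raddf_sum. Qed.

Let tau_kill i h : tau (mixed m (gX i) * h) = 0.
Proof.
have -> : mixed m (gX i) = (map_poly (@mpolyC m S) (map_poly (@mpolyC m R) (g i))).['X_i].
  rewrite -(horner_map (mixed m))/= mixedX ltn_ord; congr (_.[_]).
  by apply/polyP => k; rewrite !coef_map/= mixedC.
have mpolyC_inj : injective (@mpolyC m R) by move=> x y /eqP; rewrite mpolyC_eq => /eqP.
apply: residue_kill => k; rewrite size_map_inj_poly ?mpolyC0//.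
transitivity ((\sum_(j < size (g i)) (g i)`_j * c i (k + j)%N)%:MP : S).
  by rewrite rmorph_sum; apply: eq_bigr => j _; rewrite coef_map/= rmorphM.
by rewrite residue_coef_rec// mpolyC0.
Qed.

Let tau0_kill i h : tau0 (gX i * h) = 0.
Proof. by apply: residue_kill => k; exact: residue_coef_rec. Qed.

Let tau_mixed p : tau (mixed m p) = (tau0 p)%:MP.
Proof.
elim/mpolyind: p => [|x a p _ _ IH]; first by rewrite /tau /tau0 !raddf0.
rewrite -mul_mpolyC rmorphD rmorphM/= mixedC.
rewrite /tau /tau0 [LHS]raddfD [X in _ = X%:MP]raddfD/= -/tau -/tau0 IH mpolyCD; congr (_ + _).
have -> : mixed m 'X_[a] = 'X_[a].
  by rewrite /mixed mmapX mpolyXE_id; apply: eq_bigr => i _; rewrite ltn_ord.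
by rewrite /tau /tau0 !residueCM !residueX mpolyCM rmorph_prod.
Qed.

Let G_diag i j : j != i -> G i j = 0.
Proof.
move=> ji; rewrite GE; apply: divided_difference_uniq; rewrite mulr0.
have E (k : nat) : mixed k (gX i) = (map_poly (fun x => (x%:MP)%:MP) (g i)).[mixed k 'X_i].
  rewrite -(horner_map (mixed k))/=; congr (_.[_]).
  by apply/polyP => l; rewrite !coef_map/= mixedC coef_map_id0 ?mpolyC0.
rewrite !E !mixedX ltnS leq_eqVlt.
have -> : (i == j :> nat) = false by rewrite eq_sym; exact/negbTE.
by rewrite subrr.
Qed.

Let det_G_prod : \det G = \prod_i G i i.
Proof.
have -> : G = diag_mx (\row_i G i i).
  apply/matrixP => i j; rewrite !mxE; case: eqVneq => [->|ij]; first by rewrite mulr1n.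
  by rewrite mulr0n G_diag// eq_sym.
by rewrite det_diag; apply: eq_bigr => i _; rewrite !mxE eqxx mulr1n.
Qed.

(** The quotient of [g(u) - g(x)] by [u - x] has leading coefficient 1 in u, in degree [size g - 2],
    exactly where the residue is normalised. *)
Let G_expand i : exists2 gam : nat -> S, gam (size (g i)).-2 = 1 &
  G i i = \sum_(a < (size (g i)).-1) (gam a)%:MP * 'X_i ^+ a.
Proof.
set d := (size (g i)).-1.
have sg : size (g i) = d.+1 by rewrite /d prednK// (ltn_trans _ (g1 i)).
pose gam a : S := \sum_(k < d.+1 | (a < k)%N) ((g i)`_k)%:MP * 'X_i ^+ (k.-1 - a).
exists gam.
  rewrite /gam (bigD1 ord_max)/=; last by have := g1 i; rewrite sg; lia.
  rewrite big1 ?addr0 => [|k /andP[k1 k2]]; last first.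
    have := ltn_ord k; move: k2; rewrite -val_eqE/=; lia.
  by have := gm i; rewrite monicE lead_coefE sg /= => /eqP->; rewrite subnn mul1r.
rewrite GE; apply: divided_difference_uniq.
have E (k : nat) : mixed k (gX i) = \sum_(l < d.+1) (((g i)`_l)%:MP)%:MP * mixed k 'X_i ^+ l.
  rewrite (horner_coef_wide (n := d.+1)); last by rewrite -sg; exact: size_poly.
  by rewrite rmorph_sum; apply: eq_bigr => l _; rewrite coef_map rmorphM/= mixedC rmorphXn.
rewrite !E !mixedX ltnSn ltnn -sumrB.
transitivity (\sum_(l < d.+1) var_diff i * \sum_(a < d | (a < l)%N)
    (((g i)`_l)%:MP * 'X_i ^+ (l.-1 - a))%:MP * 'X_i ^+ a).
  apply: eq_bigr => l _; rewrite -mulrBr -opprB subrXX -opprB mulNr opprK mulrCA.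
  congr (_ * _); rewrite mulr_sumr.
  rewrite (big_ord_widen d (fun a => (((g i)`_l)%:MP)%:MP * (('X_i)%:MP ^+ (l.-1 - a) * 'X_i ^+ a))) //.
    by apply: eq_bigr => a _; rewrite rmorphM rmorphXn mulrA.
  by rewrite -ltnS ltn_ord.
rewrite -mulr_sumr; congr (_ * _); rewrite (exchange_big_dep xpredT)//=.
by apply: eq_bigr => a _; rewrite -mulr_suml -rmorph_sum.
Qed.

(** In every variable the residue coefficients vanish below the exponent [size g - 2] and equal 1
    there, so only the leading monomial of the product of the [G i i] contributes. *)
Let tau_det_G : tau (\det G) = 1.
Proof.
have [gam gam1 GG] : exists2 gam : 'I_m -> nat -> S, forall i, gam i (size (g i)).-2 = 1 &
    forall i, G i i = \sum_(a < (size (g i)).-1) (gam i a)%:MP * 'X_i ^+ a.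
  have ex i : exists ga : nat -> S, ga (size (g i)).-2 = 1 /\
      G i i = \sum_(a < (size (g i)).-1) (ga a)%:MP * 'X_i ^+ a.
    by have [ga h1 h2] := G_expand i; exists ga.
  by have [ga gaP] := choice ex; exists ga => i; have [] := gaP i.
pose N := (\max_i (size (g i)).-1)%N.
pose gam' i a : S := if (a < (size (g i)).-1)%N then gam i a else 0.
have sN i : ((size (g i)).-1 <= N)%N by rewrite /N (bigD1 i)//= leq_maxl.
have GN i : G i i = \sum_(a < N) (gam' i a)%:MP * 'X_i ^+ a.
  rewrite GG (big_ord_widen N (fun a => (gam i a)%:MP * 'X_i ^+ a))// big_mkcond/=.
  by apply: eq_bigr => a _; rewrite /gam'; case: ifP; rewrite ?mpolyC0 ?mul0r.
rewrite det_G_prod; under eq_bigr do rewrite GN.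
rewrite bigA_distr_bigA /tau raddf_sum/=.
transitivity (\sum_(phi : {ffun 'I_m -> 'I_N}) \prod_i (gam' i (phi i) * (c i (phi i))%:MP)).
  apply: eq_bigr => phi _; rewrite !big_split/= -rmorph_prod /tau residueCM; congr (_ * _).
  have -> : \prod_i 'X_i ^+ phi i = 'X_[ [multinom (phi i : nat) | i < m] ] :> T.
    by rewrite mpolyXE_id; apply: eq_bigr => i _; rewrite mnmE.
  by rewrite residueX; apply: eq_bigr => i _; rewrite mnmE.
rewrite -(bigA_distr_bigA (fun i (a : 'I_N) => gam' i a * (c i a)%:MP)) big1// => i _.
have dN : ((size (g i)).-2 < N)%N by apply: leq_trans (sN i); have := g1 i; lia.
have dd : ((size (g i)).-2 < (size (g i)).-1)%N by have := g1 i; lia.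
rewrite (bigD1 (Ordinal dN))//= big1 ?addr0 => [|a ad].
  by rewrite /gam' dd gam1 /c residue_coef_small// eqxx mpolyC1 mulr1.
rewrite /gam'; case: ifP => [h|]; last by rewrite mul0r.
have -> : c i a = 0; last by rewrite mpolyC0 mulr0.
rewrite /c residue_coef_small//; case: eqP => // E.
by case/eqP: ad; apply: val_inj.
Qed.

(** [\det G] is a reproducing kernel. Multiplying it by [u_i] instead of [X_i] adds a multiple of
    [gX i] in the new variables, which [tau] kills, minus a multiple of [gX i] in the old ones,
    which lies in [span f]. *)
Let tau_repr p : span f (tau (mixed m p * \det G) - p).
Proof.
have fI := span_ideal f; have [f0 fD fM] := fI.
elim/mpoly_ring_ind: p => [x|i p IH|p q IHp IHq].
- by rewrite mixedC /tau residueCM -/tau tau_det_G mulr1 subrr.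
- have zG : mixed m 'X_i * \det G = ('X_i)%:MP * \det G + (mixed m (gX i) - (gX i)%:MP) * \prod_(j | j != i) G j j.
    rewrite -(mixed0 (gX i)) det_G_prod (bigD1 i)//= mixedX ltn_ord.
    have <- : var_diff i * G i i = mixed m (gX i) - mixed 0 (gX i).
      rewrite -diffE (bigD1 i)//= big1 ?addr0 => [|j ji]; first by rewrite mulrC GE.
      by rewrite -GE G_diag// mul0r.
    exact: shift_mul.
  pose h := mixed m p * \prod_(j | j != i) G j j.
  have E : tau (mixed m ('X_i * p) * \det G) = 'X_i * tau (mixed m p * \det G) - gX i * tau h.
    have E1 : mixed m ('X_i * p) * \det G = ('X_i)%:MP * (mixed m p * \det G) +
        (mixed m (gX i) * h - (gX i)%:MP * h).
      rewrite /h.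
      have -> : mixed m ('X_i * p) = mixed m 'X_i * mixed m p by exact: rmorphM.
      rewrite (mulrAC (mixed m 'X_i) (mixed m p) (\det G)).
      apply: etrans (congr1 (fun x => x * mixed m p) zG) _.
      exact: (shift_mul2 ('X_i)%:MP (\det G) (mixed m (gX i)) (gX i)%:MP
        (\prod_(j | j != i) G j j) (mixed m p)).
    apply: etrans (congr1 tau E1) _; apply: etrans (tauD _ _) _; congr (_ + _).
      exact: tauCM.
    apply: etrans (tauB _ _) _.
    exact: etrans (congr2 (fun x y => x - y) (tau_kill i h) (tauCM _ _)) (sub0r _).
  have E2 : 'X_i * tau (mixed m p * \det G) - gX i * tau h - 'X_i * p =
      'X_i * (tau (mixed m p * \det G) - p) - tau h * gX i by exact: shift_mul3.
  rewrite E E2; apply: (idealB fI); first exact: fM.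
  by apply: fM; rewrite gF; exists (F i).
- have E : tau (mixed m (p + q) * \det G) = tau (mixed m p * \det G) + tau (mixed m q * \det G).
    by rewrite (rmorphD (mixed m)) mulrDl tauD.
  by rewrite E opprD addrACA; exact: fD.
Qed.

Let tau_J p : J p -> forall h, span f (tau (h * p)).
Proof.
have fI := span_ideal f; have [f0 fD fM] := fI.
move=> [_ [_ [[a ->] [b ->] ->]]] h.
pose A i : T := h * (a i * (f i)%:MP); pose B i : T := h * (b i * mixed m (gX i)).
have -> : tau (h * (\sum_i a i * (f i)%:MP + \sum_i b i * mixed m (gX i))) = \sum_i tau (A i) + \sum_i tau (B i).
  rewrite (mulr_sum2 h (fun i => a i * (f i)%:MP) (fun i => b i * mixed m (gX i))).
  exact: etrans (tauD (\sum_i A i) (\sum_i B i)) (f_equal2 +%R (tau_sum _ _ A) (tau_sum _ _ B)).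
apply: fD; apply: (ideal_sum fI) => i _; rewrite /A /B.
  have -> : h * (a i * (f i)%:MP) = (f i)%:MP * (h * a i) by exact: mul_rot.
  by rewrite tauCM mulrC; apply: fM; exact: span_gen.
have -> : h * (b i * mixed m (gX i)) = mixed m (gX i) * (h * b i) by exact: mul_rot.
by rewrite tau_kill.
Qed.

(** In the reproducing formula [\det G] is replaced by [\det Fu * \det D], and [\det D] is expanded
    in monomials of the new variables. Its coefficients are the [dl], and residues against these
    monomials are the [psi]. Such a dual basis makes the quotient a projective module over [R]. *)
Lemma complete_intersection_dual_basis : exists (I : finType) (psi : I -> S -> R) (dl : I -> S),
  [/\ forall i p q, psi i (p + q) = psi i p + psi i q,
      forall i c p, psi i (c%:MP * p) = c * psi i p,
      forall i p, span f p -> psi i p = 0 &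
      forall p, span f (p - \sum_i (psi i p)%:MP * dl i)].
Proof.
have fI := span_ideal f; have [f0 fD fM] := fI.
pose d := \det D.
exists ('X_{1..m < msize d} : finType).
exists (fun (b : 'X_{1..m < msize d}) p => tau0 (\det F * p * 'X_[b])), (fun b : 'X_{1..m < msize d} => d@_b); split.
- by move=> b p q; rewrite mulrDr mulrDl /tau0 raddfD.
- by move=> b x p; rewrite mul_rot6 /tau0 residueCM.
- move=> b _ [h ->]; rewrite mulr_sumr mulr_suml /tau0 raddf_sum/= big1// => k _.
  (* By Cramer's rule [\det F] sends every [f k] into the ideal of the [gX i], on which the residue
     vanishes. *)
  have E : \det F * f k = \sum_i (\adj F) k i * gX i.
    pose fv : 'cV[S]_m := \col_j f j.
    have : (\adj F *m (F *m fv)) k 0 = \det F * f k.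
      by rewrite mulmxA mul_adj_mx mul_scalar_mx !mxE.
    move=> <-; rewrite mxE; apply: eq_bigr => i _; rewrite gF [(F *m fv) i 0]mxE.
    by congr (_ * _); apply: eq_bigr => l _; rewrite mxE.
  have E1 : \det F * (h k * f k) * 'X_[b] = (\sum_i (\adj F) k i * gX i) * (h k * 'X_[b]).
    by rewrite -E; exact: mul_rot4.
  rewrite E1 mulr_suml raddf_sum/= big1// => i _.
  have E2 : (\adj F) k i * gX i * (h k * 'X_[b]) = gX i * ((\adj F) k i * (h k * 'X_[b])).
    exact: mulrAC_A.
  by rewrite E2; exact: tau0_kill.
move=> p.
have -> : \sum_(b : 'X_{1..m < msize d}) (tau0 (\det F * p * 'X_[b]))%:MP * d@_b =
    tau (mixed m p * \det (Fu *m D)).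
  have -> : \det (Fu *m D) = mixed m (\det F) * d.
    rewrite det_mulmx; congr (_ * _); rewrite -det_map_mx; congr (\det _).
    by apply/matrixP => i k; rewrite FuE mxE.
  have E1 : mixed m p * (mixed m (\det F) * d) =
      \sum_(b : 'X_{1..m < msize d}) (d@_b)%:MP * mixed m (\det F * p * 'X_[b]).
    rewrite {1}(mpolywE (leqnn (msize d))) mulrA mulr_sumr; apply: eq_bigr => b _.
    rewrite -mul_mpolyC.
    have -> : mixed m (\det F * p * 'X_[b]) = mixed m (\det F) * mixed m p * 'X_[b].
      rewrite !(rmorphM (mixed m)); congr (_ * _).
      by rewrite /= /mixed mmapX mpolyXE_id; apply: eq_bigr => i _; rewrite ltn_ord.
    exact: mul_rot5.
  rewrite E1 tau_sum; apply: eq_bigr => b _.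
  by rewrite tauCM tau_mixed mulrC.
have -> : p - tau (mixed m p * \det (Fu *m D)) =
   tau (mixed m p * (\det G - \det (Fu *m D))) - (tau (mixed m p * \det G) - p).
  by rewrite mulrBr tauB; exact: sub_swap.
by apply: (idealB fI); [apply: tau_J; exact: det_G | exact: tau_repr].
Qed.

End Bezoutian.


(** * Dimension of the fibres of a finite family *)

(** For a rank factorisation [E = A B], idempotence forces [B A = 1], an identity matrix whose size
    is the rank. *)
Lemma mxtrace_idempotent (K : fieldType) n (E : 'M[K]_n) : E *m E = E -> \tr E = (\rank E)%:R.
Proof.
move=> EE.
have : row_base E *m col_base E = 1%:M.
  apply: (row_free_inj (row_base_free E)); rewrite mul1mx.
  have [C CE] := row_fullP (col_base_full E).
  have rbE : row_base E = C *m E.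
    have : C *m (col_base E *m row_base E) = row_base E by rewrite mulmxA CE mul1mx.
    by rewrite mulmx_base.
  by rewrite -mulmxA mulmx_base [in LHS]rbE -mulmxA EE -rbE.
move=> rc; have : \tr (col_base E *m row_base E) = (\rank E)%:R by rewrite mxtrace_mulC rc mxtrace1.
by rewrite mulmx_base.
Qed.

(** The values of [q + 1] are positive integers, so it has no root in an algebraically closed
    field. *)
Lemma const_poly_nat (K : numClosedFieldType) (q : {poly K}) :
  (forall t, exists n : nat, q.[t] = n%:R) -> exists c, q = c%:P.
Proof.
move=> qn; have [/size1_polyC->|q1] := leqP (size q) 1; first by exists q`_0.
have : size (q + 1) != 1%N.
  by rewrite size_polyDl ?size_polyC ?oner_eq0// gtn_eqF.
move=> /closed_rootP[t]; rewrite rootE hornerD hornerC.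
have [n ->] := qn t; by rewrite natr1 pnatr_eq0.
Qed.

Lemma split_remainder (A : comNzRingType) (x b y a l q : A) :
  (x + b * y) * a + (l + y * q) = x * a + l + y * (b * a + q).
Proof. ring. Qed.

Section Fibres.
Variables (K : numClosedFieldType) (m : nat).
Local Notation S := {mpoly {poly K}[m]}.
Local Notation S0 := {mpoly K[m]}.

Definition fibre (t : K) : S -> S0 := map_mpoly (horner_eval t).
HB.instance Definition _ t := GRing.RMorphism.copy (fibre t) (map_mpoly (horner_eval t)).

Definition const_family : S0 -> S := map_mpoly polyC.
HB.instance Definition _ := GRing.RMorphism.copy const_family (map_mpoly polyC).

Lemma fibreC t c : fibre t c%:MP = (c.[t])%:MP.
Proof. exact: map_mpolyC. Qed.

Lemma fibreK t : cancel const_family (fibre t).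
Proof.
move=> p; apply/mpolyP => a; rewrite !mcoeff_map_mpoly/=.
by rewrite /horner_eval hornerC.
Qed.

Lemma fibre_eq t p : exists q, p = const_family (fibre t p) + ('X - t%:P)%:MP * q.
Proof.
elim/mpolyind: p => [|c a p _ _ [q E]].
  by exists 0; rewrite !rmorph0 mulr0 addr0.
have /factor_theorem[b bE] : root (c - (c.[t])%:P) t.
  by rewrite rootE hornerD hornerN hornerC subrr.
exists (b%:MP * 'X_[a] + q).
rewrite (rmorphD (fibre t)) (rmorphD const_family) -mul_mpolyC.
rewrite (rmorphM (fibre t)) (rmorphM const_family)/= fibreC {1}E.
have -> : const_family (c.[t])%:MP = ((c.[t])%:P)%:MP by exact: map_mpolyC.
have -> : const_family (fibre t 'X_[a]) = 'X_[a] by rewrite /fibre map_mpolyX; exact: map_mpolyX.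
rewrite {1}(_ : c = (c.[t])%:P + b * ('X - t%:P)); last by rewrite -bE subrKC.
rewrite (mpolyCD _ (c.[t])%:P) (mpolyCM _ b); exact: split_remainder.
Qed.

Variables (s : nat) (f : 'I_m -> S) (psi : 'I_s -> S -> {poly K}) (dl : 'I_s -> S).
Hypothesis psiD : forall i p q, psi i (p + q) = psi i p + psi i q.
Hypothesis psiC : forall i c p, psi i (c%:MP * p) = c * psi i p.
Hypothesis psi0 : forall i p, span f p -> psi i p = 0.
Hypothesis psiE : forall p, span f (p - \sum_i (psi i p)%:MP * dl i).

(** These coordinates with respect to the [dl] embed the quotient of the fibre at [t] into K^s, with
    the row space of the idempotent [E t] as image. The dimension is thus a trace, which is
    polynomial in [t]. *)
Let v t (a : S0) : 'rV[K]_s := \row_i (psi i (const_family a)).[t].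
Let E t : 'M[K]_s := \matrix_(i, j) (psi j (dl i)).[t].
Let J t : set S0 := span (fun i => fibre t (f i)).

Let vD t a b : v t (a + b) = v t a + v t b.
Proof. by apply/rowP => i; rewrite !mxE rmorphD psiD hornerD. Qed.

Let vZ t c a : v t (c *: a) = c *: v t a.
Proof.
apply/rowP => i; rewrite !mxE -mul_mpolyC rmorphM/= /const_family map_mpolyC.
by rewrite psiC hornerM hornerC.
Qed.

Let vB t a b : v t (a - b) = v t a - v t b.
Proof. by rewrite -scaleN1r vD vZ scaleN1r. Qed.

Let v_sum t (I : Type) (r : seq I) (F : I -> S0) : v t (\sum_(i <- r) F i) = \sum_(i <- r) v t (F i).
Proof.
elim: r => [|i r IH]; last by rewrite !big_cons vD IH.
by rewrite !big_nil -(scale0r 0) vZ scale0r.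
Qed.

Let v_fibre t p : v t (fibre t p) = \row_i (psi i p).[t].
Proof.
apply/rowP => i; rewrite !mxE; have [q qE] := fibre_eq t p.
by rewrite {2}qE psiD psiC hornerD hornerM hornerXsubC subrr mul0r addr0.
Qed.

Let v_dl t i : v t (fibre t (dl i)) = row i (E t).
Proof. by rewrite v_fibre; apply/rowP => j; rewrite !mxE. Qed.

Let v_expand t a : J t (a - \sum_i v t a 0 i *: fibre t (dl i)).
Proof.
have [h hE] := psiE (const_family a).
exists (fun k => fibre t (h k)).
have := congr1 (fibre t) hE; rewrite rmorphB/= fibreK !rmorph_sum/= => E1.
transitivity (\sum_i fibre t (h i * f i)); last by apply: eq_bigr => i _; rewrite rmorphM.
rewrite -E1; congr (_ - _); apply: eq_bigr => i _.
by rewrite rmorphM/= fibreC mul_mpolyC mxE.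
Qed.

Let v_J t a : J t a -> v t a = 0.
Proof.
move=> [h ->]; rewrite v_sum big1// => k _; apply/rowP => i; rewrite !mxE rmorphM/=.
have [q qE] := fibre_eq t (f k).
have : psi i (const_family (h k) * f k) = 0.
  by apply: psi0; have [_ _ fM] := span_ideal f; apply: fM; exact: span_gen.
rewrite {1}qE mulrDr mulrCA psiD psiC => /(congr1 (horner^~ t)).
by rewrite hornerD hornerM hornerXsubC subrr mul0r addr0 hornerC.
Qed.

Let v_E t a : v t a = v t a *m E t.
Proof.
have := v_J (v_expand t a); rewrite vB v_sum => /eqP; rewrite subr_eq0 => /eqP {1}->.
rewrite mulmx_sum_row; apply: eq_bigr => i _; by rewrite vZ v_dl.
Qed.

Let EE t : E t *m E t = E t.
Proof. by apply/row_matrixP => i; rewrite row_mul -v_dl -v_E. Qed.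

Lemma fibre_dim : exists d, forall t, has_quotient_dim setT (span (fun i => fibre t (f i))) d.
Proof.
pose q := \sum_i psi i (dl i).
have trE t : q.[t] = (\rank (E t))%:R.
  by rewrite -mxtrace_idempotent// /mxtrace /q horner_sum; apply: eq_bigr => i _; rewrite mxE.
have [c qc] : exists c, q = c%:P by apply: const_poly_nat => t; exists (\rank (E t)).
exists (\rank (E 0)) => t.
have -> : \rank (E 0) = \rank (E t).
  by apply/eqP; rewrite -(eqr_nat K) -!trE qc !hornerC.
have /submxP[Q QE] : (row_base (E t) <= E t)%MS by rewrite eq_row_base.
exists (fun i => \sum_k Q i k *: fibre t (dl k)); split => // F _.
have vF : exists a, v t F = a *m row_base (E t).
  by apply/submxP; rewrite eq_row_base v_E submxMl.
have ve (a : 'rV_(\rank (E t))) : v t (\sum_(i < \rank (E t)) a 0 i *: \sum_k Q i k *: fibre t (dl k)) = a *m row_base (E t).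
  rewrite v_sum mulmx_sum_row; apply: eq_bigr => i _; rewrite vZ v_sum; congr (_ *: _).
  rewrite QE row_mul mulmx_sum_row; apply: eq_bigr => k _; by rewrite vZ v_dl mxE.
have JP (a : S0) : J t a <-> v t a = 0.
  split; first exact: v_J.
  move=> va; have := v_expand t a; rewrite va big1 ?subr0// => i _.
  by rewrite mxE scale0r.
have [a aE] := vF; exists a; split; first by apply/JP; rewrite vB ve aE subrr.
move=> b /JP; rewrite vB ve aE => /eqP; rewrite subr_eq0 => /eqP.
by move/(row_free_inj (row_base_free _)).
Qed.

End Fibres.


(** * Integrality from linear forms whose products are scalars *)

Section Integrality.
Variables (R : comNzRingType) (S : comAlgType R) (J : set S) (n p : nat).
Variables (xs ys : 'I_n.+1 -> S) (lx ly : 'I_p -> S) (Lx Ly : 'I_p -> 'I_n.+1 -> R) (w : 'I_p -> R).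
Hypothesis JI : is_ideal J.
Hypotheses (xs0 : xs ord0 = 1) (ys0 : ys ord0 = 1).
Hypothesis lxE : forall k, lx k = \sum_i Lx k i *: xs i.
Hypothesis lyE : forall k, ly k = \sum_i Ly k i *: ys i.
Hypothesis lxy : forall k, J (lx k * ly k - w k *: 1).
Hypothesis forms_span : forall Cx Cy : seq 'I_p, (forall k, k \in Cx \/ k \in Cy) ->
  (forall i, exists2 c : 'I_p -> R, forall k, k \notin Cx -> c k = 0 & xs i = \sum_k c k *: lx k) \/
  (forall i, exists2 c : 'I_p -> R, forall k, k \notin Cy -> c k = 0 & ys i = \sum_k c k *: ly k).

(* Modulo J, the polynomials of degree at most d in the xs and e in the ys. *)
Inductive bispan (d e : nat) : S -> Prop :=
| bispanJ a of J a : bispan d e a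
| bispanD a b of bispan d e a & bispan d e b : bispan d e (a + b)
| bispan_mon r (al be : seq 'I_n.+1) of size al = d & size be = e :
    bispan d e (r *: (\prod_(i <- al) xs i * \prod_(i <- be) ys i)).

Lemma bispanZ d e r a : bispan d e a -> bispan d e (r *: a).
Proof.
have [J0 JD JM] := JI; elim=> [b Jb|b c _ IHb _ IHc|q al be ha hb].
- by apply: bispanJ; rewrite -mulr_algl; exact: JM.
- by rewrite scalerDr; exact: bispanD.
- by rewrite scalerA; exact: bispan_mon.
Qed.

Lemma bispan_sum d e (I : Type) (r : seq I) (P : pred I) (F : I -> S) :
  (forall i, P i -> bispan d e (F i)) -> bispan d e (\sum_(i <- r | P i) F i).
Proof.
have [J0 _ _] := JI; move=> H; elim/big_ind: _ => //; first exact: bispanJ.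
exact: bispanD.
Qed.

Lemma bispanM d e d' e' a b : bispan d e a -> bispan d' e' b -> bispan (d + d') (e + e') (a * b).
Proof.
have [J0 JD JM] := JI; elim=> [c Jc|c1 c2 _ IH1 _ IH2|r al be ha hb] bb.
- by apply: bispanJ; exact: idealM.
- by rewrite mulrDl; apply: bispanD; [exact: IH1 | exact: IH2].
elim: bb => [c Jc|c1 c2 _ IH1 _ IH2|r' al' be' ha' hb'].
- by apply: bispanJ; exact: JM.
- by rewrite mulrDr; exact: bispanD.
rewrite -scalerAl -scalerAr scalerA mulrACA -!big_cat/=.
by apply: bispan_mon; rewrite size_cat ?ha ?hb ?ha' ?hb'.
Qed.

Lemma bispan_x i : bispan 1 0 (xs i).
Proof. by have := @bispan_mon 1 0 1 [:: i] [::] erefl erefl; rewrite big_seq1 big_nil mulr1 scale1r. Qed.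

Lemma bispan_y i : bispan 0 1 (ys i).
Proof. by have := @bispan_mon 0 1 1 [::] [:: i] erefl erefl; rewrite big_seq1 big_nil mul1r scale1r. Qed.

Lemma bispan_lx k : bispan 1 0 (lx k).
Proof. by rewrite lxE; apply: bispan_sum => i _; apply: bispanZ; exact: bispan_x. Qed.

Lemma bispan_ly k : bispan 0 1 (ly k).
Proof. by rewrite lyE; apply: bispan_sum => i _; apply: bispanZ; exact: bispan_y. Qed.

Lemma bispan_Sl d e a : bispan d e a -> bispan d.+1 e a.
Proof. by move=> /(bispanM (bispan_x ord0)); rewrite xs0 mul1r. Qed.

Lemma bispan_Sr d e a : bispan d e a -> bispan d e.+1 a.
Proof. by move=> /(bispanM (bispan_y ord0)); rewrite ys0 mul1r. Qed.

(** [Cx] and [Cy] hold the pairs already decided in favour of x or of y. Apart from terms of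
    bidegree (d, d), an element of bidegree (d + 1, d + 1) must be a sum of multiples of chosen
    forms. *)
Inductive reduced (Cx Cy : seq 'I_p) (d : nat) : S -> Prop :=
| reduced_low a of bispan d d a : reduced Cx Cy d a
| reducedD a b of reduced Cx Cy d a & reduced Cx Cy d b : reduced Cx Cy d (a + b)
| reduced_x k a of k \in Cx & bispan d d.+1 a : reduced Cx Cy d (lx k * a)
| reduced_y k a of k \in Cy & bispan d.+1 d a : reduced Cx Cy d (ly k * a).

Lemma reduced_bispan Cx Cy d a : reduced Cx Cy d a -> bispan d.+1 d.+1 a.
Proof.
elim=> [b|b c _ IHb _ IHc|k b _|k b _].
- by move=> /bispan_Sl/bispan_Sr.
- exact: bispanD.
- exact: (bispanM (bispan_lx k)).
- exact: (bispanM (bispan_ly k)).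
Qed.

(** The first factor may use [lx k], the second [ly k]. Where both meet, their product is the scalar
    [w k] and both degrees drop by one; any other term has low degree or keeps a form chosen
    before. *)
Lemma reducedM k Cx Cy d1 d2 a b : reduced (k :: Cx) Cy d1 a -> reduced Cx (k :: Cy) d2 b ->
  reduced Cx Cy (d1 + d2.+1) (a * b).
Proof.
have [J0 JD JM] := JI; move=> + rb; have bb := reduced_bispan rb.
elim=> [c bc|c1 c2 _ IH1 _ IH2|k' c|k' c k'y bc].
- by apply: reduced_low; exact: bispanM.
- by rewrite mulrDl; exact: reducedD.
- rewrite inE => /orP[/eqP->|k'x] bc; last first.
    by rewrite -mulrA; apply: reduced_x => //; rewrite -addSn; exact: bispanM.
  have bkc : bispan d1.+1 d1.+1 (lx k * c) by exact: (bispanM (bispan_lx k)).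
  elim: rb => [e be|e1 e2 _ IH1 _ IH2|l e lx' be|l e].
  - by apply: reduced_low; rewrite addnS -addSn; exact: bispanM.
  - by rewrite mulrDr; exact: reducedD.
  - rewrite mulrCA; apply: reduced_x => //.
    by rewrite [X in bispan X _ _]addnS -addSn -addSn; exact: bispanM.
  rewrite inE => /orP[/eqP->|ly'] be; last first.
    rewrite mulrCA; apply: reduced_y => //.
    by rewrite [X in bispan _ X _]addnS -addSn -addSn; exact: bispanM.
  apply: reduced_low.
  have -> : lx k * c * (ly k * e) = (lx k * ly k - w k *: 1) * (c * e) + w k *: (c * e).
    by rewrite mulrBl -scalerAl mul1r subrK mulrACA.
  have ce : bispan (d1 + d2.+1) (d1 + d2.+1) (c * e).
    by rewrite [X in bispan _ X _]addnS -addSn; exact: bispanM.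
  apply: bispanD; last exact: bispanZ.
  by apply: bispanJ; exact: idealM.
- by rewrite -mulrA; apply: reduced_y => //; rewrite -addSn; exact: bispanM.
Qed.

Lemma reduced_mul_ind d1 d2 (Q : S -> Prop) : (forall a, J a -> Q a) ->
  (forall a b, Q a -> Q b -> Q (a + b)) ->
  (forall a b, bispan d1 d1 a -> bispan d2 d2 b -> Q (a * b)) ->
  forall a, bispan (d1 + d2) (d1 + d2) a -> Q a.
Proof.
move=> QJ QD QM a; elim=> {a} [a /QJ//|a b _ Qa _ Qb|r al be ha hb]; first exact: QD.
rewrite -(cat_take_drop d1 al) -(cat_take_drop d1 be) !big_cat/= mulrACA scalerAl.
apply: QM; last first.
  by rewrite -[X in bispan _ _ X]scale1r; apply: bispan_mon; rewrite size_drop ?ha ?hb addKn.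
by apply: bispan_mon; rewrite size_takel ?ha ?hb ?leq_addr.
Qed.

(** Induction on the list [s] of undecided pairs: both decisions for [k] are tried and the results
    multiplied, which removes [k] from the choice at the price of a larger degree. When every pair
    is decided, [forms_span] gives d = 0; when nothing has been chosen, [reduced] reduces to
    bidegree (d, d). *)
Lemma bispan_stable : exists d, forall a, bispan d.+1 d.+1 a -> bispan d d a.
Proof.
suff : forall s Cx Cy : seq 'I_p, (forall k, [\/ k \in s, k \in Cx | k \in Cy]) ->
    exists d, forall a, bispan d.+1 d.+1 a -> reduced Cx Cy d a.
  move=> /(_ (enum 'I_p) [::] [::]) [|d H].
    by move=> k; constructor 1; rewrite mem_enum.
  by exists d => a /H; elim=> // b c _ IHb _ IHc; exact: bispanD.
elim=> [|k s IH] Cx Cy Call; last first.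
  have [|d1 H1] := IH (k :: Cx) Cy.
    by move=> l; have := Call l; rewrite !inE => -[/orP[->|->]|->|->];
      rewrite ?orbT; [constructor 2|constructor 1|constructor 2|constructor 3].
  have [|d2 H2] := IH Cx (k :: Cy).
    by move=> l; have := Call l; rewrite !inE => -[/orP[->|->]|->|->];
      rewrite ?orbT; [constructor 3|constructor 1|constructor 2|constructor 3].
  exists (d1 + d2.+1)%N => a; rewrite -addSn.
  apply: reduced_mul_ind => [b Jb|b c|b c /H1 rb /H2 rc].
  - by apply: reduced_low; exact: bispanJ.
  - exact: reducedD.
  - exact: reducedM rb rc.
exists 0%N => a; elim=> {a} [a Ja|a b _ IHa _ IHb|r al be].
- by apply: reduced_low; exact: bispanJ.
- exact: reducedD.
have reduced_sum (F : 'I_p -> S) : (forall k, reduced Cx Cy 0 (F k)) -> reduced Cx Cy 0 (\sum_k F k).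
  move=> H; elim/big_ind: _ => //; last exact: reducedD.
  by apply: reduced_low; apply: bispanJ; have [] := JI.
case: al => [//|i [|//]] _; case: be => [//|j [|//]] _; rewrite !big_seq1.
have Call' k : k \in Cx \/ k \in Cy by case: (Call k) => //; [left | right].
have [/(_ i)[c c0 ->]|/(_ j)[c c0 ->]] := forms_span Call'.
  rewrite mulr_suml scaler_sumr; apply: reduced_sum => k.
  rewrite -scalerAl scalerA scalerAr.
  have [kx|/c0->] := boolP (k \in Cx).
    by apply: reduced_x => //; apply: bispanZ; exact: bispan_y.
  by rewrite mulr0 scale0r mulr0; apply: reduced_low; apply: bispanJ; have [] := JI.
rewrite mulr_sumr scaler_sumr; apply: reduced_sum => k.
rewrite -scalerAr scalerA [xs i * _]mulrC scalerAr.
have [kx|/c0->] := boolP (k \in Cy).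
  by apply: reduced_y => //; apply: bispanZ; exact: bispan_x.
by rewrite mulr0 scale0r mulr0; apply: reduced_low; apply: bispanJ; have [] := JI.
Qed.

Lemma det_ideal (I : finType) (M : I -> I -> S) (b : I -> S) (i0 : I) : b i0 = 1 ->
  (forall i, J (\sum_j M i j * b j)) ->
  J (\det (\matrix_(i < #|I|, j < #|I|) M (enum_val i) (enum_val j))).
Proof.
move=> b0 MJ; set A := (\matrix_(i, j) _); have [_ _ JM] := JI.
pose bv : 'cV[S]_#|I| := \col_i b (enum_val i).
have -> : \det A = (\adj A *m (A *m bv)) (enum_rank i0) 0.
  by rewrite mulmxA mul_adj_mx mul_scalar_mx !mxE enum_rankK b0 mulr1.
rewrite mxE; apply: ideal_sum => // i _; apply: JM.
rewrite mxE; have := MJ (enum_val i); congr J.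
rewrite (reindex (@enum_val I predT)) /=; last exact/onW_bij/enum_val_bij.
by apply: eq_bigr => j _; rewrite !mxE.
Qed.

(** The determinant trick: finitely many products [b i] generate a module stable under [z], and 1 is
    one of them because [xs] and [ys] are 1 at index 0. So [J] contains the characteristic
    polynomial at [z]. *)
Lemma integral_element z d : (forall a, bispan d d a -> bispan d d (z * a)) ->
  exists g : {poly R}, [/\ g \is monic, (1 < size g)%N & J (map_poly (in_alg S) g).[z]].
Proof.
move=> zB; pose I : finType := (d.-tuple 'I_n.+1 * d.-tuple 'I_n.+1)%type.
pose b (i : I) : S := \prod_(k <- i.1) xs k * \prod_(k <- i.2) ys k.
have [J0 JD JM] := JI.
have gen a : bispan d d a -> exists c : I -> R, J (a - \sum_i c i *: b i).
  elim=> {a} [a Ja|a a' _ [c cE] _ [c' cE']|r al be ha hb].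
  - by exists (fun=> 0); rewrite big1 ?subr0// => i _; rewrite scale0r.
  - exists (fun i => c i + c' i); under eq_bigr do rewrite scalerDl.
    by rewrite big_split opprD addrACA; exact: JD.
  have ha' : size al == d by rewrite ha.
  have hb' : size be == d by rewrite hb.
  exists (fun i => if i == (Tuple ha', Tuple hb') then r else 0).
  rewrite (bigD1 (Tuple ha', Tuple hb'))//= eqxx (big1 _ (fun i => i != (Tuple ha', Tuple hb'))).
    by rewrite addr0 subrr.
  by move=> i /negPf->; rewrite scale0r.
have /choice[M ME] i : exists c : I -> R, J (z * b i - \sum_j c j *: b j).
  by apply/gen/zB; rewrite -[b i]scale1r; apply: bispan_mon; rewrite size_tuple.
pose A : 'M[R]_#|I| := \matrix_(i, j) M (enum_val i) (enum_val j).
have I0 : (0 < #|I|)%N by apply/card_gt0P; exists ([tuple ord0 | _ < d], [tuple ord0 | _ < d]).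
exists (char_poly A); split; first exact: char_poly_monic.
  by rewrite size_char_poly ltnS.
pose N (i j : I) : S := (i == j)%:R * z - (M i j)%:A.
have -> : (map_poly (in_alg S) (char_poly A)).[z] =
    \det (\matrix_(i < #|I|, j < #|I|) N (enum_val i) (enum_val j)).
  rewrite map_char_poly /char_poly -[LHS]/(horner_eval z _) -det_map_mx; congr (\det _).
  apply/matrixP => i j; rewrite !mxE /N (inj_eq enum_val_inj) rmorphB rmorphMn /=.
  by rewrite /horner_eval hornerX hornerC -mulr_natl.
apply: (det_ideal (b := b) (i0 := ([tuple ord0 | _ < d], [tuple ord0 | _ < d]))).
  by rewrite /b !big_tuple !big1 ?mulr1// => i _; rewrite tnth_mktuple.
move=> i; rewrite /N; have := ME i; congr J.
transitivity (\sum_j ((i == j)%:R * z * b j - M i j *: b j)); last first.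
  by apply: eq_bigr => j _; rewrite mulrBl mulr_algl.
rewrite sumrB; congr (_ - _); rewrite (bigD1 i)//= eqxx mul1r big1 ?addr0// => j /negPf ji.
by rewrite eq_sym ji !mul0r.
Qed.

Lemma integral_forms i : (exists g : {poly R},
    [/\ g \is monic, (1 < size g)%N & J (map_poly (in_alg S) g).[xs i]]) /\
  (exists g : {poly R}, [/\ g \is monic, (1 < size g)%N & J (map_poly (in_alg S) g).[ys i]]).
Proof.
have [d dB] := bispan_stable.
split; apply: (@integral_element _ d) => a ba; apply: dB.
  by apply: bispan_Sr; exact: (bispanM (bispan_x i)).
by apply: bispan_Sl; exact: (bispanM (bispan_y i)).
Qed.

End Integrality.

(** * Finite-dimensional quotients *)

Section QuotientMaps.
Variables (K : fieldType) (E : lmodType K).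
Implicit Types (W Q : set E).

Definition quotient_map W d (v : E -> 'rV[K]_d) : Prop :=
  [/\ linear v, forall a, exists p, v p = a & forall p, W p <-> v p = 0].

Definition is_subspace W : Prop :=
  [/\ W 0, forall p q, W p -> W q -> W (p + q) & forall c p, W p -> W (c *: p)].

Section Linear.
Variables (d : nat) (v : E -> 'rV[K]_d) (vL : linear v).
Let vl : {linear E -> 'rV[K]_d} := HB.pack v (GRing.isLinear.Build _ _ _ _ v vL).

Lemma linear_mapB p q : v (p - q) = v p - v q. Proof. exact: (raddfB vl). Qed.
Lemma linear_mapD p q : v (p + q) = v p + v q. Proof. exact: (raddfD vl). Qed.
Lemma linear_map0 : v 0 = 0. Proof. exact: (raddf0 vl). Qed.
Lemma linear_mapZ c p : v (c *: p) = c *: v p. Proof. exact: (linearZZ vl). Qed.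
Lemma linear_map_sum (I : Type) (r : seq I) (F : I -> E) :
  v (\sum_(i <- r) F i) = \sum_(i <- r) v (F i).
Proof. exact: (raddf_sum vl). Qed.

End Linear.

Lemma quotient_section W d (v : E -> 'rV[K]_d) : quotient_map W v ->
  exists e : 'I_d -> E, (forall a : 'rV[K]_d, v (\sum_i a 0 i *: e i) = a) /\
    forall p, W (p - \sum_i v p 0 i *: e i).
Proof.
case=> vL vS vW; have /choice[e eE] i := vS (delta_mx 0 i).
have eK (a : 'rV[K]_d) : v (\sum_i a 0 i *: e i) = a.
  rewrite (linear_map_sum vL) [RHS]row_sum_delta; apply: eq_bigr => i _.
  by rewrite (linear_mapZ vL) eE.
by exists e; split => // p; apply/vW; rewrite (linear_mapB vL) eK subrr.
Qed.

Lemma quotient_map_dim W d (v : E -> 'rV[K]_d) : quotient_map W v ->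
  has_quotient_dim setT W d.
Proof.
move=> vW; have [e [eK eW]] := quotient_section vW; have [vL _ WE] := vW.
exists e; split => // F _; exists (v F); split => // b /WE.
by rewrite (linear_mapB vL) eK => /eqP; rewrite subr_eq0 => /eqP.
Qed.

Lemma has_quotient_map W d : is_subspace W -> has_quotient_dim setT W d ->
  exists v : E -> 'rV[K]_d, quotient_map W v.
Proof.
move=> WS [e [_ eU]]; have [W0 WD WZ] := WS.
have /choice[v vE] F : exists a : 'rV[K]_d, unique (fun a : 'rV[K]_d => W (F - \sum_i a 0 i *: e i)) a.
  by have [a aE] := eU F I; exists a.
have vP F (a : 'rV[K]_d) : W (F - \sum_i a 0 i *: e i) -> v F = a by move=> Wa; exact: (vE F).2.
exists v; split.
- move=> c p q; apply: vP; under eq_bigr do rewrite !mxE scalerDl -scalerA.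
  rewrite big_split/= -scaler_sumr opprD addrACA -scalerBr.
  by apply: WD; [apply: WZ; exact: (vE p).1 | exact: (vE q).1].
- move=> a; exists (\sum_i a 0 i *: e i); apply: vP; by rewrite subrr.
- move=> p; split => [Wp|vp].
    apply: vP; rewrite big1 ?subr0// => i _; by rewrite mxE scale0r.
  have := (vE p).1; rewrite vp big1 ?subr0// => i _; by rewrite mxE scale0r.
Qed.

Lemma quotient_map_le W W' d d' (v : E -> 'rV[K]_d) (v' : E -> 'rV[K]_d') :
  quotient_map W v -> quotient_map W' v' -> (forall p, W p -> W' p) -> (d' <= d)%N.
Proof.
move=> vW [v'L v'S v'W] WW'; have [e [_ eW]] := quotient_section vW.
pose T : 'M[K]_(d, d') := \matrix_(i, j) v' (e i) 0 j.
have v'T p : v' p = v p *m T.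
  have /WW'/v'W := eW p; rewrite (linear_mapB v'L) (linear_map_sum v'L) => /eqP.
  rewrite subr_eq0 => /eqP->; rewrite mulmx_sum_row; apply: eq_bigr => i _.
  by rewrite (linear_mapZ v'L); congr (_ *: _); apply/rowP => j; rewrite !mxE.
have : row_full T.
  rewrite -sub1mx; apply/row_subP => i; have [p <-] := v'S (row i 1%:M).
  by rewrite v'T submxMl.
by move=> /eqP <-; exact: rank_leq_row.
Qed.

Lemma has_quotient_dim_uniq W d d' : is_subspace W ->
  has_quotient_dim setT W d -> has_quotient_dim setT W d' -> d = d'.
Proof.
move=> WS /(has_quotient_map WS)[v vW] /(has_quotient_map WS)[v' vW'].
by apply/eqP; rewrite eqn_leq (quotient_map_le vW' vW) ?(quotient_map_le vW vW').
Qed.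

(** [Q] is a mere predicate on a space of possibly infinite dimension. Among the matrices with row
    space inside the image, one of maximal rank has the whole image as row space. *)
Lemma linear_image_mx Q d (v : E -> 'rV[K]_d) : is_subspace Q -> linear v ->
  exists A : 'M[K]_d, (forall u : 'rV_d, (u <= A)%MS -> exists2 q, Q q & v q = u) /\
    forall q, Q q -> (v q <= A)%MS.
Proof.
move=> [Q0 QD QZ] vL.
pose ok (A : 'M[K]_d) := forall u : 'rV_d, (u <= A)%MS -> exists2 q, Q q & v q = u.
pose P r := `[< exists2 A, ok A & \rank A = r >].
have P0 : exists r, P r.
  exists 0%N; apply/asboolP; exists 0; last exact: mxrank0.
  by move=> u; rewrite submx0 => /eqP->; exists 0 => //; exact: linear_map0.
have Pd r : P r -> (r <= d)%N by move=> /asboolP[A _ <-]; exact: rank_leq_row.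
have [r /asboolP[A Aok rA] rmax] := ex_maxnP P0 Pd.
exists A; split => // q Qq.
have AB : ok (A + v q)%MS.
  move=> u /sub_addsmxP[[a b] /= ->].
  have [q1 Qq1 <-] := Aok (a *m A) (submxMl _ _).
  exists (q1 + b 0 0 *: q); first by apply: QD => //; exact: QZ.
  rewrite (linear_mapD vL) (linear_mapZ vL); congr (_ + _).
  by rewrite [in RHS](mx11_scalar b) mul_scalar_mx.
have : (\rank (A + v q)%MS <= \rank A)%N.
  by rewrite rA; apply: rmax; apply/asboolP; exists (A + v q)%MS.
rewrite (geq_leqif (mxrank_leqif_sup (addsmxSl A (v q)))).
exact: submx_trans (addsmxSr _ _).
Qed.

(** The second conclusion, finite generation of [Q] modulo [W], later yields a common denominator
    for a localization. *)
Lemma has_quotient_dim_sup W Q d : is_subspace W -> is_subspace Q -> (forall p, W p -> Q p) ->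
  has_quotient_dim setT W d ->
  (exists d', has_quotient_dim setT Q d') /\
  exists e : 'I_d -> E, (forall i, Q (e i)) /\
    forall p, Q p -> exists a : 'rV[K]_d, W (p - \sum_i a 0 i *: e i).
Proof.
move=> WS QS WQ /(has_quotient_map WS)[v vW]; have [vL vS WE] := vW.
have [A [AQ QA]] := linear_image_mx QS vL.
split.
  exists (\rank (cokermx A)); apply: (@quotient_map_dim _ _ (fun p => v p *m col_base (cokermx A))).
  split => [c p q|a|p].
  - by rewrite vL mulmxDl -scalemxAl.
  - have [C CE] := row_fullP (col_base_full (cokermx A)).
    by have [p pE] := vS (a *m C); exists p; rewrite pE -mulmxA CE mulmx1.
  - have -> : v p *m col_base (cokermx A) = 0 <-> (v p <= A)%MS.
      rewrite submxE -[in X in _ <-> is_true (X == 0)](mulmx_base (cokermx A)) mulmxA.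
      split => [->|/eqP E0]; first by rewrite mul0mx.
      by apply: (row_free_inj (row_base_free (cokermx A))); rewrite E0 mul0mx.
    split; first exact: QA.
    move=> /AQ[q Qq vq]; rewrite -(subrK q p).
    by have [_ QD _] := QS; apply: QD => //; apply/WQ/WE; rewrite (linear_mapB vL) vq subrr.
have /choice[e eE] i : exists q, Q q /\ v q = row i A.
  by have [q Qq qE] := AQ _ (row_sub i A); exists q.
exists e; split => [i|p Qp]; first exact: (eE i).1.
have /submxP[a aE] := QA _ Qp; exists a; apply/WE.
rewrite (linear_mapB vL) (linear_map_sum vL) aE mulmx_sum_row; apply/eqP; rewrite subr_eq0; apply/eqP.
by apply: eq_bigr => i _; rewrite (linear_mapZ vL) (eE i).2.
Qed.

End QuotientMaps.

(** * Zero-dimensional ideals over an algebraically closed field *)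

Section ZeroDimensional.
Variables (K : numClosedFieldType) (m : nat).
Local Notation S := {mpoly K[m]}.
Implicit Types (J Q : set S) (p q e : S) (w : 'rV[K]_m).

Definition mev (w : 'rV[K]_m) (p : S) : K := p.@[fun i => w 0 i].
HB.instance Definition _ w := GRing.RMorphism.copy (mev w) (meval (fun i => w 0 i)).

Definition zero_of J w : Prop := forall p, J p -> mev w p = 0.

(** Zero-dimensionality, in the form in which integrality provides it. *)
Definition eliminates J : Prop :=
  forall i, exists g : {poly K}, g != 0 /\ J (map_poly (@mpolyC m K) g).['X_i].

(** The contraction to polynomials of the extension of [J] to the local ring at [w]. For a
    zero-dimensional [J] the quotient by it is the local ring of [J] at [w], so multiplicities can
    be computed with polynomials. *)
Definition localization J w : set S := [set p | exists e, mev w e != 0 /\ J (e * p)].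

Lemma ideal_subspace J : is_ideal J -> is_subspace J.
Proof. by case=> J0 JD JM; split => // c p Jp; rewrite -mul_mpolyC; exact: JM. Qed.

Lemma mevX w i : mev w 'X_i = w 0 i. Proof. exact: mevalXU. Qed.
Lemma mevC w c : mev w c%:MP = c. Proof. exact: mevalC. Qed.

Lemma mpoly_vanishing J w p : is_ideal J -> (forall i, J ('X_i - (w 0 i)%:MP)) -> J (p - (mev w p)%:MP).
Proof.
move=> JI Jw; have [J0 JD JM] := JI.
apply: (@mpoly_ring_ind _ _ (fun p => J (p - (mev w p)%:MP))) => [c|i q Jq|q r Jq Jr].
- by rewrite mevC subrr.
- have -> : 'X_i * q - (mev w ('X_i * q))%:MP = q * ('X_i - (w 0 i)%:MP) + (w 0 i)%:MP * (q - (mev w q)%:MP).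
    by rewrite rmorphM/= mevX mpolyCM mulrBr mulrBr addrA [q * _%:MP]mulrC subrK mulrC.
  by apply: JD; exact: JM.
- by rewrite rmorphD mpolyCD opprD addrACA; exact: JD.
Qed.

(** The variables are specialised one by one. If no value [r] were admissible, every [X_i - r] would
    be invertible modulo the ideal, and so would the elimination polynomial, a non-zero multiple of
    a product of such factors. *)
Lemma weak_nullstellensatz J : is_ideal J -> eliminates J -> ~ J 1 -> exists w, zero_of J w.
Proof.
move=> JI JE J1.
suff : forall j, (j <= m)%N -> exists J' (w : 'rV[K]_m), [/\ is_ideal J', forall p, J p -> J' p, ~ J' 1 &
    forall i : 'I_m, (i < j)%N -> J' ('X_i - (w 0 i)%:MP)].
  move=> /(_ m (leqnn m))[J' [w [J'I JJ' J'1 J'w]]]; exists w => p /JJ' J'p.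
  apply: contra_notP J'1 => /eqP wp; have [_ _ JM] := J'I.
  have := @mpoly_vanishing J' w p J'I (fun i => J'w i (ltn_ord i)).
  move=> /(idealB J'I J'p); rewrite opprB addrC subrK => /(JM (mev w p)^-1%:MP).
  by rewrite -mpolyCM mulVf.
elim=> [_|j IH jm]; first by exists J, 0; split.
have [J' [w [J'I JJ' J'1 J'w]]] := IH (ltnW jm); have [J0 JD JM] := J'I.
pose i := Ordinal jm.
have [r J'r] : exists r, ~ add_ideal J' (span (fun _ : 'I_1 => 'X_i - r%:MP)) 1.
  apply: contra_notP J'1 => /forallNP H.
  have {}H r p : J' (('X_i - r%:MP) * p) -> J' p.
    move=> Jp; have /contrapT[a [_ [Ja [h ->] E1]]] := H r.
    rewrite -[p]mul1r E1 big_ord1 mulrDl; apply: JD; first by rewrite mulrC; exact: JM.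
    by rewrite -mulrA; exact: JM.
  have [g [g0 /JJ']] := JE i; have [rs ->] := closed_field_poly_normal g.
  rewrite map_polyZ/= hornerZ -[X in J' X]mulr1.
  have lg0 : lead_coef g != 0 by rewrite lead_coef_eq0.
  move=> /(JM (lead_coef g)^-1%:MP); rewrite !mulrA -mpolyCM mulVf// mul1r.
  rewrite rmorph_prod/= horner_prod.
  have H' (p : S) : J' (\prod_(r <- rs) (map_poly (@mpolyC m K) ('X - r%:P)).['X_i] * p) -> J' p.
    elim: rs p => [|r rs IHrs] p; first by rewrite big_nil mul1r.
    by rewrite big_cons -mulrA rmorphB/= map_polyX map_polyC/= hornerXsubC => /H; exact: IHrs.
  exact: H'.
have sI := span_ideal (fun _ : 'I_1 => 'X_i - r%:MP : S).
exists (add_ideal J' (span (fun _ : 'I_1 => 'X_i - r%:MP))), (\row_k if k == i then r else w 0 k).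
split => //; first exact: add_idealP.
  by move=> p /JJ' Jp; exact: add_ideal_l.
move=> k; rewrite ltnS leq_eqVlt mxE; have [->|ki] := eqVneq k i.
  by move=> _; apply: add_ideal_r => //; exact: (span_gen (fun _ : 'I_1 => 'X_i - r%:MP) ord0).
rewrite (_ : (k == j :> nat) = false) /=; last by apply/negP => /eqP kj; case/eqP: ki; exact: val_inj.
by move=> kj; apply: add_ideal_l => //; exact: J'w.
Qed.

Lemma localization_ideal J w : is_ideal J -> is_ideal (localization J w).
Proof.
move=> JI; have [J0 JD JM] := JI; split.
- by exists 1; rewrite rmorph1 oner_eq0 mulr0.
- move=> p q [e [e0 Jp]] [e' [e0' Jq]]; exists (e * e'); rewrite rmorphM mulf_neq0//; split => //.
  by rewrite mulrDr [X in X * p]mulrC -!mulrA; apply: JD; exact: JM.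
- by move=> p q [e [e0 Jq]]; exists e; split => //; rewrite mulrCA; exact: JM.
Qed.

Lemma localization_sub J w p : J p -> localization J w p.
Proof. by exists 1; rewrite rmorph1 oner_eq0 mul1r. Qed.

Lemma localization_proper J w : zero_of J w -> ~ localization J w 1.
Proof. by move=> Jw [e [e0]]; rewrite mulr1 => /Jw/eqP; apply/negP. Qed.

Lemma eliminates_sub J Q : (forall p, J p -> Q p) -> eliminates J -> eliminates Q.
Proof. by move=> JQ JE i; have [g [g0 /JQ]] := JE i; exists g. Qed.

(** Factor the elimination polynomial as a power of [X - w_i] times a cofactor that is non-zero at
    [w_i]; the cofactor serves as denominator. *)
Lemma localization_pow J w : is_ideal J -> eliminates J ->
  exists k, forall i, localization J w (('X_i - (w 0 i)%:MP) ^+ k).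
Proof.
move=> JI JE.
have /choice[k kE] i : exists k, localization J w (('X_i - (w 0 i)%:MP) ^+ k).
  have [g [g0 Jg]] := JE i; have [k [q /= + gE]] := multiplicity_XsubC g (w 0 i).
  rewrite g0 /= => qr; exists k; exists (map_poly (@mpolyC m K) q).['X_i]; split.
    have -> : mev w (map_poly (@mpolyC m K) q).['X_i] = q.[w 0 i].
      rewrite -horner_map/= mevX -map_poly_comp /= map_poly_id// => c _; exact: mevC.
    by [].
  by move: Jg; rewrite gE rmorphM rmorphXn rmorphB/= map_polyX map_polyC/= hornerM horner_exp hornerXsubC.
exists (\max_i k i)%N => i; rewrite -(subnK (leq_bigmax i)) exprD.
by have [_ _ JM] := localization_ideal w JI; apply: JM.
Qed.

Lemma quotient_dim_comaximal J Q Q' d d' : is_ideal J -> is_ideal Q -> is_ideal Q' ->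
  (forall p, J p <-> Q p /\ Q' p) -> add_ideal Q Q' 1 ->
  has_quotient_dim setT Q d -> has_quotient_dim setT Q' d' -> has_quotient_dim setT J (d + d').
Proof.
move=> JI QI QI' JQ [a [b [Qa Qb ab]]].
move=> /(has_quotient_map (ideal_subspace QI))[v [vL vS vW]].
move=> /(has_quotient_map (ideal_subspace QI'))[v' [vL' vS' vW']].
apply: (@quotient_map_dim _ _ _ _ (fun p => row_mx (v p) (v' p))); split.
- by move=> c p q; rewrite vL vL' scale_row_mx add_row_mx.
- move=> u; have [p pE] := vS (lsubmx u); have [q qE] := vS' (rsubmx u).
  have [_ _ QM] := QI; have [_ _ QM'] := QI'.
  exists (b * p + a * q); rewrite -[RHS]hsubmxK; congr row_mx.
    rewrite -pE; apply/eqP; rewrite -subr_eq0 -(linear_mapB vL); apply/eqP/vW.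
    rewrite -{2}[p]mul1r ab.
    have -> : b * p + a * q - (a + b) * p = a * (q - p) by ring.
    exact: idealM.
  rewrite -qE; apply/eqP; rewrite -subr_eq0 -(linear_mapB vL'); apply/eqP/vW'.
  rewrite -{2}[q]mul1r ab.
  have -> : b * p + a * q - (a + b) * q = b * (p - q) by ring.
  exact: idealM.
- move=> p; rewrite JQ vW vW' -row_mx0; split => [[-> ->]//|/eq_row_mx[]//].
Qed.

(** One zero [w] is split off at a time. The localization at [w] and [J'], obtained by adding an
    element [e] to [J], are comaximal with intersection [J]; so dimensions add, and [J'] keeps the
    other zeros in smaller dimension. *)
Theorem local_decomposition J d : is_ideal J -> eliminates J -> has_quotient_dim setT J d ->
  exists (s : seq 'rV[K]_m) (mult : 'rV[K]_m -> nat),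
    [/\ uniq s, forall w, w \in s <-> zero_of J w,
      forall w, w \in s -> has_quotient_dim setT (localization J w) (mult w) &
      (\sum_(w <- s) mult w)%N = d].
Proof.
elim/ltn_ind: d J => d IH J JI JE Jd; have [J0 JD JM] := JI.
have JS := ideal_subspace JI.
have [J1|J1] := pselect (J 1).
  have JT p : J p by rewrite -[p]mulr1; exact: JM.
  exists [::], (fun=> 0%N); split => // [w|]; last first.
    rewrite big_nil; apply: (has_quotient_dim_uniq JS) Jd.
    apply: (@quotient_map_dim _ _ _ _ (fun=> 0)); split => // [c p q|a].
    - by rewrite scaler0 addr0.
    - by exists 0; rewrite thinmx0.
  split => // Jw; have := Jw 1 J1; rewrite rmorph1 => /eqP; by rewrite oner_eq0.
have [w Jw] := weak_nullstellensatz JI JE J1.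
have QI := localization_ideal w JI; have QS := ideal_subspace QI.
have [[d1 Qd1] [q [qQ qE]]] := has_quotient_dim_sup JS QS (@localization_sub J w) Jd.
have /choice[es esE] i : exists e, mev w e != 0 /\ J (e * q i) by exact: qQ.
(* The localization is finitely generated modulo [J], so the product of the denominators of the
   generators serves all its elements. *)
pose e := \prod_i es i.
have ew : mev w e != 0 by rewrite rmorph_prod prodf_seq_neq0; apply/allP => i _; exact: (esE i).1.
have eQ p : localization J w p -> J (e * p).
  move=> /qE[a Ja]; rewrite -(subrK (\sum_i a 0 i *: q i) p) mulrDr; apply: (JD); first exact: JM.
  rewrite mulr_sumr; apply: (ideal_sum JI) => i _; rewrite -scalerAr -mul_mpolyC; apply: JM.
  by rewrite /e (bigD1 i)//= mulrAC; apply: idealM => //; exact: (esE i).2.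
pose J' := add_ideal J (span (fun _ : 'I_1 => e)).
have eI := span_ideal (fun _ : 'I_1 => e : S).
have J'I : is_ideal J' by exact: add_idealP.
have JJ' p : J p -> J' p by move=> Jp; exact: add_ideal_l.
have J'e : J' e by apply: add_ideal_r => //; exact: (span_gen (fun _ : 'I_1 => e) ord0).
have J'P p : J' p -> exists a r, J a /\ p = a + r * e.
  by move=> [a [_ [Ja [r ->] ->]]]; exists a, (r ord0); rewrite big_ord1.
have [k kQ] := localization_pow w JI JE.
have Qzero v : zero_of (localization J w) v -> v = w.
  move=> Qv; apply/rowP => i; have := Qv _ (kQ i).
  rewrite rmorphXn/= rmorphB/= mevX mevC => /eqP; rewrite expf_eq0 subr_eq0 => /andP[_ /eqP//].
(* Otherwise there would be a common zero; it could only be [w], where [e] does not vanish. *)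
have comax : add_ideal (localization J w) J' 1.
  have AI := add_idealP QI J'I.
  apply: contrapT => A1; have [|v Av] := weak_nullstellensatz AI _ A1.
    by apply: eliminates_sub JE => p Jp; apply: add_ideal_l => //; exact: localization_sub.
  have vw : v = w by apply: Qzero => p Qp; apply: Av; exact: add_ideal_l.
  have := Av e (add_ideal_r QI J'e); rewrite vw => /eqP; exact/negP.
have J'J p : J p <-> localization J w p /\ J' p.
  split => [Jp|[Qp J'p]]; first by split; [exact: localization_sub | exact: JJ'].
  have [a [b [Qa /J'P[x [r [Jx ->]]] E1]]] := comax.
  have [y [s [Jy pE]]] := J'P _ J'p.
  rewrite -[p]mul1r E1 !mulrDl; apply: (JD); last first.
    by apply: (JD); [exact: idealM | rewrite -mulrA; apply: JM; exact: eQ].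
  rewrite pE mulrDr; apply: (JD); first exact: JM.
  by rewrite mulrCA; apply: JM; rewrite mulrC; exact: eQ.
have [[d2 J'd2] _] := has_quotient_dim_sup JS (ideal_subspace J'I) JJ' Jd.
have dE : d = (d1 + d2)%N.
  by apply: (has_quotient_dim_uniq JS Jd); exact: (quotient_dim_comaximal JI QI J'I J'J comax).
have d1_gt0 : (0 < d1)%N.
  rewrite lt0n; apply/eqP => d10; case: (localization_proper Jw).
  have [v [_ _ ->]] := has_quotient_map QS Qd1.
  by move: (v 1); rewrite d10 => u; exact: thinmx0.
have [|s' [mult' [us' s'P s'd s'E]]] := IH d2 _ J' J'I (eliminates_sub JJ' JE) J'd2.
  by rewrite dE -[X in (X < _)%N]add0n ltn_add2r.
have notw v : zero_of J' v -> v != w.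
  by move=> J'v; apply/eqP => vw; have := J'v e J'e; rewrite vw => /eqP; exact/negP.
(* Away from [w] some element that does not vanish multiplies [e] into [J]; hence adding [e] changes
   neither the zeros nor the localizations there. *)
have far v : v != w -> exists a, mev v a != 0 /\ J (e * a).
  move=> /eqP vw; have [i vi] : exists i, v 0 i != w 0 i.
    by apply: contra_notP vw => /forallNP H; apply/rowP => i; apply/eqP; rewrite -[_ == _]negbK; apply/negP; exact: H.
  exists (('X_i - (w 0 i)%:MP) ^+ k); split; last exact/eQ/kQ.
  by rewrite rmorphXn/= rmorphB/= mevX mevC expf_neq0// subr_eq0.
have J'zero v : v != w -> zero_of J v -> zero_of J' v.
  move=> /far[a [a0 Ja]] Jv p /J'P[x [r [Jx ->]]].
  have := Jv _ Ja; rewrite rmorphM => /eqP; rewrite mulf_eq0 (negPf a0) orbF => /eqP e0.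
  by rewrite rmorphD rmorphM/= (Jv _ Jx) e0 mulr0 addr0.
exists (w :: s'), (fun v => if v == w then d1 else mult' v); split.
- rewrite /= us' andbT; apply/negP => /s'P/notw; by rewrite eqxx.
- move=> v; rewrite inE; split.
    case/orP => [/eqP->//|/s'P J'v p /JJ']; exact: J'v.
  move=> Jv; case: eqVneq => //= vw; apply/s'P; exact: J'zero.
- move=> v; rewrite inE; case: eqVneq => [-> //|vw /= vs].
  have -> // : localization J v = localization J' v; last exact: s'd.
  rewrite predeqE => p; split => [[c [c0 /JJ' ?]]|[c [c0 /J'P[x [r [Jx cpE]]]]]]; first by exists c.
  have [a [a0 Ja]] := far v vw; exists (a * c); rewrite rmorphM mulf_neq0//; split => //.
  by rewrite -mulrA cpE mulrDr; apply: (JD); [exact: JM | rewrite mulrCA [a * e]mulrC; exact: JM].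
- rewrite big_cons eqxx dE -s'E; congr addn; rewrite big_seq [RHS]big_seq; apply: eq_bigr => v /s'P/notw.
  by move=> /negPf->.
Qed.

End ZeroDimensional.

(** * Families of linear forms without small dependencies *)

Definition zeros (K : fieldType) N P (L : 'M[K]_(P, N)) (x : 'cV[K]_N) : {set 'I_P} :=
  [set k | (L *m x) k 0 == 0]%SET.

Section Forms.
Variables (K : fieldType) (N P : nat) (L : 'M[K]_(P, N.+1)).
Hypothesis few_zeros : forall x : 'cV[K]_N.+1, x != 0 -> (#|zeros L x| <= N)%N.
Implicit Type C : {set 'I_P}.

Lemma forms_uniq C (x x' : 'cV[K]_N.+1) : (N < #|C|)%N ->
  (forall k, k \in C -> (L *m x) k 0 = (L *m x') k 0) -> x = x'.
Proof.
move=> NC H; apply/eqP; rewrite -subr_eq0; apply: contraTT NC => /few_zeros xN; rewrite -leqNgt.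
apply: leq_trans xN; apply/subset_leq_card/fintype.subsetP => k /H E.
by rewrite inE mulmxBr !mxE; move: E; rewrite !mxE => ->; rewrite subrr.
Qed.

(** The rows in [C] have trivial common kernel by [forms_uniq], hence a left inverse, which is
    padded by zeros outside [C]. *)
Lemma forms_generate C : (N < #|C|)%N ->
  exists c : 'M[K]_(N.+1, P), (forall i k, k \notin C -> c i k = 0) /\ c *m L = 1%:M.
Proof.
move=> NC; pose B := \matrix_(k < P, j < N.+1) if k \in C then L k j else 0.
have : row_full B.
  rewrite -col_leq_rank -mxrank_tr row_leq_rank.
  apply: inj_row_free => v vB; apply: trmx_inj; rewrite trmx0.
  apply: (forms_uniq NC) => k kC; rewrite mulmx0 [RHS]mxE.
  have := congr1 (fun A : 'rV_P => A 0 k) vB; rewrite !mxE => E; rewrite -[RHS]E.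
  by apply: eq_bigr => j _; rewrite !mxE kC mulrC.
case/row_fullP => A AB; exists (\matrix_(i, k) if k \in C then A i k else 0).
split => [i k /negPf kC|]; first by rewrite mxE kC.
rewrite -AB; apply/matrixP => i j; rewrite !mxE; apply: eq_bigr => k _; rewrite !mxE.
by case: ifP => _; rewrite ?mul0r ?mulr0.
Qed.

(** N equations in N + 1 unknowns have a non-zero solution; it cannot annihilate the form [k0] as
    well, for this would make N + 1 zeros. *)
Lemma forms_solve C k0 : k0 \notin C -> #|C| = N ->
  exists x : 'cV[K]_N.+1, (L *m x) k0 0 = 1 /\ forall k, k \in C -> (L *m x) k 0 = 0.
Proof.
move=> k0C CN; pose B := \matrix_(i < #|C|, j < N.+1) L (enum_val i) j.
have /rowV0Pn[v /sub_kermxP vB v0] : kermx B^T != 0.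
  rewrite kermx_eq0 -row_leq_rank -ltnNge; apply: leq_ltn_trans (rank_leq_col _) _.
  by rewrite CN.
have vC k : k \in C -> (L *m v^T) k 0 = 0.
  move=> kC; have := congr1 (fun A : 'rV_#|C| => A 0 (enum_rank_in kC k)) vB.
  rewrite !mxE => E; rewrite -[RHS]E; apply: eq_bigr => j _.
  by rewrite !mxE enum_rankK_in// mulrC.
have vk0 : (L *m v^T) k0 0 != 0.
  apply: contra_neq v0 => vk0; apply: trmx_inj; rewrite trmx0.
  apply: (@forms_uniq (k0 |: C)); first by rewrite cardsU1 k0C CN.
  by move=> k; rewrite !inE mulmx0 [RHS]mxE => /orP[/eqP->//|]; exact: vC.
exists (((L *m v^T) k0 0)^-1 *: v^T); rewrite -scalemxAr; split.
  by rewrite mxE mulVf.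
by move=> k /vC kv; rewrite mxE kv mulr0.
Qed.

End Forms.

(** * The system of bilinear equations *)

Section System.
Variables (K : numClosedFieldType) (N : nat).
Local Notation m := (N + N)%N.
Local Notation P := m.+2.
Variables (Lx Ly : 'M[K]_(P, N.+1)) (eps : 'I_P -> K).
Local Notation S := {mpoly K[m]}.
Local Notation SR := {mpoly {poly K}[m]}.

Definition coord_x (i : 'I_N.+1) : S := if unlift ord0 i is Some j then 'X_(lshift N j) else 1.
Definition coord_y (i : 'I_N.+1) : S := if unlift ord0 i is Some j then 'X_(rshift N j) else 1.
Definition form_x k : S := \sum_i (Lx k i)%:MP * coord_x i.
Definition form_y k : S := \sum_i (Ly k i)%:MP * coord_y i.
(** Row 0 is normalised to 1 and the product in row 1 follows from Parseval's relation; the other 2N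
    rows carry the equations. *)
Definition row2 (k : 'I_m) : 'I_P := lift ord0 (lift ord0 k).
Definition bilinear (t : K) (k : 'I_m) : S := form_x (row2 k) * form_y (row2 k) - t%:MP.

Hypothesis Lx0 : forall i, Lx ord0 i = (i == ord0)%:R.
Hypothesis Ly0 : forall i, Ly ord0 i = (i == ord0)%:R.
Hypothesis few_zeros_x :
  forall x : 'cV[K]_N.+1, x != 0 -> (#|zeros Lx x| <= N)%N.
Hypothesis few_zeros_y :
  forall x : 'cV[K]_N.+1, x != 0 -> (#|zeros Ly x| <= N)%N.
Hypothesis eps0 : eps ord0 = 1.
Hypothesis eps1 : eps (lift ord0 ord0) = -1.
Hypothesis eps_sum : \sum_k eps k = 0.
Hypothesis parseval : forall i j, \sum_k eps k * Lx k i * Ly k j = 0.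

Lemma coord_x0 : coord_x ord0 = 1. Proof. by rewrite /coord_x unlift_none. Qed.
Lemma coord_y0 : coord_y ord0 = 1. Proof. by rewrite /coord_y unlift_none. Qed.

Lemma form_x0 : form_x ord0 = 1.
Proof.
rewrite /form_x (bigD1 ord0)//= Lx0 eqxx mul1r coord_x0 big1 ?addr0// => i /negPf i0.
by rewrite Lx0 i0 mpolyC0 mul0r.
Qed.

Lemma form_y0 : form_y ord0 = 1.
Proof.
rewrite /form_y (bigD1 ord0)//= Ly0 eqxx mul1r coord_y0 big1 ?addr0// => i /negPf i0.
by rewrite Ly0 i0 mpolyC0 mul0r.
Qed.

Lemma eps_row2_sum : \sum_k eps (row2 k) = 0.
Proof. by have := eps_sum; rewrite !big_ord_recl eps0 eps1 addrA subrr add0r. Qed.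

Lemma parseval_forms : \sum_k (eps k)%:MP * (form_x k * form_y k) = 0.
Proof.
transitivity (\sum_i \sum_j (\sum_k eps k * Lx k i * Ly k j)%:MP * (coord_x i * coord_y j)).
  under eq_bigr do rewrite /form_x /form_y mulr_suml mulr_sumr.
  rewrite exchange_big/=; apply: eq_bigr => i _.
  under eq_bigr do rewrite mulr_sumr mulr_sumr.
  rewrite exchange_big/=; apply: eq_bigr => j _.
  rewrite rmorph_sum mulr_suml/=; apply: eq_bigr => k _.
  by rewrite !mpolyCM; ring.
by rewrite big1// => i _; rewrite big1// => j _; rewrite parseval mpolyC0 mul0r.
Qed.

(* Modulo the equations, Parseval's relation makes the remaining product 1. *)
Lemma second_product : form_x (lift ord0 ord0) * form_y (lift ord0 ord0) - 1 =
  \sum_k (eps (row2 k))%:MP * (form_x (row2 k) * form_y (row2 k)).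
Proof.
have := parseval_forms; rewrite !big_ord_recl form_x0 form_y0 eps0 eps1 mpolyCN !mul1r mulN1r.
by rewrite addrA addrC => /eqP; rewrite addr_eq0 opprB => /eqP<-.
Qed.

Definition bilinear_family (k : 'I_m) : SR :=
  const_family (form_x (row2 k) * form_y (row2 k)) - 'X%:MP.

Lemma fibre_bilinear t k : fibre t (bilinear_family k) = bilinear t k.
Proof. by rewrite rmorphB/= fibreK fibreC hornerX. Qed.

Lemma const_familyC c : const_family (c%:MP : S) = (c%:P)%:MP.
Proof. exact: map_mpolyC. Qed.

Lemma forms_expand (L : 'M[K]_(P, N.+1)) (c : 'M[K]_(N.+1, P)) (z : 'I_N.+1 -> SR) (ph : 'I_P -> SR) :
  (forall k, ph k = \sum_i (L k i)%:P *: z i) -> c *m L = 1%:M ->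
  forall j, z j = \sum_k (c j k)%:P *: ph k.
Proof.
move=> phE cL j; transitivity (\sum_i ((c *m L) j i)%:P *: z i).
  rewrite cL (bigD1 j)//= mxE eqxx scale1r big1 ?addr0// => i /negPf ij.
  by rewrite mxE eq_sym ij scale0r.
transitivity (\sum_i \sum_k (c j k * L k i)%:P *: z i).
  by apply: eq_bigr => i _; rewrite mxE rmorph_sum scaler_suml.
rewrite exchange_big; apply: eq_bigr => k _; rewrite phE scaler_sumr.
by apply: eq_bigr => i _; rewrite scalerA rmorphM.
Qed.

(** Modulo the family all 2N + 2 products are scalars: 1 in rows 0 and 1, the parameter ['X] in the
    others. This is the setting of [integral_forms]. *)
Lemma forms_integral (i : 'I_m) : exists g : {poly {poly K}}, [/\ g \is monic, (1 < size g)%N &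
  span bilinear_family (map_poly (@mpolyC m {poly K}) g).['X_i]].
Proof.
pose xs i : SR := const_family (coord_x i).
pose ys i : SR := const_family (coord_y i).
pose w (k : 'I_P) : {poly K} := if unlift ord0 k is Some k1 then
  if unlift ord0 k1 is Some _ then 'X else 1 else 1.
have JI := span_ideal bilinear_family; have [J0 JD JM] := JI.
have E k : const_family (form_x k) = \sum_i (Lx k i)%:P *: xs i.
  by rewrite rmorph_sum/=; apply: eq_bigr => j _; rewrite rmorphM/= const_familyC mul_mpolyC.
have E' k : const_family (form_y k) = \sum_i (Ly k i)%:P *: ys i.
  by rewrite rmorph_sum/=; apply: eq_bigr => j _; rewrite rmorphM/= const_familyC mul_mpolyC.
have prod_w k : span bilinear_family (const_family (form_x k) * const_family (form_y k) - w k *: 1).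
  rewrite -rmorphM -mul_mpolyC mulr1 /w.
  case: unliftP => [k1 ->|->]; last by rewrite form_x0 form_y0 mulr1 rmorph1 subrr.
  case: unliftP => [k2 ->|->]; first exact: span_gen.
  have -> : (1 : {poly K})%:MP = const_family 1 :> SR by rewrite [RHS]rmorph1 mpolyC1.
  rewrite -rmorphB second_product rmorph_sum.
  have -> : \sum_k const_family ((eps (row2 k))%:MP * (form_x (row2 k) * form_y (row2 k))) =
      \sum_k ((eps (row2 k))%:P)%:MP * bilinear_family k.
    under [RHS]eq_bigr do rewrite mulrBr.
    have e0 : \sum_k ((eps (row2 k))%:P)%:MP = 0 :> SR.
      transitivity (((\sum_k eps (row2 k))%:P)%:MP : SR); first by rewrite !rmorph_sum.
      by rewrite eps_row2_sum polyC0 mpolyC0.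
    rewrite sumrB -mulr_suml e0 mul0r subr0.
    by apply: eq_bigr => k2 _; rewrite rmorphM/= const_familyC.
  by apply: (ideal_sum JI) => k2 _; apply: JM; exact: span_gen.
have gen (Cx Cy : seq 'I_P) : (forall k, k \in Cx \/ k \in Cy) ->
  (forall i, exists2 c : 'I_P -> {poly K}, forall k, k \notin Cx -> c k = 0 &
     xs i = \sum_k c k *: const_family (form_x k)) \/
  (forall i, exists2 c : 'I_P -> {poly K}, forall k, k \notin Cy -> c k = 0 &
     ys i = \sum_k c k *: const_family (form_y k)).
  move=> Call; pose A := [set k in Cx]%SET; pose B := [set k in Cy]%SET.
  (* Pigeonhole: two sets with at most N elements each cannot cover 2N + 2 indices. *)
  have : (N < #|A|)%N || (N < #|B|)%N.
    have AB : A :|: B = [set: 'I_P]%SET by apply/setP => k; rewrite !inE; apply/orP; exact: Call.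
    have := cardsU A B; rewrite AB cardsT card_ord; lia.
  case/orP => [/(forms_generate few_zeros_x)|/(forms_generate few_zeros_y)] [c [c0 cL]]; [left|right] => j;
    exists (fun k => (c j k)%:P).
  - by move=> k kC; rewrite c0 ?inE.
  - exact: (forms_expand E cL).
  - by move=> k kC; rewrite c0 ?inE.
  - exact: (forms_expand E' cL).
have xs0 : xs ord0 = 1 by rewrite /xs coord_x0 rmorph1.
have ys0 : ys ord0 = 1 by rewrite /ys coord_y0 rmorph1.
have H := integral_forms JI xs0 ys0 E E' prod_w gen.
have algE (g : {poly {poly K}}) : map_poly (in_alg SR) g = map_poly (@mpolyC m {poly K}) g.
  by apply: eq_map_poly => c; rewrite /= alg_mpolyC.
case: (split_ordP i) => j ->; have [Hx Hy] := H (lift ord0 j).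
- have [g [gm g1]] := Hx; rewrite algE /xs /coord_x liftK /const_family map_mpolyX.
  by exists g.
- have [g [gm g1]] := Hy; rewrite algE /ys /coord_y liftK /const_family map_mpolyX.
  by exists g.
Qed.

Lemma bilinear_eliminates t : eliminates (span (bilinear t)).
Proof.
move=> i; have [g [gm _ [h hE]]] := forms_integral i.
exists (map_poly (horner_eval t) g); split; first by rewrite monic_neq0// monic_map.
exists (fun k => fibre t (h k)).
transitivity (fibre t (map_poly (@mpolyC m {poly K}) g).['X_i]).
  rewrite -horner_map/= [fibre t 'X_i]map_mpolyX; congr (_.[_]).
  by rewrite -!map_poly_comp; apply: eq_map_poly => c; rewrite /= fibreC.
by rewrite hE rmorph_sum/=; apply: eq_bigr => k _; rewrite rmorphM/= fibre_bilinear.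
Qed.

Lemma bilinear_dim : exists d, forall t, has_quotient_dim setT (span (bilinear t)) d.
Proof.
have /choice[g gP] := forms_integral.
have gm i : g i \is monic by have [] := gP i.
have g1 i : (1 < size (g i))%N by have [] := gP i.
have /choice[F FE] i : exists h : 'I_m -> SR,
    (map_poly (@mpolyC m {poly K}) (g i)).['X_i] = \sum_k h k * bilinear_family k.
  by have [] := gP i.
have gF i : (map_poly (@mpolyC m {poly K}) (g i)).['X_i] =
    \sum_k (\matrix_(i, k) F i k : 'M_m) i k * bilinear_family k.
  by rewrite FE; apply: eq_bigr => k _; rewrite mxE.
have [|||I [psi [dl [psiD psiC psi0 psiE]]]] := @complete_intersection_dual_basis _ m bilinear_family g _ gm g1 gF
  (\matrix_(i, j) divided_difference j (map_poly (@mpolyC m {poly K}) (g i)).['X_i])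
  (\matrix_(k, j) divided_difference j (bilinear_family k))
  (\matrix_(i, k) mixed m ((\matrix_(i, k) F i k : 'M_m) i k)); do ?by move=> i j; rewrite mxE.
have [||||d dE] := @fibre_dim K m #|I| bilinear_family (fun i => psi (enum_val i)) (fun i => dl (enum_val i)).
- by move=> i; exact: psiD.
- by move=> i; exact: psiC.
- by move=> i; exact: psi0.
- move=> p; have := psiE p; congr (span _ (_ - _)).
  by rewrite (reindex (@enum_val I predT)) //; exact/onW_bij/enum_val_bij.
exists d => t; have := dE t; congr (has_quotient_dim _ (span _) _).
by apply/funext => k; exact: fibre_bilinear.
Qed.

Definition vec_x w : 'cV[K]_N.+1 := \col_i mev w (coord_x i).
Definition vec_y w : 'cV[K]_N.+1 := \col_i mev w (coord_y i).

Lemma mev_form_x w k : mev w (form_x k) = (Lx *m vec_x w) k 0.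
Proof. by rewrite rmorph_sum mxE; apply: eq_bigr => i _; rewrite rmorphM/= mevC mxE. Qed.

Lemma mev_form_y w k : mev w (form_y k) = (Ly *m vec_y w) k 0.
Proof. by rewrite rmorph_sum mxE; apply: eq_bigr => i _; rewrite rmorphM/= mevC mxE. Qed.

Lemma zero_bilinear t w : zero_of (span (bilinear t)) w <->
  forall k, mev w (form_x (row2 k)) * mev w (form_y (row2 k)) = t.
Proof.
split => [H k|H _ [h ->]].
  have := H _ (span_gen (bilinear t) k); rewrite rmorphB rmorphM/= mevC => /eqP.
  by rewrite subr_eq0 => /eqP.
rewrite rmorph_sum big1// => k _; rewrite rmorphM/= /bilinear rmorphB rmorphM/= mevC H.
by rewrite subrr mulr0.
Qed.

Definition zeros_x w : {set 'I_m} := [set k | mev w (form_x (row2 k)) == 0]%SET.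
Definition zeros_y w : {set 'I_m} := [set k | mev w (form_y (row2 k)) == 0]%SET.

Lemma row2_inj : injective row2. Proof. by move=> i j /lift_inj/lift_inj. Qed.

Lemma ord0_row2 (A : {set 'I_m}) : ord0 \notin (row2 @: A)%SET.
Proof. by apply/imsetP => -[k _ /eqP]; rewrite (negPf (neq_lift _ _)). Qed.

Lemma card_zeros_x w : (#|zeros_x w| <= N)%N.
Proof.
have w0 : vec_x w != 0.
  apply/eqP => /(congr1 (fun A : 'cV_N.+1 => A ord0 0)) /eqP.
  by rewrite !mxE coord_x0 rmorph1 oner_eq0.
apply: leq_trans (few_zeros_x w0); rewrite -(card_imset _ row2_inj); apply/subset_leq_card/fintype.subsetP.
by move=> _ /imsetP[k + ->]; rewrite !inE mev_form_x.
Qed.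

Lemma card_zeros_y w : (#|zeros_y w| <= N)%N.
Proof.
have w0 : vec_y w != 0.
  apply/eqP => /(congr1 (fun A : 'cV_N.+1 => A ord0 0)) /eqP.
  by rewrite !mxE coord_y0 rmorph1 oner_eq0.
apply: leq_trans (few_zeros_y w0); rewrite -(card_imset _ row2_inj); apply/subset_leq_card/fintype.subsetP.
by move=> _ /imsetP[k + ->]; rewrite !inE mev_form_y.
Qed.

Section SpecialFibre.
Variables (w : 'rV[K]_m) (w0 : zero_of (span (bilinear 0)) w).

Lemma zeros_cover k : (k \in zeros_x w) || (k \in zeros_y w).
Proof. by rewrite !inE -mulf_eq0; have /zero_bilinear -> := w0; rewrite eqxx. Qed.

(** Each of the 2N pairs contains a vanishing form, while at most N forms of either kind vanish; so
    both bounds are attained and no pair vanishes twice. *)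
Lemma zeros_compl : #|zeros_x w| = N /\ zeros_y w = ~: zeros_x w.
Proof.
have U : zeros_x w :|: zeros_y w = [set: 'I_m]%SET by apply/setP => k; rewrite inE zeros_cover inE.
have := cardsU (zeros_x w) (zeros_y w); rewrite U cardsT card_ord => cU.
have cx := card_zeros_x w; have cy := card_zeros_y w.
have xN : #|zeros_x w| = N by lia.
have I0 : #|zeros_x w :&: zeros_y w| = 0%N by have := subset_leq_card (subsetIl (zeros_x w) (zeros_y w)); lia.
split => //; apply/setP => k.
have /setP/(_ k) := cards0_eq I0; have := zeros_cover k; rewrite !inE.
by case: (mev w (form_x _) == 0); case: (mev w (form_y _) == 0).
Qed.

(** Where a form vanishes, its partner is a unit near [w], so the form itself lies in the localized
    ideal. These N forms together with row 0 span all linear forms; every coordinate is therefore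
    constant in the local ring, and the solution is simple. *)
Lemma localization_special p : localization (span (bilinear 0)) w p <-> mev w p = 0.
Proof.
have JI := span_ideal (bilinear 0); have QI := localization_ideal w JI; have [Q0 QD QM] := QI.
have Qz q : localization (span (bilinear 0)) w q -> mev w q = 0.
  move=> [e [e0 /w0 /eqP]]; rewrite rmorphM mulf_eq0 => /orP[]; last by move/eqP.
  by move=> ee; rewrite ee in e0.
split => [|pw]; first exact: Qz.
suff QX i : localization (span (bilinear 0)) w ('X_i - (w 0 i)%:MP).
  by have := mpoly_vanishing p QI QX; rewrite pw mpolyC0 subr0.
have [cx yx] := zeros_compl.
have Jxy k : span (bilinear 0) (form_x (row2 k) * form_y (row2 k)).
  by have := span_gen (bilinear 0) k; rewrite /bilinear mpolyC0 subr0.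
have Qx k : k \in zeros_x w -> localization (span (bilinear 0)) w (form_x (row2 k)).
  move=> kx; exists (form_y (row2 k)); split; last by rewrite mulrC.
  have : k \notin zeros_y w by rewrite yx finset.inE negbK.
  by rewrite inE.
have Qy k : k \in zeros_y w -> localization (span (bilinear 0)) w (form_y (row2 k)).
  move=> ky; exists (form_x (row2 k)); split => //.
  by move: ky; rewrite yx !inE.
have key (L : 'M[K]_(P, N.+1)) (z : 'I_N.+1 -> S) (ph : 'I_P -> S) (A : {set 'I_m}) :
    (forall x : 'cV[K]_N.+1, x != 0 -> (#|zeros L x| <= N)%N) -> ph ord0 = 1 ->
    (forall k, ph k = \sum_i (L k i)%:MP * z i) -> #|A| = N ->
    (forall k, k \in A -> localization (span (bilinear 0)) w (ph (row2 k))) ->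
    forall i, exists c, localization (span (bilinear 0)) w (z i - c%:MP).
  move=> Lz ph0 phE AN QA j.
  have [|c [c0 cL]] := forms_generate Lz (C := ord0 |: (row2 @: A)%SET).
    by rewrite cardsU1 ord0_row2 card_imset ?AN//; exact: row2_inj.
  exists (c j ord0).
  have -> : z j - (c j ord0)%:MP = \sum_(k | k != ord0) (c j k)%:MP * ph k.
    have -> : z j = \sum_k (c j k)%:MP * ph k.
      transitivity (\sum_l ((c *m L) j l)%:MP * z l).
        rewrite cL (bigD1 j)//= mxE eqxx mul1r big1 ?addr0// => l /negPf lj.
        by rewrite mxE eq_sym lj mpolyC0 mul0r.
      transitivity (\sum_l \sum_k (c j k * L k l)%:MP * z l).
        by apply: eq_bigr => l _; rewrite mxE rmorph_sum mulr_suml.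
      rewrite exchange_big; apply: eq_bigr => k _; rewrite phE mulr_sumr.
      by apply: eq_bigr => l _; rewrite mpolyCM mulrA.
    by rewrite (bigD1 ord0)//= ph0 mulr1 addrAC subrr add0r.
  apply: (ideal_sum QI) => k k0; have [|kC] := boolP (k \in ord0 |: (row2 @: A)%SET).
    rewrite !inE (negPf k0) => /imsetP[l lA ->]; apply: QM; exact: QA.
  by rewrite c0// mpolyC0 mul0r.
have fix_c (l : 'I_m) c : localization (span (bilinear 0)) w ('X_l - c%:MP) ->
    localization (span (bilinear 0)) w ('X_l - (w 0 l)%:MP).
  move=> Qc; have := Qz _ Qc; rewrite rmorphB/= mevX mevC => /eqP; rewrite subr_eq0 => /eqP -> //.
case: (split_ordP i) => j ->.
  have [c] := key Lx coord_x form_x _ few_zeros_x form_x0 (fun=> erefl) cx Qx (lift ord0 j).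
  by rewrite /coord_x liftK; exact: fix_c.
have cy : #|zeros_y w| = N by rewrite yx; have := cardsC (zeros_x w); rewrite cx card_ord; lia.
have [c] := key Ly coord_y form_y _ few_zeros_y form_y0 (fun=> erefl) cy Qy (lift ord0 j).
by rewrite /coord_y liftK; exact: fix_c.
Qed.

End SpecialFibre.

Lemma zeros_x_inj w w' : zero_of (span (bilinear 0)) w -> zero_of (span (bilinear 0)) w' ->
  zeros_x w = zeros_x w' -> w = w'.
Proof.
move=> w0 w0' E; have [cx yx] := zeros_compl w0; have [cx' yx'] := zeros_compl w0'.
have Ey : zeros_y w = zeros_y w' by rewrite yx yx' E.
have cy : #|zeros_y w| = N by rewrite yx; have := cardsC (zeros_x w); rewrite cx card_ord; lia.
have Vx : vec_x w = vec_x w'.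
  apply: (forms_uniq few_zeros_x (C := ord0 |: (row2 @: zeros_x w)%SET)).
    by rewrite cardsU1 ord0_row2 card_imset ?cx//; exact: row2_inj.
  move=> k; rewrite -!mev_form_x !inE => /orP[/eqP->|/imsetP[l lx ->]].
    by rewrite form_x0 !rmorph1.
  by move: (lx); rewrite {1}E !inE => /eqP->; move: lx; rewrite inE => /eqP->.
have Vy : vec_y w = vec_y w'.
  apply: (forms_uniq few_zeros_y (C := ord0 |: (row2 @: zeros_y w)%SET)).
    by rewrite cardsU1 ord0_row2 card_imset ?cy//; exact: row2_inj.
  move=> k; rewrite -!mev_form_y !inE => /orP[/eqP->|/imsetP[l lx ->]].
    by rewrite form_y0 !rmorph1.
  by move: (lx); rewrite {1}Ey !inE => /eqP->; move: lx; rewrite inE => /eqP->.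
apply/rowP => i; case: (split_ordP i) => j ->.
  by have := congr1 (fun A : 'cV_N.+1 => A (lift ord0 j) 0) Vx; rewrite !mxE /coord_x liftK !mevX.
by have := congr1 (fun A : 'cV_N.+1 => A (lift ord0 j) 0) Vy; rewrite !mxE /coord_y liftK !mevX.
Qed.

Lemma zeros_x_surj (A : {set 'I_m}) : #|A| = N ->
  exists2 w, zero_of (span (bilinear 0)) w & zeros_x w = A.
Proof.
move=> cA; have cB : #|~: A| = N by have := cardsC A; rewrite cA card_ord; lia.
have [|x [x0 xA]] := @forms_solve _ _ _ _ few_zeros_x (row2 @: A)%SET ord0 (ord0_row2 A).
  by rewrite card_imset//; exact: row2_inj.
have [|y [y0 yA]] := @forms_solve _ _ _ _ few_zeros_y (row2 @: ~: A)%SET ord0 (ord0_row2 _).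
  by rewrite card_imset//; exact: row2_inj.
pose w : 'rV[K]_m := \row_i match split i with inl j => x (lift ord0 j) 0 | inr j => y (lift ord0 j) 0 end.
have x00 : x ord0 0 = 1.
  rewrite -x0 mxE (bigD1 ord0)//= Lx0 eqxx mul1r big1 ?addr0// => i /negPf i0.
  by rewrite Lx0 i0 mul0r.
have y00 : y ord0 0 = 1.
  rewrite -y0 mxE (bigD1 ord0)//= Ly0 eqxx mul1r big1 ?addr0// => i /negPf i0.
  by rewrite Ly0 i0 mul0r.
have wx : vec_x w = x.
  apply/colP => i; rewrite !mxE /coord_x; case: unliftP => [j ->|->]; last by rewrite rmorph1.
  by rewrite mevX mxE (unsplitK (inl j)).
have wy : vec_y w = y.
  apply/colP => i; rewrite !mxE /coord_y; case: unliftP => [j ->|->]; last by rewrite rmorph1.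
  by rewrite mevX mxE (unsplitK (inr j)).
have w0 : zero_of (span (bilinear 0)) w.
  apply/zero_bilinear => k; rewrite mev_form_x mev_form_y wx wy.
  have [kA|kA] := boolP (k \in A); first by rewrite xA ?mul0r// imset_f.
  by rewrite yA ?mulr0// imset_f// inE.
exists w => //; apply/esym/eqP; rewrite eqEcard (zeros_compl w0).1 cA leqnn andbT.
apply/fintype.subsetP => k kA; rewrite inE mev_form_x wx xA//; exact: imset_f.
Qed.

Theorem bilinear_count : exists (s : seq 'rV[K]_m) (mult : 'rV[K]_m -> nat),
  [/\ uniq s, forall w, w \in s <-> zero_of (span (bilinear 1)) w,
      forall w, w \in s -> has_quotient_dim setT (localization (span (bilinear 1)) w) (mult w) &
      (\sum_(w <- s) mult w)%N = 'C(N + N, N)].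
Proof.
have [d dE] := bilinear_dim.
suff <- : d = 'C(N + N, N).
  exact: (local_decomposition (span_ideal _) (@bilinear_eliminates 1) (dE 1)).
have [s [mult [us sP sd <-]]] := local_decomposition (span_ideal _) (@bilinear_eliminates 0) (dE 0).
have mult1 w : w \in s -> mult w = 1%N.
  move=> ws; have /sP w0 := ws.
  have QS := ideal_subspace (localization_ideal w (span_ideal (bilinear 0))).
  apply: (has_quotient_dim_uniq QS (sd w ws)).
  (* Evaluation at [w] identifies the local ring with the field. *)
  apply: (@quotient_map_dim _ _ _ _ (fun p => (mev w p)%:M)); split.
  - move=> c p q; rewrite -mul_mpolyC rmorphD rmorphM/= mevC raddfD/=.
    by rewrite -scale_scalar_mx.
  - by move=> a; exists (a 0 0)%:MP; rewrite mevC [RHS]mx11_scalar.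
  - move=> p; rewrite localization_special//; split => [->|/(congr1 (fun A : 'rV_1 => A 0 0))].
      by rewrite raddf0.
    by rewrite !mxE eqxx mulr1n.
rewrite big_seq (eq_bigr (fun=> 1%N)) => [|w ws]; last exact: mult1.
rewrite -big_seq sum1_size -[X in 'C(X, _)]card_ord -card_draws cardE -(size_map zeros_x).
apply/perm_size/uniq_perm; first 1 last.
- exact: enum_uniq.
- move=> A; rewrite mem_enum inE; apply/mapP/eqP => [[w /sP w0 ->]|/zeros_x_surj[w w0 <-]].
    by have [] := zeros_compl w0.
  by exists w => //; exact/sP.
rewrite map_inj_in_uniq// => w w' /sP w0 /sP w0'; exact: zeros_x_inj.
Qed.

End System.

(** * Order of vanishing of a polynomial *)

Lemma digits_inj B m (f g : 'I_m -> nat) : (forall i, (f i < B)%N) -> (forall i, (g i < B)%N) ->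
  (\sum_i f i * B ^ i = \sum_i g i * B ^ i)%N -> f =1 g.
Proof.
elim: m f g => [|m IH] f g fB gB; first by move=> _ [].
have E (h : 'I_m.+1 -> nat) : (\sum_i h i * B ^ i = h ord0 + (\sum_i h (lift ord0 i) * B ^ i) * B)%N.
  rewrite big_ord_recl muln1 big_distrl; congr addn; apply: eq_bigr => i _.
  by rewrite /= expnSr mulnA.
rewrite !E => H.
have f0 : f ord0 = g ord0.
  have := congr1 (modn^~ B) H; rewrite ![(_ + _ * B)%N]addnC !modnMDl !modn_small//.
have B0 : (0 < B)%N by exact: leq_ltn_trans (fB ord0).
move: H; rewrite f0 => /addnI/eqP; rewrite eqn_pmul2r// => /eqP/IH H i.
case: (unliftP ord0 i) => [j ->|-> //]; exact: (H (fun i => fB _) (fun i => gB _)).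
Qed.

Lemma poly_nonroot (K : numFieldType) (q : {poly K}) : q != 0 -> exists t, q.[t] != 0.
Proof.
move=> q0; apply: contrapT => /forallNP H.
have : (size [seq i%:R : K | i <- iota 0 (size q)] < size q)%N.
  apply: (max_poly_roots q0).
    by apply/allP => _ /mapP[i _ ->]; rewrite rootE -[_ == _]negbK; apply/negP; exact: H.
  rewrite map_inj_uniq ?iota_uniq// => i j /eqP.
  by rewrite eqr_nat => /eqP.
by rewrite size_map size_iota ltnn.
Qed.

(** The order of [K] is only partial, so a product of two numbers below 1 replaces a minimum. *)
Lemma small_number (K : numFieldType) (d e C : K) : 0 < d -> 0 < e -> 0 <= C ->
  exists z, [/\ 0 < z, z <= 1, z < d & C * z < e].
Proof.
move=> dpos e0 C0; pose x := d / (1 + d); pose y := e / (1 + e + C).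
have dp : 0 < 1 + d by rewrite addr_gt0.
have yd : 0 < 1 + e + C by rewrite ltr_wpDr// addr_gt0.
have x0 : 0 < x by exact: divr_gt0.
have y0 : 0 < y by exact: divr_gt0.
have x1 : x < 1 by rewrite ltr_pdivrMr// mul1r ltrDr.
have xd : x <= d by rewrite ler_pdivrMr// ler_peMr ?lerDl ?(ltW dpos).
have y1 : y < 1 by rewrite ltr_pdivrMr// mul1r -addrA addrCA ltrDl ltr_wpDr.
have zy : x * y < y by rewrite gtr_pMl.
exists (x * y); split; first exact: mulr_gt0.
- by apply/ltW/(lt_trans zy).
- by apply: lt_le_trans xd; rewrite gtr_pMr.
- apply: le_lt_trans (ler_wpM2l C0 (ltW zy)) _.
  by rewrite /y mulrA ltr_pdivrMr// mulrC ltr_pM2l// ltrDr addr_gt0.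
Qed.

Section Order.
Variables (K : numClosedFieldType) (m : nat).
Local Notation S := {mpoly K[m]}.
Implicit Types (r rho : S) (w u v : 'rV[K]_m).

Definition shift w : S -> S := mmap (@mpolyC m K) (fun i => 'X_i - (w 0 i)%:MP).
HB.instance Definition _ w := GRing.RMorphism.copy (shift w) (mmap (@mpolyC m K) (fun i => 'X_i - (w 0 i)%:MP)).

Lemma shiftC w c : shift w c%:MP = c%:MP. Proof. exact: mmapC. Qed.
Lemma shiftX w i : shift w 'X_i = 'X_i - (w 0 i)%:MP.
Proof. by rewrite /shift mmapX mmap1U. Qed.

Lemma shift_surj w r : exists rho, r = shift w rho.
Proof.
elim/mpoly_ring_ind: r => [c|i p [rho ->]|p q [rho ->] [rho' ->]].
- by exists c%:MP; rewrite shiftC.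
- by exists (('X_i + (w 0 i)%:MP) * rho); rewrite rmorphM rmorphD/= shiftX shiftC subrK.
- by exists (rho + rho'); rewrite rmorphD.
Qed.

Lemma mev_shift w rho u : mev (w + u) (shift w rho) = mev u rho.
Proof.
elim/mpoly_ring_ind: rho => [c|i p E|p q E E'].
- by rewrite shiftC !mevC.
- by rewrite rmorphM/= shiftX !rmorphM/= rmorphB/= !mevX mevC mxE addrAC subrr add0r E.
- by rewrite rmorphD/= !rmorphD/= E E'.
Qed.

(** Kronecker's substitution: in the direction with coordinates [t ^+ (B ^ i)], where [B] exceeds
    all exponents, distinct monomials become distinct powers of t. The lowest homogeneous part turns
    into a non-zero polynomial in t, and any non-root gives a direction. *)
Lemma low_order_direction rho D : (exists2 a, (mdeg a < D)%N & rho@_a != 0) ->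
  exists v d0 (h : {poly K}), [/\ (d0 < D)%N, h.[0] != 0 &
    forall z, mev (z *: v) rho = z ^+ d0 * h.[z]].
Proof.
move=> [a1 a1D a1rho].
pose P d := has (fun a => mdeg a == d) (msupp rho).
have P1 : P (mdeg a1) by apply/hasP; exists a1 => //; rewrite mcoeff_msupp.
have [d0 /hasP[a0 a0rho /eqP a0d] d0min] := ex_minnP (ex_intro P _ P1).
pose B := msize rho; pose kap (a : 'X_{1..m}) := (\sum_i a i * B ^ i)%N.
have aB a : a \in msupp rho -> forall i, (a i < B)%N.
  move=> /msize_mdeg_lt aB i; apply: leq_ltn_trans aB.
  by rewrite mdegE (bigD1 i)//= leq_addr.
pose q : {poly K} := \sum_(a <- msupp rho | mdeg a == d0) rho@_a *: 'X^(kap a).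
have q0 : q != 0.
  apply/eqP => /(congr1 (fun p : {poly K} => p`_(kap a0))); rewrite coef0 coef_sum.
  rewrite -big_filter (bigD1_seq a0) ?filter_uniq ?msupp_uniq ?mem_filter ?a0d ?eqxx//= coefZ coefXn eqxx mulr1 big1_seq => [|a].
    by rewrite addr0 => /eqP; rewrite -[_ == _]negbK -mcoeff_msupp a0rho.
  rewrite mem_filter => /andP[aa0 /andP[_ ar]]; rewrite coefZ coefXn; case: eqP => [E|]; rewrite ?mulr0//.
  case/eqP: aa0; apply/mnmP => i; apply: (digits_inj (aB _ ar) (aB _ a0rho)).
  by rewrite -/(kap a) -E.
have [t t0] := poly_nonroot q0.
pose v : 'rV[K]_m := \row_i t ^+ (B ^ i).
have vE (a : 'X_{1..m}) : \prod_i (v 0 i) ^+ a i = t ^+ kap a.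
  by rewrite /kap expr_sum; apply: eq_bigr => i _; rewrite mxE -exprM mulnC.
pose h : {poly K} := \sum_(a <- msupp rho) (rho@_a * t ^+ kap a) *: 'X^(mdeg a - d0).
exists v, d0, h; split.
- by apply: leq_ltn_trans a1D; exact: d0min.
- suff -> : h.[0] = q.[t] by [].
  rewrite !horner_sum big_seq [RHS]big_seq_cond big_mkcondr/=; apply: eq_bigr => a ar.
  have ad : (d0 <= mdeg a)%N by apply: d0min; apply/hasP; exists a.
  rewrite hornerZ hornerXn expr0n subn_eq0 eqn_leq ad andbT; case: leqP => _.
    by rewrite mulr1 hornerZ hornerXn.
  by rewrite mulr0.
- move=> z; rewrite /mev mevalE horner_sum mulr_sumr big_seq [RHS]big_seq; apply: eq_bigr => a ar.
  have ad : (d0 <= mdeg a)%N by apply: d0min; apply/hasP; exists a.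
  rewrite hornerZ hornerXn mulrCA -exprD subnKC// -mulrA -vE; congr (_ * _).
  rewrite mulrC mdegE expr_sum -big_split/=; apply: eq_bigr => i _.
  by rewrite !mxE exprMn.
Qed.

Lemma horner_bounded (h : {poly K}) : exists2 B, 0 <= B & forall z, `|z| <= 1 -> `|h.[z]| <= B.
Proof.
exists (\sum_(i < size h) `|h`_i|); first by apply: sumr_ge0.
move=> z z1; rewrite horner_coef; apply: le_trans (ler_norm_sum _ _ _) _; apply: ler_sum => i _.
by rewrite normrM normrX ler_piMr// exprn_ile1.
Qed.

(* Restrict to a line on which the lowest homogeneous part does not vanish. *)
Lemma poly_order (Q : set S) r w D : is_ideal Q ->
  (forall a : 'X_{1..m}, (D <= mdeg a)%N -> Q (\prod_i ('X_i - (w 0 i)%:MP) ^+ a i)) ->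
  (forall v, exists C d, [/\ 0 <= C, 0 < d & forall z, `|z| < d -> `|mev (w + z *: v) r| <= C * `|z| ^+ D]) ->
  Q r.
Proof.
move=> QI QD rO; have [Q0 _ QM] := QI; have [rho rE] := shift_surj w r.
have [bad|good] := pselect (exists2 a, (mdeg a < D)%N & rho@_a != 0); last first.
  rewrite rE /shift /mmap; rewrite big_seq; apply: (ideal_sum QI) => a ar; apply: QM; apply: QD.
  rewrite leqNgt; apply: contra_notN good => aD; exists a => //.
  by rewrite -mcoeff_msupp.
have [v [d0 [h [d0D h0 hE]]]] := low_order_direction bad.
have [C [d [C0 dpos CE]]] := rO v.
have /factor_theorem[h1 h1E] : root (h - (h.[0])%:P) 0 by rewrite rootE hornerD hornerN hornerC subrr.
have [B B0 BE] := horner_bounded h1.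
have hp : 0 < `|h.[0]| by rewrite normr_gt0.
have [z [z0 z1 zd zh]] := small_number dpos hp (addr_ge0 C0 B0).
have nz : `|z| = z by rewrite gtr0_norm.
have hz : `|h.[z]| <= C * z.
  have := CE z; rewrite nz => /(_ zd); rewrite rE mev_shift hE normrM normrX nz.
  rewrite -(subnKC d0D) exprD exprSr mulrCA -!mulrA ler_pM2l ?exprn_gt0// => H; apply: le_trans H _.
  rewrite mulrCA mulrA; apply: ler_piMr; first by rewrite mulr_ge0// ltW.
  by apply: exprn_ile1 => //; exact: ltW.
have h1z : `|h.[0]| <= C * z + B * z.
  have -> : h.[0] = h.[z] - (h - (h.[0])%:P).[z] by rewrite hornerD hornerN hornerC opprB addrC subrK.
  apply: le_trans (ler_normB _ _) _; apply: lerD => //.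
  rewrite h1E hornerM hornerXsubC subr0 normrM nz ler_pM2r//.
  by apply: BE; rewrite nz.
by move: zh; rewrite mulrDl => /(le_lt_trans h1z); rewrite ltxx.
Qed.

Lemma localization_power_products (J : set S) w : is_ideal J -> eliminates J ->
  exists D, forall a : 'X_{1..m}, (D <= mdeg a)%N ->
    localization J w (\prod_i ('X_i - (w 0 i)%:MP) ^+ a i).
Proof.
move=> JI JE; have [k kQ] := localization_pow w JI JE; have QI := localization_ideal w JI.
(* Pigeonhole: a monomial of larger degree than m * k has an exponent that is at least k. *)
exists (m * k).+1 => a aD.
have [i ki] : exists i, (k <= a i)%N.
  apply: contrapT => /forallNP H; suff : (mdeg a <= m * k)%N by rewrite leqNgt aD.
  rewrite mdegE -[X in (_ <= X * _)%N]card_ord -sum_nat_const; apply: leq_sum => i _.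
  by apply: ltnW; rewrite ltnNge; apply/negP; exact: H.
rewrite (bigD1 i)//= -(subnKC ki) exprD; apply: (idealM QI); apply: (idealM QI); exact: kQ.
Qed.

Lemma prod_count (T : comNzRingType) (F : 'I_m -> T) (s : seq 'I_m) :
  \prod_(j <- s) F j = \prod_i F i ^+ [multinom count_mem i s | i < m] i.
Proof.
elim: s => [|j s IH]; first by rewrite big_nil big1// => i _; rewrite mnmE.
rewrite big_cons IH [RHS](bigD1 j)//= [in LHS](bigD1 j)//= !mnmE eqxx add1n exprS mulrA; congr (_ * _).
by apply: eq_bigr => i ij; rewrite !mnmE /= eq_sym (negPf ij).
Qed.

Lemma mdeg_count (s : seq 'I_m) : mdeg [multinom count_mem i s | i < m] = size s.
Proof.
rewrite mdegE; under eq_bigr do rewrite mnmE.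
elim: s => [|j s IH]; first by rewrite big1.
by rewrite /= big_split/= IH (bigD1 j)//= eqxx big1// => i /negPf ij; rewrite eq_sym ij.
Qed.

End Order.

End CompleteIntersections.

From mathcomp Require Import complex.
From mathcomp Require Import all_classical all_reals.
From mathcomp Require Import topology normedtype landau derive trigo.
From mathcomp Require interval_inference.

Import Order.TTheory GRing.Theory Num.Theory.
Import numFieldNormedType.Exports.

Local Open Scope classical_set_scope.
Local Open Scope ring_scope.

(** * Cauchy estimates without integrals *)

Section RealSquares.
Variable R : realType.
Implicit Types (x y t : R).

Lemma half_pow_small (t d : R) : 0 < d -> exists k, t / 2 ^+ k < d.
Proof.
move=> d0.
have [k tk] : exists k : nat, t / d < k%:R.
  by exists (Num.bound `|t / d|); rewrite (le_lt_trans (ler_norm _)) // archi_boundP.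
exists k; rewrite ltr_pdivrMr ?exprn_gt0// mulrC -ltr_pdivrMr//.
by rewrite (lt_le_trans tk)// -natrX ler_nat ltnW// ltn_expl.
Qed.

Lemma nested_intervals (x t : nat -> R) :
  (forall k, 0 <= t k) -> (forall k, x k <= x k.+1) ->
  (forall k, x k.+1 + t k.+1 <= x k + t k) ->
  exists a, forall k, x k <= a <= x k + t k.
Proof.
move=> t0 xm xtm.
have xm' j k : (j <= k)%N -> x j <= x k by apply: (homo_leq (fun y => lexx y) (@le_trans _ _)).
have xt j k : (j <= k)%N -> x k + t k <= x j + t j.
  by move/(homo_leq (r := fun a b => b <= a) (f := fun k => x k + t k)); apply => //;
   move=> a b c ba cb; apply: le_trans ba.
have ub k : ubound (range x) (x k + t k).
  move=> _ [j _ <-]; have [jk|kj] := leqP j k.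
    by rewrite (le_trans (xm' _ _ jk)) // lerDl.
  by rewrite (le_trans _ (xt _ _ (ltnW kj))) // lerDl.
have ne : range x !=set0 by exists (x 0); exists 0.
exists (sup (range x)) => k; apply/andP; split; last by apply: ge_sup => //; exact: ub.
by apply: ub_le_sup; [exists (x 0 + t 0); exact: ub | exists k].
Qed.

(** A square on which [P] fails has a quarter on which it fails; the nested squares obtained in this
    way shrink to a point, where the local hypothesis gives a contradiction. *)
Lemma square_induction (P : R -> R -> R -> Prop) x0 y0 t0 : 0 < t0 ->
  (forall x y t, 0 < t -> P x y (t / 2) -> P (x + t / 2) y (t / 2) ->
     P x (y + t / 2) (t / 2) -> P (x + t / 2) (y + t / 2) (t / 2) -> P x y t) ->
  (forall a b, x0 <= a <= x0 + t0 -> y0 <= b <= y0 + t0 ->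
     exists2 d, 0 < d & forall x y t, 0 < t -> t < d ->
       x <= a <= x + t -> y <= b <= y + t -> P x y t) ->
  P x0 y0 t0.
Proof.
move=> t0_gt0 Psub Ploc; apply: contrapT => nP0.
have next (s : R * R * R) : exists s' : R * R * R,
    0 < s.2 -> ~ P s.1.1 s.1.2 s.2 ->
    [/\ s'.2 = s.2 / 2, ~ P s'.1.1 s'.1.2 s'.2,
      s.1.1 <= s'.1.1 /\ s'.1.1 + s'.2 <= s.1.1 + s.2 &
      s.1.2 <= s'.1.2 /\ s'.1.2 + s'.2 <= s.1.2 + s.2].
  case: s => [[x y] t] /=.
  have [t_gt0|] := pselect (0 < t); last by exists (x, y, t).
  have [|nP] := pselect (P x y t); first by exists (x, y, t).
  have [p1|] := pselect (P x y (t / 2)); last first.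
    by exists (x, y, t / 2) => /= _ _; split => //; split; lra.
  have [p2|] := pselect (P (x + t / 2) y (t / 2)); last first.
    by exists (x + t / 2, y, t / 2) => /= _ _; split => //; split; lra.
  have [p3|] := pselect (P x (y + t / 2) (t / 2)); last first.
    by exists (x, y + t / 2, t / 2) => /= _ _; split => //; split; lra.
  have [p4|] := pselect (P (x + t / 2) (y + t / 2) (t / 2)); last first.
    by exists (x + t / 2, y + t / 2, t / 2) => /= _ _; split => //; split; lra.
  by case: nP; apply: Psub.
have [nx nxP] := choice next.
pose s k := iter k nx (x0, y0, t0).
have sP k : 0 < (s k).2 /\ ~ P (s k).1.1 (s k).1.2 (s k).2.
  elim: k => [//|k [sk nPk]].
  by have [-> nP _ _] := nxP _ sk nPk; split => //; rewrite divr_gt0.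
have sS k : [/\ (s k.+1).2 = (s k).2 / 2,
      (s k).1.1 <= (s k.+1).1.1 /\ (s k.+1).1.1 + (s k.+1).2 <= (s k).1.1 + (s k).2 &
      (s k).1.2 <= (s k.+1).1.2 /\ (s k.+1).1.2 + (s k.+1).2 <= (s k).1.2 + (s k).2].
  by have [sk nPk] := sP k; have [? _ ? ?] := nxP _ sk nPk; split.
have tE k : (s k).2 = t0 / 2 ^+ k.
  elim: k => [|k IH]; first by rewrite expr0 divr1.
  by have [-> _ _] := sS k; rewrite IH exprSr invfM mulrA.
have [a aP] : exists a, forall k, (s k).1.1 <= a <= (s k).1.1 + (s k).2.
  apply: (@nested_intervals (fun k => (s k).1.1) (fun k => (s k).2)) => k.
  - by have [/ltW] := sP k.
  - by have [_ []] := sS k.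
  - by have [_ []] := sS k.
have [b bP] : exists b, forall k, (s k).1.2 <= b <= (s k).1.2 + (s k).2.
  apply: (@nested_intervals (fun k => (s k).1.2) (fun k => (s k).2)) => k.
  - by have [/ltW] := sP k.
  - by have [_ _ []] := sS k.
  - by have [_ _ []] := sS k.
have [d d0 Pd] : exists2 d, 0 < d & forall x y t, 0 < t -> t < d ->
       x <= a <= x + t -> y <= b <= y + t -> P x y t.
  by apply: Ploc; [exact: (aP 0) | exact: (bP 0)].
have [k kd] := half_pow_small t0 d0.
have [sk nPk] := sP k; apply: nPk; apply: Pd => //.
by rewrite tE.
Qed.

End RealSquares.

Section CauchyEstimate.
Variable R : realType.
Local Notation K := (R[i]).
Local Notation C_ x := (x%:C%C : K).

(** Norms over [R[i]] take complex values; their real parts make real linear arithmetic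
    available. *)
Definition nrm (V : normedZmodType K) (v : V) : R := complex.Re `|v|.

Lemma nrmE (V : normedZmodType K) (v : V) : `|v| = C_ (nrm v).
Proof. by rewrite /nrm; case: `|v| (normr_ge0 v) => a b; rewrite lecE/= => /andP[/eqP->]. Qed.

Lemma nrm_ge0 (V : normedZmodType K) (v : V) : 0 <= nrm v.
Proof. by rewrite -lecR -nrmE; exact: normr_ge0. Qed.

Lemma ler_nrmD (V : normedZmodType K) (v w : V) : nrm (v + w) <= nrm v + nrm w.
Proof. by rewrite -lecR rmorphD/= -!nrmE ler_normD. Qed.

Lemma nrmN (V : normedZmodType K) (v : V) : nrm (- v) = nrm v.
Proof. by rewrite /nrm normrN. Qed.

Lemma nrm0 (V : normedZmodType K) : nrm (0 : V) = 0.
Proof. by rewrite /nrm normr0. Qed.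

Lemma nrm_eq0 (V : normedZmodType K) (v : V) : (nrm v == 0) = (v == 0).
Proof. by rewrite -[RHS]normr_eq0 nrmE -(inj_eq (@complexI R)). Qed.

Lemma nrm_gt0 (V : normedZmodType K) (v : V) : (0 < nrm v) = (v != 0).
Proof. by rewrite lt_def nrm_ge0 andbT nrm_eq0. Qed.

Lemma nrm_distC (V : normedZmodType K) (v w : V) : nrm (v - w) = nrm (w - v).
Proof. by rewrite -nrmN opprB. Qed.

Lemma nrmM (x y : K) : nrm (x * y) = nrm x * nrm y.
Proof. by apply: complexI; rewrite rmorphM/= -!nrmE normrM. Qed.

Lemma nrmV (x : K) : nrm x^-1 = (nrm x)^-1.
Proof. by apply: complexI; rewrite fmorphV/= -!nrmE normfV. Qed.

Lemma nrmX (x : K) n : nrm (x ^+ n) = nrm x ^+ n.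
Proof. by apply: complexI; rewrite rmorphXn/= -!nrmE normrX. Qed.

Lemma nrm_real (x : R) : nrm (C_ x) = `|x|.
Proof. by apply: complexI; rewrite -nrmE normc_def/= expr0n/= addr0 sqrtr_sqr. Qed.

Lemma nrm_i : nrm ('i%C : K) = 1.
Proof. by apply: complexI; rewrite -nrmE normc_def/= expr0n/= add0r expr1n sqrtr1. Qed.

Lemma nrm_sum (V : normedZmodType K) (I : Type) (r : seq I) (P : pred I) (F : I -> V) :
  nrm (\sum_(i <- r | P i) F i) <= \sum_(i <- r | P i) nrm (F i).
Proof.
elim/big_ind2: _ => // [|v x w y vx wy]; first by rewrite nrm0.
by rewrite (le_trans (ler_nrmD _ _)) ?lerD.
Qed.

Lemma abs_Re_le (z : K) : `|complex.Re z| <= nrm z.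
Proof. by rewrite -lecR -nrmE normc_ge_Re. Qed.

Lemma abs_Im_le (z : K) : `|complex.Im z| <= nrm z.
Proof.
have := abs_Re_le (z * 'i%C); rewrite nrmM nrm_i mulr1.
by case: z => a b /=; rewrite mulr0 mulr1 sub0r normrN.
Qed.

Lemma nrm_le_ReIm (x y : R) : nrm (x +i* y)%C <= `|x| + `|y|.
Proof.
have -> : (x +i* y)%C = C_ x + 'i%C * C_ y by simpc.
by rewrite (le_trans (ler_nrmD _ _)) // nrmM nrm_i mul1r !nrm_real.
Qed.

Lemma ler_nrm_sub (V : normedZmodType K) (u v w : V) : nrm (u - w) <= nrm (u - v) + nrm (v - w).
Proof. by have := ler_nrmD (u - v) (v - w); rewrite addrA subrK. Qed.

Definition has_deriv (F : K -> K) (a D : K) : Prop := forall e : R, 0 < e ->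
  exists2 d : R, 0 < d & forall z, nrm (z - a) < d ->
    nrm (F z - F a - D * (z - a)) <= e * nrm (z - a).

(** The Riemann sum, with N sample points on each side, of the counterclockwise integral of [F]
    along the boundary of the square with lower left corner [x + iy] and side [t]. *)
Definition bsum (F : K -> K) (N : nat) (x y t : R) : K :=
  \sum_(k < N) C_ (t / N%:R) *
    (F ((x + k%:R * (t / N%:R)) +i* y)%C - F ((x + k%:R * (t / N%:R)) +i* (y + t))%C
     + 'i%C * (F ((x + t) +i* (y + k%:R * (t / N%:R)))%C - F (x +i* (y + k%:R * (t / N%:R)))%C)).

Lemma big_ord_mul (V : nmodType) (q N : nat) (G : nat -> V) :
  \sum_(k < q * N) G k = \sum_(a < q) \sum_(k < N) G (a * N + k)%N.
Proof.
elim: q => [|q IH]; first by rewrite !big_ord0.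
rewrite big_ord_recr/= -IH mulSn addnC big_split_ord/=.
by congr (_ + _).
Qed.

(** The q N sample points of a line are exactly those of its q pieces, so interior sides cancel with
    no error term. *)
Lemma bsum_subdivide F (q N : nat) x y t : (0 < q)%N -> (0 < N)%N ->
  bsum F (q * N) x y t = \sum_(a < q) \sum_(b < q)
    bsum F N (x + a%:R * (t / q%:R)) (y + b%:R * (t / q%:R)) (t / q%:R).
Proof.
move=> q0 N0.
have q0' : q%:R != 0 :> R by rewrite pnatr_eq0 -lt0n.
have N0' : N%:R != 0 :> R by rewrite pnatr_eq0 -lt0n.
pose h (N : nat) x y (t : R) : K :=
  \sum_(k < N) C_ (t / N%:R) * F ((x + k%:R * (t / N%:R)) +i* y)%C.
pose v (N : nat) x y (t : R) : K :=
  \sum_(k < N) C_ (t / N%:R) * F (x +i* (y + k%:R * (t / N%:R)))%C.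
have bE M x' y' t' : bsum F M x' y' t' =
    h M x' y' t' - h M x' (y' + t') t' + 'i%C * (v M (x' + t') y' t' - v M x' y' t').
  rewrite /bsum /h /v -!sumrB mulr_sumr -big_split/=.
  by apply: eq_bigr => k _; ring.
have hE x' y' : h (q * N)%N x' y' t =
    \sum_(a < q) h N (x' + a%:R * (t / q%:R)) y' (t / q%:R).
  rewrite /h (big_ord_mul _ _ (fun k => C_ (t / (q * N)%:R) *
     F ((x' + k%:R * (t / (q * N)%:R)) +i* y')%C)).
  apply: eq_bigr => a _; apply: eq_bigr => k _.
  have E : t / (q * N)%:R = t / q%:R / N%:R by rewrite natrM; field; rewrite q0' N0'.
  rewrite E; congr (_ * F (_ +i* _)%C).
  by rewrite natrD natrM; field; rewrite q0' N0'.
have vE x' y' : v (q * N)%N x' y' t =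
    \sum_(b < q) v N x' (y' + b%:R * (t / q%:R)) (t / q%:R).
  rewrite /v (big_ord_mul _ _ (fun k => C_ (t / (q * N)%:R) *
     F (x' +i* (y' + k%:R * (t / (q * N)%:R)))%C)).
  apply: eq_bigr => a _; apply: eq_bigr => k _.
  have E : t / (q * N)%:R = t / q%:R / N%:R by rewrite natrM; field; rewrite q0' N0'.
  rewrite E; congr (_ * F (_ +i* _)%C).
  by rewrite natrD natrM; field; rewrite q0' N0'.
have tE : q%:R * (t / q%:R) = t by field.
have tel (G : R -> K) w : \sum_(b < q) (G (w + b%:R * (t / q%:R)) -
    G (w + b%:R * (t / q%:R) + t / q%:R)) = G w - G (w + t).
  pose G' (b : nat) := - G (w + b%:R * (t / q%:R)).
  rewrite (eq_bigr (fun b : 'I_q => G' b.+1 - G' b)); last first.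
    move=> b _; rewrite /G' opprK addrC; congr (- G _ + _).
    by rewrite -natr1 mulrDl mul1r addrA.
  rewrite -(big_mkord xpredT (fun b => G' b.+1 - G' b)) telescope_sumr//.
  by rewrite /G' mul0r addr0 tE opprK addrC.
rewrite bE !hE !vE.
under [RHS]eq_bigr do under eq_bigr do rewrite bE.
under [RHS]eq_bigr do rewrite big_split/= (tel (fun y => h N _ y _)).
rewrite big_split/= sumrB; congr (_ + _).
rewrite [RHS]exchange_big/= -sumrB mulr_sumr; apply: eq_bigr => b _.
rewrite -mulr_sumr; congr (_ * _).
by rewrite -[LHS]opprB -(tel (fun x => v N x _ _)) -sumrN; apply: eq_bigr => a _; rewrite opprB.
Qed.

Lemma bsum_lin (F G : K -> K) N x y t (c : K) :
  bsum (fun z => F z + c * G z) N x y t = bsum F N x y t + c * bsum G N x y t.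
Proof. by rewrite /bsum mulr_sumr -big_split/=; apply: eq_bigr => k _; ring. Qed.

(** Each summand already vanishes: bottom minus top is [- i D t], and i times right minus left is
    [i D t]. *)
Lemma bsum_affine (c D w : K) N x y t : bsum (fun z => c + D * (z - w)) N x y t = 0.
Proof.
rewrite /bsum big1// => k _; apply/eqP; rewrite mulf_eq0; apply/orP; right.
set d := k%:R * _.
have -> : ((x + d) +i* (y + t))%C = ((x + d) +i* y)%C + 'i%C * C_ t by simpc.
have -> : ((x + t) +i* (y + d))%C = (x +i* (y + d))%C + C_ t by simpc.
by apply/eqP; ring: (sqr_i R).
Qed.

Lemma bsum_le (F : K -> K) N x y t B : 0 <= t ->
  (forall u v, x <= u <= x + t -> y <= v <= y + t ->
     (u == x) || (u == x + t) || (v == y) || (v == y + t) -> nrm (F (u +i* v)%C) <= B) ->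
  nrm (bsum F N x y t) <= 4 * t * B.
Proof.
move=> t0 FB; have [->|N0] := posnP N.
  rewrite /bsum big_ord0 nrm0; apply: mulr_ge0; first by rewrite mulr_ge0.
  by apply: le_trans (FB x y _ _ _); rewrite ?nrm_ge0 ?lexx ?lerDl ?eqxx.
have N0' : N%:R != 0 :> R by rewrite pnatr_eq0 -lt0n.
have -> : 4 * t * B = \sum_(k < N) (t / N%:R) * (4 * B).
  by rewrite sumr_const card_ord -mulr_natl; field.
apply: le_trans (nrm_sum _ _ _) _; apply: ler_sum => k _.
rewrite nrmM nrm_real ger0_norm ?divr_ge0// ler_wpM2l ?divr_ge0//.
have d1 : 0 <= k%:R * (t / N%:R) by rewrite mulr_ge0 ?divr_ge0.
have d2 : k%:R * (t / N%:R) <= t.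
  rewrite mulrCA ler_piMr// ler_pdivrMr ?ltr0n// mul1r ler_nat ltnW//.
have H (u v w z : K) : nrm (u - v + 'i%C * (w - z)) <= nrm u + nrm v + (nrm w + nrm z).
  apply: le_trans (ler_nrmD _ _) _; rewrite nrmM nrm_i mul1r.
  by apply: lerD; apply: le_trans (ler_nrmD _ _) _; rewrite nrmN.
apply: le_trans (H _ _ _ _) _.
have -> : 4 * B = B + B + (B + B) by ring.
do !apply: lerD; apply: FB; rewrite ?eqxx ?orbT ?lexx ?lerDl//; apply/andP; split; lra.
Qed.

(** The exact subdivision needs matching sample points, so the estimate is claimed for the multiples
    of some [N0] instead of all large N. *)
Lemma goursat (F : K -> K) x0 y0 t0 : 0 < t0 ->
  (forall u v, x0 <= u <= x0 + t0 -> y0 <= v <= y0 + t0 ->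
     exists D, has_deriv F (u +i* v)%C D) ->
  forall e, 0 < e -> exists2 N0 : nat, (0 < N0)%N &
    forall N, (0 < N)%N -> (N0 %| N)%N -> nrm (bsum F N x0 y0 t0) <= e * t0 ^+ 2.
Proof.
move=> t0_gt0 Fd e e0; move: t0_gt0 Fd.
move=> t0_gt0 Fd.
apply: (@square_induction _ (fun x y t => exists2 N0 : nat, (0 < N0)%N &
    forall N, (0 < N)%N -> (N0 %| N)%N -> nrm (bsum F N x y t) <= e * t ^+ 2)) => //.
  move=> x y t t_gt0 [N1 N1_0 B1] [N2 N2_0 B2] [N3 N3_0 B3] [N4 N4_0 B4].
  (* After halving, N must still be a multiple of the counts of all four quarters. *)
  exists (2 * (N1 * N2 * N3 * N4))%N; first by rewrite !muln_gt0 N1_0 N2_0 N3_0 N4_0.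
  move=> N N_gt0 /dvdnP[M NE].
  have {NE} : N = (2 * (M * (N1 * N2 * N3 * N4)))%N by rewrite NE; ring.
  set N' := (M * _)%N => NE.
  have N'0 : (0 < N')%N by move: N_gt0; rewrite NE; lia.
  rewrite NE bsum_subdivide// !big_ord_recl !big_ord0 !addr0/=.
  rewrite /bump/= addn0 !mul0r !addr0 !mul1r.
  have D1 : (N1 %| N')%N by apply/dvdnP; exists (M * N2 * N3 * N4)%N; rewrite /N'; ring.
  have D2 : (N2 %| N')%N by apply/dvdnP; exists (M * N1 * N3 * N4)%N; rewrite /N'; ring.
  have D3 : (N3 %| N')%N by apply/dvdnP; exists (M * N1 * N2 * N4)%N; rewrite /N'; ring.
  have D4 : (N4 %| N')%N by apply/dvdnP; exists (M * N1 * N2 * N3)%N; rewrite /N'; ring.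
  have := B1 _ N'0 D1; have := B2 _ N'0 D2; have := B3 _ N'0 D3; have := B4 _ N'0 D4.
  set b1 := bsum _ _ x y _; set b2 := bsum _ _ (x + _) y _; set b3 := bsum _ _ x (y + _) _.
  set b4 := bsum _ _ _ _ _ => h4 h3 h2 h1.
  have := ler_nrmD (b1 + b3) (b2 + b4); have := ler_nrmD b1 b3; have := ler_nrmD b2 b4.
  have E : e * (t / 2) ^+ 2 = (e * t ^+ 2) / 4 by field.
  rewrite E in h1 h2 h3 h4; lra.
move=> a b xa yb; have [D FD] := Fd _ _ xa yb.
(* The perimeter is 4t and points of the square are within 2t of the limit point: 4t (e / 8) 2t = e
   t^2. *)
have e8 : 0 < e / 8 by lra.
have [d d0 Hd] := FD _ e8.
exists (d / 2); first by lra.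
move=> x y t t_gt0 td /andP[xa1 xa2] /andP[yb1 yb2]; exists 1%N => // N _ _.
pose A z := F (a +i* b)%C + D * (z - (a +i* b)%C).
have -> : bsum F N x y t = bsum (fun z => F z + (-1) * A z) N x y t.
  by rewrite bsum_lin bsum_affine mulr0 addr0.
have -> : e * t ^+ 2 = 4 * t * (e / 8 * (2 * t)) by field.
apply: bsum_le; first exact: ltW.
move=> u v /andP[u1 u2] /andP[v1 v2] _.
have dist : nrm ((u +i* v)%C - (a +i* b)%C : K) <= 2 * t.
  have -> : (u +i* v)%C - (a +i* b)%C = ((u - a) +i* (v - b))%C :> K by [].
  apply: le_trans (nrm_le_ReIm _ _) _.
  have : `|u - a| <= t by rewrite ler_norml; apply/andP; split; lra.
  have : `|v - b| <= t by rewrite ler_norml; apply/andP; split; lra.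
  lra.
rewrite mulN1r /A opprD addrA.
apply: le_trans (Hd _ _) _; first by lra.
by rewrite ler_wpM2l// ltW.
Qed.

End CauchyEstimate.


(** * Complex differentiability in terms of real norms *)

Section Derivatives.
Variable R : realType.
Local Notation K := (R[i] : numClosedFieldType).
Local Notation C_ x := (x%:C%C : K).

Lemma real_gt0P (e : K) : 0 < e -> exists2 r : R, 0 < r & e = C_ r.
Proof. by case: e => a b; rewrite ltcE/= => /andP[/eqP-> a0]; exists a. Qed.

Lemma nbhs_nrmP (V : normedModType K) (x : V) (P : set V) :
  nbhs x P <-> exists2 d : R, 0 < d & forall v, nrm (v - x) < d -> P v.
Proof.
split=> [/nbhs_ballP[e /real_gt0P[r r0 ->]]|[d d0 dP]].
  move=> rP; exists r => // v vx; apply: rP.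
  by rewrite -ball_normE/= distrC nrmE ltcR.
apply/nbhs_ballP; exists (C_ d); first by rewrite /= ltcR.
by move=> v; rewrite -ball_normE/= distrC nrmE ltcR => /dP.
Qed.

(** The differential is obtained by choice from its defining property, so it suffices that the zero
    map has this property. *)
Lemma differentiable_flat (V W : normedModType K) (F : V -> W) (x : V) :
  (forall e : R, 0 < e -> exists2 d : R, 0 < d & forall v, nrm (v - x) < d ->
    nrm (F v - F x) <= e * nrm (v - x)) ->
  differentiable F x.
Proof.
move=> flat; apply/diffP.
apply: (@getPex _ (fun (df : {linear V -> W}) => continuous df /\
  forall y, F y = F (lim (nbhs x)) + df (y - lim (nbhs x))
                  +o_(y \near x) (y - lim (nbhs x)))).
exists (@GRing.null_fun V W : {linear V -> W}); split; first by move=> ?; exact: cvg_cst.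
suff : F = (fun=> F x + 0) +o_x (fun y => y - x).
  by rewrite funeqE => H y; rewrite lim_id//=; exact: H.
apply/eqaddoP => _ /real_gt0P[e e0 ->].
have [d d0 H] := flat e e0.
apply/nbhs_nrmP; exists d => // v /H.
by rewrite !nrmE -rmorphM lecR addr0.
Qed.

Lemma diff_approx (V W : normedModType K) (F : V -> W) (x : V) : differentiable F x ->
  forall e : R, 0 < e -> exists2 d : R, 0 < d & forall v, nrm (v - x) < d ->
    nrm (F v - F x - 'd F x (v - x)) <= e * nrm (v - x).
Proof.
move=> /diffP[_]; rewrite lim_id// => Fo e e0.
have /eqaddoP H : F = (fun y => F x + 'd F x (y - x)) +o_x (fun y => y - x).
  by rewrite funeqE; exact: Fo.
have /(H (C_ e))/nbhs_nrmP[d d0 dP] : 0 < C_ e by rewrite ltcR.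
exists d => // v /dP.
by rewrite !nrmE -rmorphM lecR opprD addrA.
Qed.

Lemma differentiable_has_deriv (F : K -> K) (a : K) : differentiable F a -> exists D, has_deriv F a D.
Proof.
move=> Fa; exists ('d F a 1) => e e0; have [d d0 H] := diff_approx Fa e0.
exists d => // v /H; congr (nrm (_ - _) <= _).
by rewrite -[v - a in LHS]mulr1 -[_ * 1]/((v - a) *: (1 : K)) linearZ/= mulrC.
Qed.

Lemma differentiable_locally (V W : normedModType K) (F G : V -> W) (x : V) (d : R) : 0 < d ->
  (forall v, nrm (v - x) < d -> F v = G v) -> differentiable F x -> differentiable G x.
Proof.
move=> d0 FG Fx.
have -> : G = F + (G - F) by rewrite addrC subrK.
apply: differentiableD => //; apply: differentiable_flat => e e0.
exists d => // v vx.
rewrite !fctE !(FG v) // (FG x); last by rewrite subrr nrm0.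
by rewrite !subrr nrm0 mulr_ge0 ?nrm_ge0 ?ltW.
Qed.

End Derivatives.


(** * Cauchy's inequality on a square *)

Section CauchySquare.
Variable R : realType.
Local Notation K := (R[i] : numClosedFieldType).
Local Notation C_ x := (x%:C%C : R[i]).
Variables (F : K -> K) (a1 a2 s M : R) (D : K).
Local Notation a := ((a1 +i* a2)%C : R[i]).
Hypothesis s_gt0 : 0 < s.
Hypothesis dF : forall u v, `|u - a1| <= s -> `|v - a2| <= s ->
  differentiable F ((u +i* v)%C : K).
Hypothesis bF : forall u v, `|u - a1| <= s -> `|v - a2| <= s -> nrm (F (u +i* v)%C) <= M.
Hypothesis FD : has_deriv F a D.

(** The integrand of Cauchy's formula for the derivative: near [a] it is [D / (z - a)] up to a
    smaller error. *)
Let q (z : K) : K := (F z - F a) * ((z - a) ^+ 2)^-1.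
Let B N r := bsum q N (a1 - r) (a2 - r) (2 * r).

Let q_deriv u v : `|u - a1| <= s -> `|v - a2| <= s -> ~ (u = a1 /\ v = a2) ->
  exists D', has_deriv q (u +i* v)%C D'.
Proof.
move=> us vs ne; apply: differentiable_has_deriv.
apply: differentiableM.
  by apply: differentiableB; [exact: dF | exact: differentiable_cst].
apply: differentiableV.
  have -> : (fun z : K => (z - a) ^+ 2) = (fun z : K => (z - a) * (z - a)).
    by apply/funext => z; rewrite expr2.
  by apply: differentiableM; apply: differentiableB; do ?[exact: ex_diff | exact: differentiable_cst].
rewrite expf_eq0/= subr_eq0; apply/eqP => -[ua va]; exact: ne.
Qed.

(** Cutting into 3 by 3 squares keeps [a] at the centre of the middle one. The other eight avoid
    [a], and Goursat's lemma bounds the boundary sum of [q] over each of them by e / 8. *)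
Let triad r : 0 < r -> r <= s -> forall e, 0 < e -> exists2 N0 : nat, (0 < N0)%N &
  forall N, (0 < N)%N -> (N0 %| N)%N -> nrm (B (3 * N) r - B N (r / 3)) <= e.
Proof.
move=> r0 rs e e0.
pose S (p : 'I_3 * 'I_3) N := bsum q N (a1 - r + p.1%:R * (2 * r / 3)) (a2 - r + p.2%:R * (2 * r / 3)) (2 * r / 3).
pose c : 'I_3 * 'I_3 := (inord 1, inord 1).
have r3 : 0 < 2 * r / 3 by lra.
have small (p : 'I_3 * 'I_3) : exists N0 : nat, (0 < N0)%N /\ (p != c -> forall N, (0 < N)%N ->
    (N0 %| N)%N -> nrm (S p N) <= e / 8).
  have [->|pc] := eqVneq p c; first by exists 1%N.
  have e' : 0 < e / 8 / (2 * r / 3) ^+ 2 by rewrite divr_gt0 ?exprn_gt0//; lra.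
  have [|N0 N0_gt0 H] := @goursat R q (a1 - r + p.1%:R * (2 * r / 3)) (a2 - r + p.2%:R * (2 * r / 3))
      _ r3 _ _ e'; last first.
    exists N0; split => // _ N N_gt0 dv; apply: le_trans (H N N_gt0 dv) _.
    by rewrite divfK// expf_neq0// gt_eqF.
  move=> u v /andP[u1 u2] /andP[v1 v2].
  have pE : (p.1 : nat) <> 1%N \/ (p.2 : nat) <> 1%N.
    have [p1|p1] := eqVneq (p.1 : nat) 1%N; last by left; exact/eqP.
    right => p2; move/eqP: pc; apply; apply/eqP; rewrite -pair_eqE/=.
    by apply/andP; split; apply/eqP; apply: val_inj; rewrite /= inordK.
  move: pc pE u1 u2 v1 v2; case: p => [[[|[|[|//]]] i1] [[|[|[|//]]] i2]] _ /= pE u1 u2 v1 v2;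
  apply: q_deriv; rewrite ?ler_norml; try (by apply/andP; split; lra); move=> [? ?]; subst;
  first [lra | by case: pE].
have [N0 N0P] := choice small.
exists (\prod_p N0 p)%N; first by apply: prodn_gt0 => p; have [] := N0P p.
move=> N N_gt0 dv; rewrite /B bsum_subdivide// pair_big/=.
rewrite (bigD1 c)//= addrAC.
have -> : bsum q N (a1 - r + (inord 1 : 'I_3)%:R * (2 * r / 3%:R))
     (a2 - r + (inord 1 : 'I_3)%:R * (2 * r / 3%:R)) (2 * r / 3%:R)
   - bsum q N (a1 - r / 3) (a2 - r / 3) (2 * (r / 3)) = 0.
  rewrite inordK//; apply/eqP; rewrite subr_eq0; by apply/eqP; congr bsum; field.
rewrite add0r.
apply: le_trans (nrm_sum _ _ _) _.
apply: (@le_trans _ _ (\sum_(p | p != c) e / 8)).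
  apply: ler_sum => p pc; have [_ /(_ pc N N_gt0)] := N0P p; apply.
  by apply: dvdn_trans dv; rewrite (bigD1 p)//= dvdn_mulr.
rewrite sumr_const cardC1 card_prod card_ord -[leLHS]mulr_natr.
by rewrite divfK ?lexx ?pnatr_eq0.
Qed.

Let triads k : forall e, 0 < e -> exists2 N0 : nat, (0 < N0)%N &
  forall N, (0 < N)%N -> (N0 %| N)%N -> nrm (B (3 ^ k * N) s - B N (s / 3 ^+ k)) <= e.
Proof.
elim: k => [|k IH] e e0.
  by exists 1%N => // N _ _; rewrite expr0 divr1 mul1n subrr nrm0 ltW.
have e2 : 0 < e / 2 by lra.
have [N1 N1_gt0 H1] := IH _ e2.
have sk : 0 < s / 3 ^+ k by rewrite divr_gt0 ?exprn_gt0.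
have sks : s / 3 ^+ k <= s.
  by rewrite ler_piMr ?(ltW s_gt0)// invf_le1 ?exprn_gt0// exprn_ege1// ler1n.
have [N2 N2_gt0 H2] := triad sk sks e2.
exists (N1 * N2)%N; first by rewrite muln_gt0 N1_gt0.
move=> N N_gt0 dv.
have h1 : nrm (B (3 ^ k * (3 * N)) s - B (3 * N) (s / 3 ^+ k)) <= e / 2.
  by apply: H1; rewrite ?muln_gt0// dvdn_mull// (dvdn_trans _ dv)// dvdn_mulr.
have h2 := H2 N N_gt0 (dvdn_trans (dvdn_mull _ (dvdnn _)) dv).
rewrite expnSr -mulnA exprSr invfM mulrA.
apply: le_trans (ler_nrm_sub _ (B (3 * N) (s / 3 ^+ k)) _) _.
lra.
Qed.

Let far r u v : 0 < r -> a1 - r <= u <= a1 - r + 2 * r -> a2 - r <= v <= a2 - r + 2 * r ->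
  (u == a1 - r) || (u == a1 - r + 2 * r) || (v == a2 - r) || (v == a2 - r + 2 * r) ->
  [/\ r <= nrm ((u +i* v)%C - a : R[i]), nrm ((u +i* v)%C - a : R[i]) <= 2 * r,
     `|u - a1| <= r & `|v - a2| <= r].
Proof.
move=> r0 /andP[u1 u2] /andP[v1 v2] bd.
have E : (u +i* v)%C - a = ((u - a1) +i* (v - a2))%C :> R[i] by [].
have ur : `|u - a1| <= r by rewrite ler_norml; apply/andP; split; lra.
have vr : `|v - a2| <= r by rewrite ler_norml; apply/andP; split; lra.
split=> //; last by rewrite E; apply: le_trans (nrm_le_ReIm _ _) _; lra.
have hu : r <= `|u - a1| -> r <= nrm ((u +i* v)%C - a : R[i]).
  by move=> h; apply: le_trans h _; rewrite E; exact: (abs_Re_le ((u - a1) +i* (v - a2))%C).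
have hv : r <= `|v - a2| -> r <= nrm ((u +i* v)%C - a : R[i]).
  by move=> h; apply: le_trans h _; rewrite E; exact: (abs_Im_le ((u - a1) +i* (v - a2))%C).
move: bd => /orP[/orP[/orP[]|]|] /eqP E'.
- by apply: hu; rewrite ler_normr; apply/orP; right; lra.
- by apply: hu; rewrite ler_normr; apply/orP; left; lra.
- by apply: hv; rewrite ler_normr; apply/orP; right; lra.
- by apply: hv; rewrite ler_normr; apply/orP; left; lra.
Qed.

(** Instead of the value [2 i pi] of the integral a lower bound is enough. The sum is i times a sum
    of terms [4 r / (u^2 + r^2)], each at least [2 / r] since |u| <= r, and their total weight is
    2r. *)
Let winding N r : (0 < N)%N -> 0 < r ->
  4 <= nrm (bsum (fun z => (z - a)^-1) N (a1 - r) (a2 - r) (2 * r)).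
Proof.
move=> N0 r0.
have N0' : N%:R != 0 :> R by rewrite pnatr_eq0 -lt0n.
set d := 2 * r / N%:R.
have d0 : 0 < d by rewrite divr_gt0 ?mulr_gt0 ?ltr0n.
pose u (k : nat) := k%:R * d - r.
have sq k : 0 < u k ^+ 2 + r ^+ 2 by rewrite ltr_wpDl ?sqr_ge0 ?exprn_gt0.
have -> : bsum (fun z => (z - a)^-1) N (a1 - r) (a2 - r) (2 * r) =
    'i%C * C_ (\sum_(k < N) d * (4 * r / (u k ^+ 2 + r ^+ 2))).
  rewrite rmorph_sum/= mulr_sumr; apply: eq_bigr => k _; rewrite -/d.
  have nz : u k ^+ 2 + r ^+ 2 != 0 by rewrite gt_eqF.
  have inv x y : ((x +i* y)%C : R[i])^-1 = ((x / (x ^+ 2 + y ^+ 2)) +i* (- (y / (x ^+ 2 + y ^+ 2))))%C by [].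
  have sub x y : (x +i* y)%C - a = ((x - a1) +i* (y - a2))%C :> R[i] by [].
  rewrite !sub !inv.
  have -> : a1 - r + k%:R * d - a1 = u k by rewrite /u; ring.
  have -> : a2 - r + k%:R * d - a2 = u k by rewrite /u; ring.
  have -> : a1 - r - a1 = - r by ring.
  have -> : a2 - r - a2 = - r by ring.
  have -> : a1 - r + 2 * r - a1 = r by ring.
  have -> : a2 - r + 2 * r - a2 = r by ring.
  have nz' : r ^+ 2 + u k ^+ 2 != 0 by rewrite addrC.
  have nz1 : u k ^+ 2 + (- r) ^+ 2 != 0 by rewrite sqrrN.
  have nz2 : (- r) ^+ 2 + u k ^+ 2 != 0 by rewrite sqrrN.
  apply/eqP; rewrite eq_complex/=; apply/andP; split; apply/eqP.
    by field; rewrite ?nz ?nz' ?nz1 ?nz2.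
  by field; rewrite ?nz ?nz' ?nz1 ?nz2.
rewrite nrmM nrm_i mul1r nrm_real.
apply: le_trans (ler_norm _).
apply: (@le_trans _ _ (\sum_(k < N) (d * (2 / r)))).
  rewrite sumr_const card_ord -[leRHS]mulr_natl /d le_eqVlt; apply/orP; left; apply/eqP; field.
  by rewrite N0' gt_eqF.
apply: ler_sum => k _; rewrite ler_wpM2l ?(ltW d0)//.
rewrite ler_pdivlMr// mulrAC ler_pdivrMr//.
have : `|u k| <= r.
  rewrite /u; have : k%:R * d <= 2 * r.
    have r2 : 0 <= 2 * r by rewrite mulr_ge0// ltW.
    by rewrite /d mulrCA ler_piMr// ler_pdivrMr ?ltr0n// mul1r ler_nat ltnW.
  have : 0 <= k%:R * d by rewrite mulr_ge0// ltW.
  by move=> h1 h2; rewrite ler_norml; apply/andP; split; lra.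
rewrite ler_norml => /andP[h1 h2].
have : 0 <= (r - u k) * (r + u k) by rewrite mulr_ge0//; lra.
have -> : (r - u k) * (r + u k) = r * r - u k ^+ 2 by ring.
by move=> h; rewrite expr2; lra.
Qed.

(** On a tiny square the boundary sum of [q] is nearly [D * b0], of norm at least 4 |D|; it nearly
    equals the sum on the large square, which is at most 8s * 2M / s^2 = 16 M / s. *)
Lemma cauchy_square : nrm D <= 4 * M / s.
Proof.
have aa : `|a1 - a1| <= s by rewrite subrr normr0 ltW.
have bb : `|a2 - a2| <= s by rewrite subrr normr0 ltW.
have M0 : 0 <= M by apply: le_trans (bF aa bb); exact: nrm_ge0.
suff : 4 * nrm D <= 4 * (4 * M / s) by rewrite ler_pM2l.
apply/ler_addgt0Pr => e e0.
have e16 : 0 < e / 16 by lra.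
have [d d0 Hd] := FD e16.
(* A bound for halving also serves for division by 3. *)
have [k kd] := half_pow_small (2 * s) d0.
pose r := s / 3 ^+ k.
have r0 : 0 < r by rewrite divr_gt0 ?exprn_gt0.
have rd : 2 * r < d.
  apply: le_lt_trans kd; rewrite mulrA ler_wpM2l ?mulr_ge0 ?(ltW s_gt0)//.
  by rewrite lef_pV2 ?posrE ?exprn_gt0//; apply: lerXn2r; rewrite ?nnegrE ?ler_nat.
have e2 : 0 < e / 2 by lra.
have [N N_gt0 HN] := triads k e2.
have := HN N N_gt0 (dvdnn N); rewrite -/r => h1.
have h2 : nrm (B (3 ^ k * N) s) <= 16 * M / s.
  have -> : 16 * M / s = 4 * (2 * s) * (2 * M / s ^+ 2) by field; rewrite gt_eqF.
  apply: bsum_le; first by rewrite mulr_ge0// ltW.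
  move=> u v uu vv bd; have [h _ us vs] := far s_gt0 uu vv bd.
  rewrite /q nrmM nrmV nrmX ler_pM ?nrm_ge0 ?invr_ge0 ?exprn_ge0 ?nrm_ge0//.
    apply: le_trans (ler_nrmD _ _) _; rewrite nrmN.
    by have := bF us vs; have := bF aa bb; lra.
  rewrite lef_pV2 ?posrE ?exprn_gt0// ?(lt_le_trans s_gt0 h)//.
  by rewrite ler_pXn2r ?nnegrE ?nrm_ge0// ltW.
set b0 := bsum (fun z => (z - a)^-1) N (a1 - r) (a2 - r) (2 * r).
have h3 : nrm (B N r - D * b0) <= e / 2.
  have -> : B N r - D * b0 = bsum (fun z => q z + (- D) * (z - a)^-1) N (a1 - r) (a2 - r) (2 * r).
    by rewrite bsum_lin mulNr.
  have -> : e / 2 = 4 * (2 * r) * (e / 16 / r) by field; rewrite gt_eqF.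
  apply: bsum_le; first by rewrite mulr_ge0// ltW.
  move=> u v uu vv bd; have [h h' us vs] := far r0 uu vv bd.
  have z0 : 0 < nrm ((u +i* v)%C - a : R[i]) by exact: lt_le_trans h.
  have z0' : (u +i* v)%C - a != 0 :> R[i] by rewrite -nrm_gt0.
  have -> : q (u +i* v)%C + - D * ((u +i* v)%C - a)^-1 =
      (F (u +i* v)%C - F a - D * ((u +i* v)%C - a)) * (((u +i* v)%C - a) ^+ 2)^-1.
    by rewrite /q; field.
  rewrite nrmM nrmV nrmX ler_pdivrMr ?exprn_gt0//.
  apply: le_trans (Hd _ (le_lt_trans h' rd)) _.
  rewrite expr2 mulrA ler_wpM2r ?nrm_ge0//.
  by rewrite mulrAC ler_pdivlMr// ler_wpM2l ?(ltW e16).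
have h4 : 4 * nrm D <= nrm (D * b0).
  by rewrite nrmM mulrC ler_wpM2l ?nrm_ge0// winding.
have h5 := ler_nrmD (- (B N r - D * b0)) (B N r).
have h6 := ler_nrmD (- (B (3 ^ k * N) s - B N r)) (B (3 ^ k * N) s).
rewrite !nrmN in h5 h6.
have E5 : - (B N r - D * b0) + B N r = D * b0 by ring.
have E6 : - (B (3 ^ k * N) s - B N r) + B (3 ^ k * N) s = B N r by ring.
rewrite E5 in h5; rewrite E6 in h6.
have -> : 4 * (4 * M / s) = 16 * M / s by field; rewrite gt_eqF.
lra.
Qed.

End CauchySquare.


(** * Taylor estimates from Cauchy's inequality *)

Section CauchyEstimates.
Variable R : realType.
Local Notation K := (R[i] : numClosedFieldType).
Local Notation C_ x := (x%:C%C : R[i]).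

Definition hol_disc (V : normedModType K) (F : V -> K) (a : V) (r M : R) : Prop :=
  forall u, nrm (u - a) < r -> differentiable F u /\ nrm (F u) <= M.

Lemma nrmZ (V : normedModType K) (c : K) (v : V) : nrm (c *: v) = nrm c * nrm v.
Proof. by apply: (@complexI R); rewrite rmorphM/= -!nrmE normrZ. Qed.

Lemma hol_disc_sub (V : normedModType K) (F : V -> K) a r M b s :
  hol_disc F a r M -> nrm (b - a) + s <= r -> hol_disc F b s M.
Proof.
move=> FH bs u ub; apply: FH.
by apply: le_lt_trans (ler_nrm_sub u b a) _; lra.
Qed.

(** The square of half side r / 3 fits into the disc, since |x| + |y| <= 2r / 3 on it; this turns
    the constant 4 into 12. *)
Lemma cauchy_disc (F : K -> K) a r M D : 0 < r -> hol_disc F a r M -> has_deriv F a D ->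
  nrm D <= 12 * M / r.
Proof.
case: a => a1 a2 r0 FH FD.
have r3 : 0 < r / 3 by lra.
have cl u v : `|u - a1| <= r / 3 -> `|v - a2| <= r / 3 ->
    nrm ((u +i* v)%C - (a1 +i* a2)%C : R[i]) < r.
  move=> h1 h2; have -> : (u +i* v)%C - (a1 +i* a2)%C = ((u - a1) +i* (v - a2))%C :> R[i] by [].
  by apply: le_lt_trans (nrm_le_ReIm _ _) _; lra.
have -> : 12 * M / r = 4 * M / (r / 3) by field; rewrite gt_eqF.
by apply: (cauchy_square r3 _ _ FD) => u v h1 h2; have [] := FH _ (cl u v h1 h2).
Qed.

Lemma differentiable_line (V : normedModType K) (F : V -> K) (a v : V) (z : K) :
  differentiable F (a + z *: v) -> differentiable (fun z : K => F (a + z *: v)) z.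
Proof.
move=> Fz; apply: (@differentiable_comp _ _ _ _ (fun z : K => a + z *: v) F) => //.
Qed.

Lemma has_deriv_line (V : normedModType K) (F : V -> K) (a v : V) (z : K) :
  differentiable F (a + z *: v) ->
  has_deriv (fun z : K => F (a + z *: v)) z ('d F (a + z *: v) v).
Proof.
move=> Fz e e0; have v1 : 0 < nrm v + 1 by have := nrm_ge0 v; lra.
have [d d0 H] := diff_approx Fz (divr_gt0 e0 v1).
exists (d / (nrm v + 1)); first exact: divr_gt0.
move=> y yz.
have E : a + y *: v - (a + z *: v) = (y - z) *: v by rewrite opprD addrACA subrr add0r scalerBl.
have n1 : nrm ((y - z) *: v) <= nrm (y - z) * (nrm v + 1).
  by rewrite nrmZ ler_wpM2l ?nrm_ge0// lerDl.
have lE : 'd F (a + z *: v) ((y - z) *: v) = 'd F (a + z *: v) v * (y - z).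
  by rewrite linearZ; exact: mulrC.
have := H (a + y *: v); rewrite E lE => {}H.
apply: le_trans (H _) _.
  by apply: le_lt_trans n1 _; rewrite -ltr_pdivlMr.
rewrite mulrAC ler_pdivrMr// -mulrA ler_wpM2l// ltW//.
Qed.

Lemma hol_disc_line (V : normedModType K) (F : V -> K) a r M v : 0 < nrm v ->
  hol_disc F a r M -> hol_disc (fun z : K => F (a + z *: v)) 0 (r / nrm v) M.
Proof.
move=> v0 FH z; rewrite subr0 ltr_pdivlMr// -nrmZ => zr.
have [] := FH (a + z *: v); first by rewrite addrAC subrr add0r.
by move=> Fd FM; split => //; exact: differentiable_line.
Qed.

Lemma cauchy_diff (V : normedModType K) (F : V -> K) a r M v : 0 < r -> hol_disc F a r M ->
  nrm ('d F a v) <= 12 * M / r * nrm v.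
Proof.
move=> r0 FH; have [->|v0] := eqVneq v 0; first by rewrite linear0 !nrm0 mulr0.
have nv : 0 < nrm v by rewrite nrm_gt0.
have H : hol_disc (fun z : K => F (a + z *: v)) 0 (r / nrm v) M by exact: hol_disc_line.
have rv : 0 < r / nrm v by exact: divr_gt0.
have Fa : differentiable F (a + 0 *: v).
  by rewrite scale0r addr0; have [] := FH a; rewrite ?subrr ?nrm0.
have := cauchy_disc rv H (has_deriv_line Fa).
rewrite scale0r addr0 invfM invrK mulrA; apply: le_trans; first exact: lexx.
Qed.

Lemma hol_disc_ge0 (V : normedModType K) (F : V -> K) a r M : 0 < r -> hol_disc F a r M -> 0 <= M.
Proof. by move=> r0 /(_ a); rewrite subrr nrm0 => /(_ r0)[_]; apply: le_trans; exact: nrm_ge0. Qed.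

(** Bisection of the interval [x, x + t] through [square_induction], with a slack [e] that absorbs
    the local error. *)
Lemma mean_value_line (G : K -> K) B :
  (forall t : R, 0 <= t <= 1 -> exists2 D, has_deriv G (C_ t) D & nrm D <= B) ->
  nrm (G 1 - G 0) <= B.
Proof.
move=> Fd; apply/ler_addgt0Pr => e e0.
suff : 0 <= 0 :> R -> 0 + 1 <= 1 :> R -> nrm (G (C_ (0 + 1)) - G (C_ 0)) <= (B + e) * 1.
  by rewrite add0r mulr1; apply.
apply: (@square_induction R (fun x _ t => 0 <= x -> x + t <= 1 ->
   nrm (G (C_ (x + t)) - G (C_ x)) <= (B + e) * t) 0 0 1) => //.
  move=> x y t t0 h1 h2 _ _ x0 xt.
  have E : x + t / 2 + t / 2 = x + t by field.
  have {}h1 := h1 x0 ltac:(lra); have {}h2 := h2 ltac:(lra) ltac:(lra).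
  rewrite E in h2.
  apply: le_trans (ler_nrm_sub _ (G (C_ (x + t / 2))) _) _; lra.
move=> c b c01 _; have c01' : 0 <= c <= 1 by move: c01; rewrite add0r.
have [D Fc Bc] := Fd c c01'.
have [d d0 H] := Fc e e0.
exists d => // x y t t0 td /andP[xc cx] _ _ _.
have key s : `|s - c| < d -> nrm (G (C_ s) - G (C_ c)) <= (B + e) * `|s - c|.
  move=> sc; have sE : nrm (C_ s - C_ c) = `|s - c| by rewrite -rmorphB nrm_real.
  have := H (C_ s); rewrite sE => /(_ sc) {}H.
  have := ler_nrmD (G (C_ s) - G (C_ c) - D * (C_ s - C_ c)) (D * (C_ s - C_ c)).
  rewrite subrK nrmM sE => H2.
  have : nrm D * `|s - c| <= B * `|s - c| by rewrite ler_wpM2r.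
  lra.
have k1 : nrm (G (C_ (x + t)) - G (C_ c)) <= (B + e) * (x + t - c).
  by have := key (x + t); rewrite ger0_norm; [apply; lra | lra].
have k2 : nrm (G (C_ c) - G (C_ x)) <= (B + e) * (c - x).
  by rewrite nrm_distC; have := key x; rewrite ler0_norm ?opprB; [rewrite nrm_distC; apply; lra | lra].
apply: le_trans (ler_nrm_sub _ (G (C_ c)) _) _; lra.
Qed.

Lemma mean_value (V : normedModType K) (F : V -> K) (a h : V) B :
  (forall t : R, 0 <= t <= 1 -> differentiable F (a + C_ t *: h) /\
     nrm ('d F (a + C_ t *: h) h) <= B) ->
  nrm (F (a + h) - F a) <= B.
Proof.
move=> Fd; have := @mean_value_line (fun z => F (a + z *: h)) B.
rewrite scale1r scale0r addr0; apply => t /Fd[Ft Bt].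
by exists ('d F (a + C_ t *: h) h) => //; exact: has_deriv_line.
Qed.

Lemma has_derivB (F G : K -> K) a D E : has_deriv F a D -> has_deriv G a E ->
  has_deriv (fun z => F z - G z) a (D - E).
Proof.
move=> FD GE e e0; have e2 : 0 < e / 2 by lra.
have [d1 d1_0 H1] := FD _ e2; have [d2 d2_0 H2] := GE _ e2.
exists (Num.min d1 d2); first by rewrite lt_min d1_0.
move=> z; rewrite lt_min => /andP[/H1 {}H1 /H2 {}H2].
have -> : F z - G z - (F a - G a) - (D - E) * (z - a) =
  (F z - F a - D * (z - a)) - (G z - G a - E * (z - a)) by ring.
apply: le_trans (ler_nrmD _ _) _; rewrite nrmN; lra.
Qed.

Lemma has_deriv_lin (c a : K) : has_deriv (fun z => z * c) a c.
Proof.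
move=> e e0; exists 1 => // z _.
have -> : z * c - a * c - c * (z - a) = 0 by ring.
by rewrite nrm0 mulr_ge0 ?nrm_ge0// ltW.
Qed.

Lemma has_deriv_sqr (c a : K) : has_deriv (fun z => z ^+ 2 * (c / 2)) a (a * c).
Proof.
move=> e e0; have n1 : 0 < nrm c + 1 by have := nrm_ge0 c; lra.
exists (e / (nrm c + 1)); first exact: divr_gt0.
move=> z za.
have -> : z ^+ 2 * (c / 2) - a ^+ 2 * (c / 2) - a * c * (z - a) = (z - a) * (z - a) * c / 2 by field.
rewrite !nrmM mulrAC -mulrA -[leLHS]mulrA mulrC ler_wpM2r ?nrm_ge0//.
move: za; rewrite ltr_pdivlMr// => za.
have -> : nrm (2^-1 : K) = 2^-1.
  have -> : 2^-1 = C_ 2^-1 by rewrite fmorphV rmorph_nat.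
  by rewrite nrm_real ger0_norm// invr_ge0.
have := nrm_ge0 (z - a); have := nrm_ge0 c; move: za; nra.
Qed.

(** The bound on difference quotients does not depend on the step [e]: Cauchy's inequality on balls
    of radius r / 4 and the mean value inequality give 12 M / (r / 4) = 48 M / r. *)
Lemma hol_disc_quot (V : normedModType K) (F : V -> K) a r M v (e : R) :
  0 < r -> hol_disc F a r M -> 0 < e -> e * nrm v <= r / 4 ->
  hol_disc (fun u => (C_ e)^-1 * (F (u + C_ e *: v) - F u)) a (r / 2) (48 * M / r * nrm v).
Proof.
move=> r0 FH e0 ev u ua.
have in4 t : 0 <= t <= 1 -> nrm (u + C_ t *: (C_ e *: v) - a) + r / 4 <= r.
  move=> /andP[t0 t1].
  have E : u + C_ t *: (C_ e *: v) - a = (u - a) + C_ t *: (C_ e *: v) by rewrite addrAC.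
  have := ler_nrmD (u - a) (C_ t *: (C_ e *: v)); rewrite -E !nrmZ !nrm_real.
  rewrite (ger0_norm t0) (ger0_norm (ltW e0)).
  have : t * (e * nrm v) <= e * nrm v by rewrite ler_piMl// mulr_ge0 ?nrm_ge0// ltW.
  lra.
have Fu t : 0 <= t <= 1 -> hol_disc F (u + C_ t *: (C_ e *: v)) (r / 4) M.
  by move=> t01; apply: hol_disc_sub FH _; exact: in4.
have r4 : 0 < r / 4 by lra.
have du t : 0 <= t <= 1 -> differentiable F (u + C_ t *: (C_ e *: v)).
  by move=> t01; have [] := Fu t t01 (u + C_ t *: (C_ e *: v)); rewrite ?subrr ?nrm0.
split.
  apply: differentiableM; first exact: differentiable_cst.
  apply: differentiableB; last by have := du 0; rewrite scale0r addr0; apply; lra.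
  apply: (@differentiable_comp _ _ _ _ (fun u : V => u + C_ e *: v) F).
    by apply: differentiableD; [exact: ex_diff | exact: differentiable_cst].
  by have := du 1; rewrite scale1r; apply; lra.
rewrite nrmM nrmV nrm_real (ger0_norm (ltW e0)) mulrC ler_pdivrMr//.
have -> : 48 * M / r * nrm v * e = 12 * M / (r / 4) * (e * nrm v) by field; rewrite gt_eqF.
apply: mean_value => t t01; split; first exact: du.
apply: le_trans (cauchy_diff _ r4 (Fu t t01)) _.
by rewrite nrmZ nrm_real (ger0_norm (ltW e0)).
Qed.

Lemma quot_cvg (V : normedModType K) (F : V -> K) u v : differentiable F u ->
  forall e, 0 < e -> exists2 d : R, 0 < d & forall t, 0 < t -> t < d ->
    nrm ((C_ t)^-1 * (F (u + C_ t *: v) - F u) - 'd F u v) <= e.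
Proof.
move=> Fu e e0.
have Fu' : differentiable F (u + (0 : K) *: v) by rewrite scale0r addr0.
have [d d0 H] := has_deriv_line Fu' e0.
exists d => // t t0 td; have := H (C_ t); rewrite subr0 nrm_real scale0r addr0.
rewrite (gtr0_norm t0) => /(_ td) {}H.
have tn : C_ t != 0 by rewrite -nrm_gt0 nrm_real gtr0_norm.
have -> : (C_ t)^-1 * (F (u + C_ t *: v) - F u) - 'd F u v =
   (F (u + C_ t *: v) - F u - 'd F u v * C_ t) * (C_ t)^-1 by field.
by rewrite nrmM nrmV nrm_real gtr0_norm// ler_pdivrMr.
Qed.

(** The differential is not yet known to be differentiable, so the mean value inequality is applied
    to the difference quotient [Q] in direction [v], with a step as small as desired. The constant
    2304 is 48 * 48: once from [hol_disc_quot], once from Cauchy's inequality with radius r / 4. *)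
Lemma diff_lipschitz (V : normedModType K) (F : V -> K) a r M (v h : V) :
  0 < r -> hol_disc F a r M -> nrm h <= r / 8 ->
  nrm ('d F (a + h) v - 'd F a v) <= 2304 * M / r ^+ 2 * nrm v * nrm h.
Proof.
move=> r0 FH hr; apply/ler_addgt0Pr => e e0.
have r2 : 0 < r / 4 by lra.
have Fa : differentiable F a by have [] := FH a; rewrite ?subrr ?nrm0.
have hr' : nrm h < r by apply: le_lt_trans hr _; lra.
have Fh : differentiable F (a + h) by have [|//] := FH (a + h); rewrite (addrAC a) subrr add0r.
have e2 : 0 < e / 2 by lra.
have [d1 d1_0 H1] := quot_cvg v Fa e2.
have [d2 d2_0 H2] := quot_cvg v Fh e2.
have nv1 : 0 < nrm v + 1 by have := nrm_ge0 v; lra.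
have d3_0 : 0 < r / 4 / (nrm v + 1) by rewrite divr_gt0.
pose t := Num.min (Num.min d1 d2) (r / 4 / (nrm v + 1)) / 2.
have m0 : 0 < Num.min (Num.min d1 d2) (r / 4 / (nrm v + 1)) by rewrite !lt_min d1_0 d2_0 d3_0.
have t0 : 0 < t by rewrite divr_gt0.
have tm : t < Num.min (Num.min d1 d2) (r / 4 / (nrm v + 1)) by rewrite /t; lra.
move: (tm); rewrite !lt_min => /andP[/andP[t1 t2] t3].
have tv : t * nrm v <= r / 4.
  move: t3; rewrite ltr_pdivlMr// => t3; apply: le_trans (ltW t3).
  by rewrite ler_wpM2l ?(ltW t0)// lerDl.
pose Q u := (C_ t)^-1 * (F (u + C_ t *: v) - F u).
have QH := hol_disc_quot r0 FH t0 tv.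
have {}H1 := H1 t t0 t1; have {}H2 := H2 t t0 t2.
have main : nrm (Q (a + h) - Q a) <= 2304 * M / r ^+ 2 * nrm v * nrm h.
  apply: mean_value => s /andP[s0 s1].
  have Qs : hol_disc Q (a + C_ s *: h) (r / 4) (48 * M / r * nrm v).
    apply: hol_disc_sub QH _; rewrite addrAC subrr add0r nrmZ nrm_real ger0_norm//.
    have : s * nrm h <= nrm h by rewrite ler_piMl ?nrm_ge0.
    lra.
  split; first by have [] := Qs (a + C_ s *: h); rewrite ?subrr ?nrm0.
  apply: le_trans (cauchy_diff _ r2 Qs) _.
  by rewrite le_eqVlt; apply/orP; left; apply/eqP; field; rewrite gt_eqF.
rewrite /Q in main.
apply: le_trans (ler_nrm_sub _ ((C_ t)^-1 * (F (a + h + C_ t *: v) - F (a + h))) _) _.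
rewrite nrm_distC.
have := ler_nrm_sub ((C_ t)^-1 * (F (a + h + C_ t *: v) - F (a + h)))
  ((C_ t)^-1 * (F (a + C_ t *: v) - F a)) ('d F a v).
lra.
Qed.

Lemma diff_quadratic (V : normedModType K) (F : V -> K) a r M (h : V) :
  0 < r -> hol_disc F a r M -> nrm h <= r / 8 ->
  nrm (F (a + h) - F a - 'd F a h) <= 2304 * M / r ^+ 2 * nrm h ^+ 2.
Proof.
move=> r0 FH hr.
pose G z := F (a + z *: h) - z * 'd F a h.
have := @mean_value_line G (2304 * M / r ^+ 2 * nrm h ^+ 2).
have -> : G 1 - G 0 = F (a + h) - F a - 'd F a h by rewrite /G scale1r scale0r addr0; ring.
apply => t /andP[t0 t1].
have th : nrm (C_ t *: h) <= nrm h.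
  by rewrite nrmZ nrm_real ger0_norm// ler_piMl ?nrm_ge0.
exists ('d F (a + C_ t *: h) h - 'd F a h).
  apply: has_derivB; last exact: has_deriv_lin.
  apply: has_deriv_line.
  have [|//] := FH (a + C_ t *: h); rewrite (addrAC a) subrr add0r.
  by apply: le_lt_trans (le_trans th hr) _; lra.
apply: le_trans (diff_lipschitz _ r0 FH _) _; first exact: le_trans th hr.
rewrite [nrm h ^+ 2]expr2 mulrA; apply: ler_wpM2l => //.
apply: mulr_ge0; last exact: nrm_ge0.
apply: divr_ge0; last by rewrite exprn_ge0// ltW.
by rewrite mulr_ge0// (hol_disc_ge0 r0 FH).
Qed.

(** Taylor's formula to second order along a segment. In [holomorphic_division] the bound on [G]
    carries a factor [nrm y], where [h = y *: dl]; this makes the remainder cubic in [y]. *)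
Lemma diff_cubic (V : normedModType K) (F : V -> K) a r M (h : V) (G : V -> K) N :
  0 < r -> hol_disc F a r M -> (forall u, G u = 'd F u h) -> hol_disc G a r N ->
  nrm h <= r / 8 ->
  nrm (F (a + h) - F a - G a - 'd G a h / 2) <= 2304 * N / r ^+ 2 * nrm h ^+ 2.
Proof.
move=> r0 FH GE GH hr.
pose g z := F (a + z *: h) - z * 'd F a h - z ^+ 2 * ('d G a h / 2).
have := @mean_value_line g (2304 * N / r ^+ 2 * nrm h ^+ 2).
have -> : g 1 - g 0 = F (a + h) - F a - G a - 'd G a h / 2.
  rewrite /g scale1r scale0r addr0 (GE a) (expr1n K 2) (expr0n K 2).
  by rewrite /= !mul1r !mul0r !subr0 addrAC (addrAC (F (a + h))).
apply => t /andP[t0 t1].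
have th : nrm (C_ t *: h) <= nrm h.
  by rewrite nrmZ nrm_real ger0_norm// ler_piMl ?nrm_ge0.
exists (G (a + C_ t *: h) - G a - C_ t * 'd G a h).
  rewrite (GE (a + C_ t *: h)) {1}(GE a).
  apply: has_derivB; last exact: has_deriv_sqr.
  apply: has_derivB; last exact: has_deriv_lin.
  apply: has_deriv_line.
  have [|//] := FH (a + C_ t *: h); rewrite (addrAC a) subrr add0r.
  by apply: le_lt_trans (le_trans th hr) _; lra.
have <- : 'd G a (C_ t *: h) = C_ t * 'd G a h by rewrite linearZ.
apply: le_trans (diff_quadratic r0 GH _) _; first exact: le_trans th hr.
apply: ler_wpM2l.
  apply: divr_ge0; last by rewrite exprn_ge0// ltW.
  by rewrite mulr_ge0// (hol_disc_ge0 r0 GH).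
by apply: lerXn2r; rewrite ?nnegrE ?nrm_ge0.
Qed.

End CauchyEstimates.


Section RowNorm.
Import interval_inference.
Variables (R : realType) (m : nat).
Local Notation K := (R[i] : numClosedFieldType).
Local Notation V := ('rV[K]_m).

Lemma nrm_coord (u : V) j : nrm (u 0 j) <= nrm u.
Proof.
rewrite -lecR -!nrmE [leRHS]/Num.norm/= mx_normE.
by rewrite -[leLHS]nngE num_le; exact: (le_bigmax _ (fun i : 'I_1 * 'I_m => `|u i.1 i.2|%:nng) (0, j)).
Qed.

Lemma nrm_delta j : nrm (delta_mx 0 j : V) <= 1.
Proof.
rewrite -lecR -!nrmE rmorph1 [leLHS]/Num.norm/= mx_normE.
rewrite -[1]nngE num_le; apply: bigmax_le => [|-[i k] _]; first by rewrite -num_le.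
by rewrite -num_le/= mxE ord1; case: (_ && _); rewrite ?normr1 ?normr0.
Qed.

End RowNorm.

(** * Holomorphy of the derivative *)

Section HolomorphicDerivative.
Variable R : realType.
Local Notation K := (R[i] : numClosedFieldType).
Local Notation C_ x := (x%:C%C : R[i]).

(** A Cauchy criterion with a rate: the limit is the supremum of the lower bounds
    [psi t - c * t]. *)
Lemma real_limit (psi : R -> R) (d c : R) : 0 < d ->
  (forall s t, 0 < s -> s < d -> 0 < t -> t < d -> psi s - psi t <= c * (s + t)) ->
  exists l, forall t, 0 < t -> t < d -> `|psi t - l| <= c * t.
Proof.
move=> d0 H.
pose E := [set y | exists t, [/\ 0 < t, t < d & y = psi t - c * t]].
have ub t : 0 < t -> t < d -> ubound E (psi t + c * t).
  move=> t0 td _ [s [s0 sd ->]]; have := H s t s0 sd t0 td; lra.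
exists (sup E) => t t0 td.
have h1 : psi t - c * t <= sup E.
  by apply: ub_le_sup; [exists (psi t + c * t); exact: ub | exists t].
have h2 : sup E <= psi t + c * t.
  by apply: ge_sup; [exists (psi t - c * t); exists t | exact: ub].
by rewrite ler_distl; apply/andP; split; lra.
Qed.

Lemma complex_limit (phi : R -> K) (d c : R) : 0 < d ->
  (forall s t, 0 < s -> s < d -> 0 < t -> t < d -> nrm (phi s - phi t) <= c * (s + t)) ->
  exists l, forall t, 0 < t -> t < d -> nrm (phi t - l) <= 2 * c * t.
Proof.
move=> d0 H.
have ReB (x y : R[i]) : complex.Re x - complex.Re y = complex.Re (x - y) by case: x; case: y.
have ImB (x y : R[i]) : complex.Im x - complex.Im y = complex.Im (x - y) by case: x; case: y.
have [l1 L1] : exists l, forall t, 0 < t -> t < d -> `|complex.Re (phi t) - l| <= c * t.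
  apply: real_limit => // s t s0 sd t0 td; apply: le_trans (H s t s0 sd t0 td).
  by rewrite ReB (le_trans (ler_norm _))// abs_Re_le.
have [l2 L2] : exists l, forall t, 0 < t -> t < d -> `|complex.Im (phi t) - l| <= c * t.
  apply: real_limit => // s t s0 sd t0 td; apply: le_trans (H s t s0 sd t0 td).
  by rewrite ImB (le_trans (ler_norm _))// abs_Im_le.
exists (l1 +i* l2)%C => t t0 td.
have -> : phi t - (l1 +i* l2)%C = ((complex.Re (phi t) - l1) +i* (complex.Im (phi t) - l2))%C.
  by case: (phi t).
apply: le_trans (nrm_le_ReIm _ _) _; have := L1 t t0 td; have := L2 t t0 td; lra.
Qed.

Variable m : nat.
Local Notation V := ('rV[K]_m).

Lemma row_deltaE (h : V) : h = \sum_j h 0 j *: delta_mx 0 j.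
Proof. exact: row_sum_delta. Qed.

Lemma differentiable_linear_form (l : 'I_m -> K) (a : V) :
  differentiable (fun u : V => \sum_j u 0 j * l j) a.
Proof.
have -> : (fun u : V => \sum_j u 0 j * l j) = \sum_j (fun u : V => u 0 j * l j).
  by apply/funext => u; rewrite fct_sumE.
apply: differentiable_sum => j; apply: differentiableM; last exact: differentiable_cst.
exact: differentiable_coord.
Qed.

Lemma differentiable_quadratic (G : V -> K) (a : V) (l : 'I_m -> K) (r c : R) : 0 < r ->
  (forall h, nrm h < r -> nrm (G (a + h) - G a - \sum_j h 0 j * l j) <= c * nrm h ^+ 2) ->
  differentiable G a.
Proof.
move=> r0 H.
have -> : G = (fun u => G u - \sum_j u 0 j * l j) + (fun u => \sum_j u 0 j * l j).
  by apply/funext => u; rewrite fctE subrK.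
apply: differentiableD; last exact: differentiable_linear_form.
apply: differentiable_flat => e e0.
have c1 : 0 < `|c| + 1 by have := normr_ge0 c; lra.
exists (Num.min r (e / (`|c| + 1))); first by rewrite lt_min r0 divr_gt0.
move=> u; rewrite lt_min => /andP[ur ue].
have := H (u - a) ur; rewrite subrKC => {}H.
have -> : G u - \sum_j u 0 j * l j - (G a - \sum_j a 0 j * l j) =
   G u - G a - \sum_j (u - a) 0 j * l j.
  under [in RHS]eq_bigr do rewrite !mxE mulrBl.
  by rewrite sumrB; ring.
apply: le_trans H _; rewrite expr2 mulrA ler_wpM2r ?nrm_ge0//.
move: ue; rewrite ltr_pdivlMr// => /ltW; apply: le_trans.
rewrite mulrC ler_wpM2l ?nrm_ge0//; have := ler_norm c; lra.
Qed.

(** Difference quotients [Q t] converge to the derivative at rate t, uniformly near [a]. Cauchy's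
    inequality for [Q s - Q t] makes their differentials at [a] converge, and the quadratic bound on
    the remainder of [Q t], whose constant is independent of t, passes to the limit. *)
Lemma differentiable_diff (F : V -> K) (a : V) r M v : 0 < r -> hol_disc F a r M ->
  differentiable (fun u => 'd F u v) a.
Proof.
move=> r0 FH; have r2 : 0 < r / 2 by lra.
have M0 := hol_disc_ge0 r0 FH.
have v0 := nrm_ge0 v.
pose d := r / 16 / (nrm v + 1).
have v1 : 0 < nrm v + 1 by lra.
have d0 : 0 < d by rewrite /d divr_gt0//; lra.
have dv t : 0 < t -> t < d -> t * nrm v <= r / 16.
  move=> t0; rewrite /d ltr_pdivlMr// => /ltW; apply: le_trans.
  by rewrite ler_wpM2l ?(ltW t0)// lerDl.
pose c1 := 2304 * M / (r / 2) ^+ 2 * nrm v ^+ 2.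
have c1_0 : 0 <= c1.
  apply: mulr_ge0; last exact: exprn_ge0.
  by apply: divr_ge0; [exact: mulr_ge0 | exact/exprn_ge0/ltW].
pose Q (t : R) : V -> K := fun u => (C_ t)^-1 * (F (u + C_ t *: v) - F u).
have QH t : 0 < t -> t < d -> hol_disc (Q t) a (r / 2) (48 * M / r * nrm v).
  by move=> t0 td; apply: hol_disc_quot => //; have := dv t t0 td; lra.
have Qd (t : R) (u : V) : 0 < t -> t < d -> nrm (u - a) < r / 2 -> differentiable (Q t) u.
  by move=> t0 td ua; have [] := QH t t0 td u ua.
have q1 (t : R) (u : V) : 0 < t -> t < d -> nrm (u - a) < r / 2 -> nrm (Q t u - 'd F u v) <= c1 * t.
  move=> t0 td ua.
  have Fu : hol_disc F u (r / 2) M by apply: hol_disc_sub FH _; lra.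
  have nt : nrm (C_ t *: v) = t * nrm v by rewrite nrmZ nrm_real gtr0_norm.
  have := diff_quadratic r2 Fu (h := C_ t *: v); rewrite nt => H.
  have {H} := H ltac:(have := dv t t0 td; lra).
  have tn : C_ t != 0 by rewrite -nrm_gt0 nrm_real gtr0_norm.
  have -> : 'd F u (C_ t *: v) = 'd F u v * C_ t by rewrite linearZ; exact: mulrC.
  have -> : Q t u - 'd F u v = (F (u + C_ t *: v) - F u - 'd F u v * C_ t) * (C_ t)^-1.
    by rewrite /Q; field.
  rewrite nrmM nrmV nrm_real (gtr0_norm t0) ler_pdivrMr// => H.
  by apply: le_trans H _; rewrite /c1 le_eqVlt; apply/orP; left; apply/eqP; field; rewrite gt_eqF.
have [l lP] : exists l : 'I_m -> K, forall j t, 0 < t -> t < d ->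
    nrm ('d (Q t) a (delta_mx 0 j) - l j) <= 2 * (24 * c1 / r) * t.
  have lim j : exists l : K, forall t, 0 < t -> t < d ->
      nrm ('d (Q t) a (delta_mx 0 j) - l) <= 2 * (24 * c1 / r) * t.
    apply: complex_limit => // s t s0 sd t0 td.
    have H : hol_disc (Q s - Q t) a (r / 2) (c1 * (s + t)).
      move=> u ua; split; first by apply: differentiableB; exact: Qd.
      have k1 := q1 s u s0 sd ua; have := q1 t u t0 td ua; rewrite nrm_distC => k2.
      by apply: le_trans (ler_nrm_sub (Q s u) ('d F u v) (Q t u)) _; rewrite mulrDr lerD.
    have aa : nrm (a - a) < r / 2 by rewrite subrr nrm0.
    have E : 'd (Q s - Q t) a (delta_mx 0 j) =
        'd (Q s) a (delta_mx 0 j) - 'd (Q t) a (delta_mx 0 j).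
      exact: (congr1 (fun g : V -> K => g (delta_mx 0 j)) (diffB (Qd s a s0 sd aa) (Qd t a t0 td aa))).
    rewrite -E; apply: le_trans (cauchy_diff (delta_mx 0 j) r2 H) _.
    have -> : 24 * c1 / r * (s + t) = 12 * (c1 * (s + t)) / (r / 2) * 1 by field; rewrite gt_eqF.
    rewrite ler_wpM2l ?nrm_delta// divr_ge0 ?(ltW r2)// mulr_ge0// mulr_ge0//; lra.
  by have [l lP] := choice lim; exists l.
pose c3 := 2304 * (48 * M / r * nrm v) / (r / 2) ^+ 2.
apply: (@differentiable_quadratic _ _ l (r / 16) c3); first by lra.
move=> h hr; apply/ler_addgt0Pr => e e0.
have h0 := nrm_ge0 h.
(* All errors that tend to 0 with t are collected in [t * c4], which the choice of [t] keeps below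
   [e]. *)
pose c4 := 2 * c1 + m%:R * (2 * (24 * c1 / r)) * nrm h + 1.
have c2_0 : 0 <= 2 * (24 * c1 / r) by rewrite mulr_ge0// divr_ge0 ?(ltW r0)// mulr_ge0.
have c4' : 0 <= m%:R * (2 * (24 * c1 / r)) * nrm h by rewrite mulr_ge0// mulr_ge0.
have c4_0 : 0 < c4 by rewrite /c4; lra.
pose t := Num.min d (e / c4) / 2.
have m0 : 0 < Num.min d (e / c4) by rewrite lt_min d0 divr_gt0.
have t0 : 0 < t by rewrite divr_gt0.
have : t < Num.min d (e / c4) by rewrite /t; lra.
rewrite lt_min => /andP[td]; rewrite ltr_pdivlMr// => te.
have ha : nrm (a + h - a) < r / 2 by rewrite (addrAC a) subrr add0r; lra.
have aa : nrm (a - a) < r / 2 by rewrite subrr nrm0.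
have hr2 : nrm h <= r / 2 / 8 by lra.
have k1 := q1 t _ t0 td ha.
have k2 := q1 t _ t0 td aa.
have k3 : nrm (Q t (a + h) - Q t a - 'd (Q t) a h) <= c3 * nrm h ^+ 2.
  exact: (diff_quadratic r2 (QH t t0 td) hr2).
have k4 : nrm ('d (Q t) a h - \sum_j h 0 j * l j) <= m%:R * (2 * (24 * c1 / r)) * nrm h * t.
  have -> : 'd (Q t) a h = \sum_j h 0 j * 'd (Q t) a (delta_mx 0 j).
    by rewrite {1}(row_deltaE h) linear_sum; apply: eq_bigr => j _; rewrite linearZ.
  rewrite -sumrB; apply: le_trans (nrm_sum _ _ _) _.
  have -> : m%:R * (2 * (24 * c1 / r)) * nrm h * t = \sum_(j < m) nrm h * (2 * (24 * c1 / r) * t).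
    by rewrite sumr_const card_ord -[RHS]mulr_natl; ring.
  apply: ler_sum => j _; rewrite -mulrBr nrmM.
  by apply: ler_pM; rewrite ?nrm_ge0 ?nrm_coord// lP.
have E (x y z w x' y' : K) :
  x - y - w = (- (x' - x)) + ((y' - y) + ((x' - y' - z) + (z - w))) by ring.
rewrite (E _ _ ('d (Q t) a h) _ (Q t (a + h)) (Q t a)) {E}.
apply: le_trans (ler_nrmD _ _) _; rewrite nrmN.
apply: le_trans (lerD k1 (le_trans (ler_nrmD _ _) (lerD k2 (le_trans (ler_nrmD _ _) (lerD k3 k4))))) _.
have : t * c4 = 2 * (c1 * t) + m%:R * (2 * (24 * c1 / r)) * nrm h * t + t by rewrite /c4; ring.
move: (c3 * _) (m%:R * _ * _ * t) (c1 * t) (t * c4) te t0 => x y z w.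
clear; lra.
Qed.

End HolomorphicDerivative.


(** * Division by a coordinate and Hadamard's lemma *)

Section Division.
Variables (R : realType) (m : nat).
Local Notation K := (R[i] : numClosedFieldType).
Local Notation C_ x := (x%:C%C : R[i]).
Local Notation V := ('rV[K]_m).

Lemma holomorphic_atP (w : V) (F : V -> K) :
  holomorphic_at w F <-> exists2 r : R, 0 < r & forall u, nrm (u - w) < r -> differentiable F u.
Proof. exact: nbhs_nrmP. Qed.

(** Cauchy's inequality needs a bound; differentiability at the centre gives one on a smaller
    ball. *)
Lemma holomorphic_at_disc (w : V) (F : V -> K) : holomorphic_at w F ->
  exists r M, 0 < r /\ hol_disc F w r M.
Proof.
move=> /holomorphic_atP[r r0 Fd].
have ww : nrm (w - w) < r by rewrite subrr nrm0.
have [d d0 H] := @diff_approx R _ _ _ _ (Fd w ww) 1 ltr01.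
have [k [k0 kP]] : exists k : R, 0 <= k /\ forall h, nrm ('d F w h) <= k * nrm h.
  have [k k0 kP] := linear_lipschitz (diff_continuous (Fd w ww)).
  move: k0 => /real_gt0P[k' k'0 kE]; exists k'; split => [|h]; first exact: ltW.
  by have := kP h; rewrite kE !nrmE -rmorphM lecR.
exists (Num.min r (Num.min d 1)), (nrm (F w) + 1 + k); split.
  by rewrite !lt_min r0 d0 ltr01.
move=> u; rewrite !lt_min => /and3P[ur ud u1]; split; first exact: Fd.
have h1 := H u ud; have h2 := kP (u - w).
have -> : F u = F w + (F u - F w - 'd F w (u - w)) + 'd F w (u - w) by ring.
apply: le_trans (ler_nrmD _ _) _; apply: lerD; last first.
  by apply: le_trans h2 _; rewrite ler_piMr// ltW.
apply: le_trans (ler_nrmD _ _) _; apply: lerD => //.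
by apply: le_trans h1 _; rewrite mul1r ltW.
Qed.

Definition set_coord (w : V) (i : 'I_m) (u : V) : V :=
  u - (u 0 i - w 0 i) *: delta_mx 0 i.

Lemma set_coordE w i u j : set_coord w i u 0 j = if j == i then w 0 i else u 0 j.
Proof.
rewrite !mxE eqxx /=; case: eqP => [->|_]; first by rewrite mulr1 opprB addrC subrK.
by rewrite mulr0 subr0.
Qed.

Lemma differentiable_set_coord w i u : differentiable (set_coord w i) u.
Proof.
apply: differentiableB; first exact: ex_diff.
apply: differentiableZl; apply: differentiableB; last exact: differentiable_cst.
exact: differentiable_coord.
Qed.

Lemma nrm_set_coord w i u : nrm (set_coord w i u - w) <= 2 * nrm (u - w).
Proof.
rewrite /set_coord addrAC; apply: le_trans (ler_nrmD _ _) _.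
rewrite nrmN nrmZ.
have := nrm_coord (u - w) i; rewrite !mxE => h.
have := nrm_delta R i => h'.
have : nrm (u 0 i - w 0 i) * nrm (delta_mx 0 i : V) <= nrm (u - w) * 1.
  by apply: ler_pM; rewrite ?nrm_ge0.
by rewrite mulr1; lra.
Qed.

Lemma holomorphic_at_set_coord w i (F : V -> K) : holomorphic_at w F ->
  holomorphic_at w (F \o set_coord w i).
Proof.
move=> /holomorphic_atP[r r0 Fd]; apply/holomorphic_atP; exists (r / 2); first by lra.
move=> u ur; apply: differentiable_comp; first exact: differentiable_set_coord.
by apply: Fd; apply: le_lt_trans (nrm_set_coord _ _ _) _; lra.
Qed.

(** The quotient is extended across the hyperplane [u 0 i = w 0 i] by the partial derivative [G].
    There it is compared with [B], its expansion to first order in [u 0 i - w 0 i]; by [diff_cubic]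
    the difference is quadratically small, hence differentiable. *)
Lemma holomorphic_division w i (F : V -> K) : holomorphic_at w F ->
  exists2 A, holomorphic_at w A &
    forall u, F u = F (set_coord w i u) + (u 0 i - w 0 i) * A u.
Proof.
move=> /holomorphic_at_disc[r [M [r0 FH]]].
have r2 : 0 < r / 2 by lra.
have r4 : 0 < r / 4 by lra.
pose dl : V := delta_mx 0 i.
pose G (u : V) : K := 'd F u dl.
pose G2 (u : V) : K := 'd G u dl.
pose P := set_coord w i.
pose N := 12 * M / (r / 2).
have N0 : 0 <= N by rewrite divr_ge0 ?(ltW r2)// mulr_ge0// (hol_disc_ge0 r0 FH).
have Fdisc (u : V) : nrm (u - w) < r / 2 -> hol_disc F u (r / 2) M.
  by move=> uw; apply: hol_disc_sub FH _; lra.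
have GH : hol_disc G w (r / 2) N.
  move=> u uw; split; first exact: differentiable_diff r2 (Fdisc u uw).
  apply: le_trans (cauchy_diff _ r2 (Fdisc u uw)) _.
  by rewrite -[leRHS]mulr1 ler_wpM2l// nrm_delta.
have Gdisc (u : V) : nrm (u - w) < r / 4 -> hol_disc G u (r / 4) N.
  by move=> uw; apply: hol_disc_sub GH _; lra.
have G2d (u : V) : nrm (u - w) < r / 4 -> differentiable G2 u.
  by move=> uw; exact: differentiable_diff r4 (Gdisc u uw).
pose A (u : V) : K := if u 0 i == w 0 i then G u else (F u - F (P u)) / (u 0 i - w 0 i).
have PE (u : V) : u 0 i = w 0 i -> P u = u by move=> E; rewrite /P /set_coord E subrr scale0r subr0.
exists A; last first.
  move=> u; rewrite /A; case: eqP => [E|/eqP ne].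
    by rewrite -/(P u) (PE u E) E subrr mul0r addr0.
  by rewrite mulrC divfK ?subr_eq0// subrKC.
apply/holomorphic_atP; exists (r / 32); first by lra.
move=> u0 u0w.
have u0r : nrm (u0 - w) < r by apply: lt_trans u0w _; lra.
have u0r2 : nrm (u0 - w) < r / 2 by apply: lt_trans u0w _; lra.
have u0r16 : nrm (u0 - w) < r / 16 by apply: lt_trans u0w _; lra.
have Pw (u : V) : nrm (u - w) < r / 16 -> nrm (P u - w) < r / 8.
  by move=> uw; apply: le_lt_trans (nrm_set_coord _ _ _) _; lra.
have dP := differentiable_set_coord w i.
have dc (u : V) : differentiable (fun u : V => u 0 i - w 0 i : K) u.
  by apply: differentiableB; [exact: differentiable_coord | exact: differentiable_cst].
have [E|ne] := eqVneq (u0 0 i) (w 0 i); last first.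
  have c0 : 0 < nrm (u0 0 i - w 0 i) by rewrite nrm_gt0 subr_eq0.
  apply: (@differentiable_locally _ _ _ (fun u => (F u - F (P u)) / (u 0 i - w 0 i)) A u0 _ c0).
    move=> u uu0; rewrite /A ifN//; apply/eqP => E.
    have := nrm_coord (u - u0) i; rewrite !mxE E nrm_distC => h.
    by have := lt_le_trans uu0 h; rewrite ltxx.
  apply: differentiableM; last first.
    by apply: differentiableV; [exact: dc | rewrite subr_eq0].
  apply: differentiableB; first by have [] := FH u0 u0r.
  apply: (@differentiable_comp _ _ _ _ P F); first exact: dP.
  by have [|//] := FH (P u0); apply: lt_trans (Pw u0 u0r16) _; lra.
pose B (u : V) : K := G (P u) + (u 0 i - w 0 i) * (G2 (P u) / 2).
have dB : differentiable B u0.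
  have u0P : P u0 = u0 by exact: PE.
  apply: differentiableD.
    apply: (@differentiable_comp _ _ _ _ P G); first exact: dP.
    by rewrite u0P; have [] := GH u0 u0r2.
  apply: differentiableM; first exact: dc.
  apply: differentiableM; last exact: differentiable_cst.
  apply: (@differentiable_comp _ _ _ _ P G2); first exact: dP.
  by rewrite u0P; apply: G2d; apply: lt_trans u0w _; lra.
have -> : A = (fun u => A u - B u) + B by apply/funext => u; rewrite fctE subrK.
apply: differentiableD; last by [].
pose c := 2304 * N / (r / 4) ^+ 2.
have c_ge0 : 0 <= c by apply: divr_ge0; [exact: mulr_ge0 | exact/exprn_ge0/ltW].
apply: (@differentiable_quadratic _ _ _ _ (fun=> 0) (r / 32) c); first by lra.
move=> h hr; rewrite big1 ?subr0; last by move=> j _; rewrite mulr0.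
have B0 : A u0 - B u0 = 0 by rewrite /A /B E eqxx PE// subrr mul0r addr0 subrr.
rewrite B0 subr0.
set u := u0 + h; set y := u 0 i - w 0 i.
have yE : y = h 0 i by rewrite /y /u !mxE E addrAC subrr add0r.
have yh : nrm y <= nrm h by rewrite yE; exact: nrm_coord.
have [y0|y0] := eqVneq y 0.
  have uE : u 0 i = w 0 i by apply/eqP; rewrite -subr_eq0; exact/eqP.
  rewrite /A /B uE eqxx (PE u uE) subrr mul0r addr0 subrr nrm0.
  by rewrite mulr_ge0// exprn_ge0// nrm_ge0.
have uE : P u + y *: dl = u by rewrite /P /set_coord subrK.
have uw : nrm (u - w) < r / 16.
  by rewrite /u addrAC; apply: le_lt_trans (ler_nrmD _ _) _; lra.
have Puw := Pw u uw.
have yd : nrm (y *: dl) <= nrm y.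
  by rewrite nrmZ -[leRHS]mulr1 ler_wpM2l ?nrm_ge0// nrm_delta.
have Fd : hol_disc F (P u) (r / 4) M by apply: hol_disc_sub FH _; lra.
have Gd : hol_disc G (P u) (r / 4) N by apply: Gdisc; lra.
have yG (v : V) : y * G v = 'd F v (y *: dl) by rewrite linearZ.
have yGd : hol_disc (fun v => y * G v) (P u) (r / 4) (nrm y * N).
  move=> v vP; have [d1 d2] := Gd v vP; split.
    by apply: differentiableM; [exact: differentiable_cst | exact: d1].
  by rewrite nrmM; apply: ler_wpM2l; [exact: nrm_ge0 | exact: d2].
have ydr : nrm (y *: dl) <= r / 4 / 8 by apply: le_trans yd (le_trans yh _); lra.
have := diff_cubic r4 Fd yG yGd ydr; rewrite uE.
have -> : 'd (fun v => y * G v) (P u) (y *: dl) = y * (y * G2 (P u)).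
  have GP : differentiable G (P u) by have [] := Gd (P u); rewrite ?subrr ?nrm0.
  transitivity (y * 'd G (P u) (y *: dl)).
    exact: (congr1 (fun g : V -> K => g (y *: dl)) (diffZ y GP)).
  have E' : 'd G (P u) (y *: dl) = y *: 'd G (P u) dl by exact: linearZZ.
  by rewrite E'.
move=> H.
have -> : A u - B u = (F u - F (P u) - y * G (P u) - y * (y * G2 (P u)) / 2) / y.
  have AE : A u = (F u - F (P u)) / y by rewrite /A ifN// -subr_eq0.
  have gen (a b d e z : K) : z != 0 ->
      (a - b) / z - (d + z * (e / 2)) = (a - b - z * d - z * (z * e) / 2) / z.
    by move=> z0; field.
  by rewrite AE; exact: gen.
have ny : 0 < nrm y by rewrite nrm_gt0.
rewrite nrmM nrmV ler_pdivrMr//; apply: le_trans H _.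
have -> : 2304 * (nrm y * N) / (r / 4) ^+ 2 * nrm (y *: dl) ^+ 2 = c * nrm (y *: dl) ^+ 2 * nrm y.
  by rewrite /c; ring.
rewrite ler_wpM2r ?nrm_ge0// ler_wpM2l//.
by apply: lerXn2r; rewrite ?nnegrE ?nrm_ge0// (le_trans yd).
Qed.

(** The coordinates are reset to those of [w] one after another, each at the cost of one term
    [(u_i - w_i) A_i]. *)
Lemma hadamard w (F : V -> K) : holomorphic_at w F ->
  exists2 A : 'I_m -> V -> K, forall i, holomorphic_at w (A i) &
    forall u, F u = F w + \sum_i (u 0 i - w 0 i) * A i u.
Proof.
move=> FH.
suff [A AH AE] : exists2 A : 'I_m -> V -> K, forall i, holomorphic_at w (A i) &
    forall u, F u = F (foldr (set_coord w) u (enum 'I_m)) +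
      \sum_(i <- enum 'I_m) (u 0 i - w 0 i) * A i u.
  exists A => // u; rewrite {1}AE; congr (F _ + _); last by rewrite big_enum.
  apply/rowP => j; have : j \in enum 'I_m by rewrite mem_enum.
  elim: (enum 'I_m) => // i s IH; rewrite inE /= set_coordE.
  by case: eqP => [->//|_] /= /IH.
elim: (enum 'I_m) (enum_uniq 'I_m) F FH => [_|i s IH /=/andP[si us]] F FH.
  exists (fun=> cst 0) => [i|u]; last by rewrite big_nil addr0.
  by apply/holomorphic_atP; exists 1 => // u _; exact: differentiable_cst.
have [A AH AE] := holomorphic_division i FH.
have [A' AH' AE'] := IH us _ (holomorphic_at_set_coord i FH).
exists (fun j => if j == i then A else A' j) => [j|u]; first by case: ifP.
rewrite big_cons eqxx AE -[F (set_coord w i u)]/((F \o set_coord w i) u) AE' /=.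
rewrite -addrA; congr (_ + _); rewrite addrC; congr (_ + _).
rewrite !big_seq; apply: eq_bigr => j js.
by case: eqP js si => // -> ->.
Qed.

End Division.

From mathcomp Require Import cyclic.
From mathcomp Require Import -(notations) mpoly.
Import CompleteIntersections.

(** * Comparison of the local rings *)

Section LocalRings.
Variables (R : realType) (m : nat).
Local Notation K := (R[i] : numClosedFieldType).
Local Notation C_ x := (x%:C%C : K).
Local Notation V := ('rV[K]_m).
Local Notation S := (mpoly m K).
Implicit Types (u w : V) (p q h : S) (F G : V -> K).

Lemma common_radius (I : finType) (e : I -> R) : (forall i, 0 < e i) ->
  exists2 d, 0 < d & forall i, d <= e i.
Proof.
move=> e0; exists (\big[Num.min/1]_i e i); last by move=> i; exact: bigmin_le_cond.
by elim/big_ind: _ => // x y x0 y0; rewrite lt_min x0 y0.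
Qed.

Lemma differentiable_mev p u : differentiable (fun v : V => mev v p) u.
Proof.
elim/mpoly_ring_ind: p => [c|i p pu|p q pu qu].
- by rewrite (_ : (fun=> _) = cst c) ?funeqE => [|v]; [exact: differentiable_cst | exact: mevC].
- rewrite (_ : (fun v => _) = (fun v : V => v 0 i) * (fun v : V => mev v p)).
    by apply: differentiableM => //; exact: differentiable_coord.
  by rewrite funeqE => v; rewrite rmorphM/= mevX.
- rewrite (_ : (fun v => _) = (fun v : V => mev v p) + (fun v : V => mev v q)).
    exact: differentiableD.
  by rewrite funeqE => v; rewrite rmorphD.
Qed.

Variable w : V.

Lemma holomorphic_at_mev p : holomorphic_at w (fun u => mev u p).
Proof. by apply/holomorphic_atP; exists 1 => // u _; exact: differentiable_mev. Qed.

Lemma holomorphic_atD F G : holomorphic_at w F -> holomorphic_at w G -> holomorphic_at w (F + G).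
Proof. by apply: filterS2 => u; exact: differentiableD. Qed.

Lemma holomorphic_atM F G : holomorphic_at w F -> holomorphic_at w G -> holomorphic_at w (F * G).
Proof. by apply: filterS2 => u; exact: differentiableM. Qed.

Lemma near_mev_neq0 p : mev w p != 0 -> \forall u \near w, mev u p != 0.
Proof.
move=> p0; have /differentiable_continuous pc := differentiable_mev p w.
have : \forall y \near mev w p, y != 0.
  apply/nbhs_nrmP; exists (nrm (mev w p)); first by rewrite nrm_gt0.
  by move=> v vp; apply: contraTneq vp => ->; rewrite sub0r nrmN ltxx.
by move=> /pc.
Qed.

Section Ideal.
Variables (nf : nat) (f : 'I_nf -> S).
Let P k u := mev u (f k).

Lemma germ_idealD F G : germ_ideal w P F -> germ_ideal w P G -> germ_ideal w P (F + G).
Proof.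
move=> [A AH AE] [B BH BE]; exists (fun k => A k + B k) => [k|].
  exact: holomorphic_atD.
move: AE BE; apply: filterS2 => u Fu Gu; rewrite fctE Fu Gu -big_split.
by apply: eq_bigr => k _; rewrite mulrDl.
Qed.

Lemma germ_idealM F G : germ_ideal w P F -> holomorphic_at w G -> germ_ideal w P (F * G).
Proof.
move=> [A AH AE] GH; exists (fun k => A k * G) => [k|]; first exact: holomorphic_atM.
move: AE; apply: filterS => u Fu; rewrite fctE Fu mulr_suml.
by apply: eq_bigr => k _; rewrite mulrAC.
Qed.

Lemma germ_ideal0 : germ_ideal w P 0.
Proof.
exists (fun=> 0) => [k|]; first by apply/holomorphic_atP; exists 1 => // u _; exact: differentiable_cst.
by apply/nbhs_nrmP; exists 1 => // u _; rewrite big1// => k _; rewrite mul0r.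
Qed.

Lemma germ_localization p : localization (span f) w p -> germ_ideal w P (fun u => mev u p).
Proof.
move=> [e [/near_mev_neq0 e0 [h hE]]].
exists (fun k => (fun u => mev u (h k)) * (fun u => (mev u e)^-1)) => [k|].
  apply: holomorphic_atM; first exact: holomorphic_at_mev.
  move: e0; apply: filterS => u eu; apply: differentiableV => //; exact: differentiable_mev.
move: e0; apply: filterS => u eu; apply: (mulfI eu).
have := congr1 (mev u) hE; rewrite rmorphM rmorph_sum/= => ->.
rewrite mulr_sumr; apply: eq_bigr => k _; rewrite rmorphM/= fctE.
by rewrite [RHS]mulrA [in RHS]mulrCA divff// mulr1.
Qed.

Definition linear_factor (i : 'I_m) : S := mpolyX K (mnm1 i) - mpolyC m (w 0 i).

Lemma mev_linear_factor u i : mev u (linear_factor i) = u 0 i - w 0 i.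
Proof. by rewrite rmorphB/= mevX mevC. Qed.

(* Induction on D: expand F by Hadamard's lemma and absorb the factors in h. *)
Lemma germ_reduction D h : (forall s : seq 'I_m, size s = D ->
    localization (span f) w (h * \prod_(j <- s) linear_factor j)) ->
  forall F, holomorphic_at w F -> exists q, germ_ideal w P (fun u => mev u h * F u - mev u q).
Proof.
elim: D h => [|D IH] h hD F FH.
  exists 0; have := hD [::] erefl; rewrite big_nil mulr1 => /germ_localization/germ_idealM/(_ FH).
  by congr germ_ideal; rewrite funeqE => u; rewrite rmorph0 subr0.
have [A AH AE] := hadamard FH.
have /choice[q qE] i : exists q, germ_ideal w P (fun u => mev u (h * linear_factor i) * A i u - mev u q).
  by apply: IH => // s sD; have := hD (i :: s); rewrite /= sD big_cons mulrA; exact.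
exists (mpolyC m (F w) * h + \sum_i q i).
have -> : (fun u => mev u h * F u - mev u (mpolyC m (F w) * h + \sum_i q i)) =
    \sum_i (fun u => mev u (h * linear_factor i) * A i u - mev u (q i)).
  rewrite funeqE => u; rewrite fct_sumE sumrB AE rmorphD rmorphM/= mevC rmorph_sum/= opprD addrA.
  congr (_ - _); rewrite mulrDr [mev u h * F w]mulrC addrAC subrr add0r mulr_sumr.
  by apply: eq_bigr => i _; rewrite rmorphM/= mev_linear_factor mulrA.
by elim/big_ind: _ => // [|? ?]; [exact: germ_ideal0 | exact: germ_idealD].
Qed.

(** Taylor polynomials without higher derivatives: each use of Hadamard's lemma gains one order at
    [w]. *)
Lemma polynomial_approximation D F : holomorphic_at w F -> exists q C d, [/\ 0 <= C, 0 < d &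
  forall u, nrm (u - w) < d -> nrm (F u - mev u q) <= C * nrm (u - w) ^+ D].
Proof.
elim: D F => [|D IH] F FH.
  have [r [M [r0 Fr]]] := holomorphic_at_disc FH.
  exists 0, M, r; split => //; first exact: hol_disc_ge0 r0 Fr.
  by move=> u ur; rewrite rmorph0 subr0 expr0 mulr1; have [] := Fr u ur.
have [A AH AE] := hadamard FH.
have /choice[q /choice[C /choice[d H]]] := fun i => IH _ (AH i).
exists (mpolyC m (F w) + \sum_i linear_factor i * q i), (\sum_i C i).
have [d1 d10 d1d] : exists2 d1 : R, 0 < d1 & forall i, d1 <= d i.
  by apply: common_radius => i; have [] := H i.
exists d1; split => //; first by apply: sumr_ge0 => i _; have [] := H i.
move=> u ud; rewrite AE rmorphD rmorph_sum/= mevC opprD addrACA subrr add0r -sumrB.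
apply: le_trans (nrm_sum _ _ _) _; rewrite mulr_suml; apply: ler_sum => i _.
rewrite rmorphM/= mev_linear_factor -mulrBr nrmM exprS mulrCA.
have [_ _ /(_ u (lt_le_trans ud (d1d i))) Hi] := H i.
apply: ler_pM => //; rewrite ?nrm_ge0//.
by have := nrm_coord (u - w) i; rewrite !mxE.
Qed.

(** The coefficients [A k] are replaced by polynomials [q k] up to order D. Then
    [p - \sum_k q k * f k] vanishes to order D at [w], and [poly_order] applies because all
    monomials of degree at least D lie in the localization. *)
Lemma localization_germ p : eliminates (span f) ->
  germ_ideal w P (fun u => mev u p) -> localization (span f) w p.
Proof.
move=> fE [A AH AE]; have JI := span_ideal f; have QI := localization_ideal w JI.
have [D DP] := localization_power_products w JI fE.
have /choice[q /choice[C /choice[d H]]] := fun k => polynomial_approximation D (AH k).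
suff : localization (span f) w (p - \sum_k q k * f k).
  have [_ QD _] := QI; move=> Hq; rewrite -(subrK (\sum_k q k * f k) p); apply: QD => //.
  by apply: localization_sub; exists q.
apply: (poly_order (D := D) QI DP) => v.
have /nbhs_nrmP[d0 d00 pE] := AE.
have /choice[M /choice[dM HM]] : forall k, exists M dM, [/\ 0 <= M, 0 < dM &
    forall u, nrm (u - w) < dM -> nrm (mev u (f k)) <= M].
  move=> k; have [r [M [r0 Fr]]] := holomorphic_at_disc (holomorphic_at_mev (f k)).
  by exists M, r; split; [exact: hol_disc_ge0 r0 Fr | | move=> u /Fr[]].
have [d2 d20 d2d] : exists2 d2 : R, 0 < d2 & forall k, d2 <= d k.
  by apply: common_radius => k; have [] := H k.
have [d3 d30 d3d] : exists2 d3 : R, 0 < d3 & forall k, d3 <= dM k.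
  by apply: common_radius => k; have [] := HM k.
have [d1 d10 [d1d0 d1d1 d1M]] : exists2 d1 : R, 0 < d1 & [/\ d1 <= d0, forall k, d1 <= d k & forall k, d1 <= dM k].
  exists (Num.min d0 (Num.min d2 d3)); first by rewrite !lt_min d00 d20.
  split=> [|k|k]; first by rewrite ge_min lexx.
    by apply: le_trans (d2d k); rewrite !ge_min lexx orbT.
  by apply: le_trans (d3d k); rewrite !ge_min lexx !orbT.
pose B := \sum_k C k * M k.
have B0 : 0 <= B by apply: sumr_ge0 => k _; apply: mulr_ge0; [have [] := H k | have [] := HM k].
have bound u : nrm (u - w) < d1 -> nrm (mev u (p - \sum_k q k * f k)) <= B * nrm (u - w) ^+ D.
  move=> ud; rewrite rmorphB/= (pE _ (lt_le_trans ud d1d0)) rmorph_sum -sumrB.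
  apply: le_trans (nrm_sum _ _ _) _; rewrite mulr_suml; apply: ler_sum => k _.
  rewrite rmorphM/= -mulrBl nrmM mulrAC; apply: ler_pM; rewrite ?nrm_ge0//.
    by have [_ _] := H k; apply; exact: lt_le_trans (d1d1 k).
  by have [_ _] := HM k; apply; exact: lt_le_trans (d1M k).
have v1 : 0 < 1 + nrm v by rewrite ltr_wpDr ?nrm_ge0.
exists (C_ (B * nrm v ^+ D)), (C_ (d1 / (1 + nrm v))); split.
- by rewrite lecR; apply: mulr_ge0 => //; rewrite exprn_ge0 ?nrm_ge0.
- by rewrite ltcR; exact: divr_gt0.
move=> z; rewrite !nrmE ltcR -rmorphXn/= -rmorphM/= lecR => zd.
have zv : nrm (w + z *: v - w) = nrm z * nrm v by rewrite addrAC subrr add0r nrmZ.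
apply: le_trans (bound _ _) _; last by rewrite zv exprMn mulrA mulrAC.
rewrite zv; move: zd; rewrite ltr_pdivlMr// => zd; apply: le_lt_trans zd.
by apply: ler_wpM2l; rewrite ?nrm_ge0// lerDr.
Qed.

(** A polynomial basis works for germs too: by [germ_reduction] every germ is a polynomial modulo
    the ideal, and by [localization_germ] no new relations between polynomials appear. *)
Theorem local_ring_dim d : eliminates (span f) ->
  has_quotient_dim setT (localization (span f) w) d ->
  has_quotient_dim (holomorphic_at w) (germ_ideal w P) d.
Proof.
move=> fE [e [_ eU]]; have JI := span_ideal f; have QI := localization_ideal w JI.
exists (fun i u => mev u (e i)); split => [i|F FH]; first exact: holomorphic_at_mev.
have sumE (a : 'rV[K]_d) : \sum_i a 0 i *: (fun u => mev u (e i)) = (fun u => mev u (\sum_i a 0 i *: e i)).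
  rewrite funeqE => u; rewrite fct_sumE rmorph_sum; apply: eq_bigr => i _.
  by rewrite -mul_mpolyC rmorphM/= mevC.
have [D DP] := localization_power_products w JI fE.
have [|q qF] := germ_reduction (D := D) (h := 1) _ FH.
  move=> s sD; rewrite mul1r prod_count; apply: DP; by rewrite mdeg_count sD.
have {}qF : germ_ideal w P (F - (fun u => mev u q)).
  by move: qF; congr germ_ideal; rewrite funeqE => u; rewrite rmorph1 mul1r.
have germP (a : 'rV[K]_d) : germ_ideal w P (F - (fun u => mev u (\sum_i a 0 i *: e i))) <->
    localization (span f) w (q - \sum_i a 0 i *: e i).
  split => [H|/germ_localization H].
    apply: localization_germ => //.
    have N1 : holomorphic_at w (- 1).
      by apply/holomorphic_atP; exists 1 => // u _; exact: differentiable_cst.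
    have := germ_idealD H (germ_idealM qF N1); congr germ_ideal.
    by rewrite funeqE => u; rewrite !fctE rmorphB/= mulrN1 opprB addrC subrKA.
  have := germ_idealD qF H; congr germ_ideal.
  by rewrite funeqE => u; rewrite !fctE rmorphB/= subrKA.
have [a [aq aU]] := eU q I; exists a; split.
  rewrite (_ : \sum_(i < d) _ = fun u => mev u (\sum_i a 0 i *: e i)); last exact: sumE.
  exact/germP.
move=> b; rewrite (_ : \sum_(i < d) _ = fun u => mev u (\sum_i b 0 i *: e i)); last exact: sumE.
by move=> /germP; exact: aU.
Qed.

End Ideal.
End LocalRings.

(** * Fourier analysis on F_p *)

Section Fourier.
Variables (R : realType) (p : nat) (p_prime : prime p) (p_odd : odd p).
Local Notation C := R[i].
Local Notation F := 'F_p.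
Local Notation Fun := {ffun F -> C^o}.
Implicit Types (f g : Fun) (x y l : F).

Let p_gt0 : (0 < p)%N. Proof. exact: prime_gt0. Qed.
Let p_neq0 : p%:R != 0 :> C. Proof. by rewrite pnatr_eq0 -lt0n. Qed.

Definition zeta : C := (cos (2 * pi / p%:R) +i* sin (2 * pi / p%:R))%C.

Lemma zetaX k : zeta ^+ k = (let t : R := 2 * pi * k%:R / p%:R in (cos t +i* sin t)%C).
Proof.
elim: k => [|k IH]; first by rewrite expr0 /= mulr0 mul0r cos0 sin0.
rewrite exprS IH /=.
have -> : 2 * pi * k.+1%:R / p%:R = 2 * pi / p%:R + 2 * pi * k%:R / p%:R :> R.
  by rewrite -natr1; ring.
rewrite cosD sinD; apply/eqP; rewrite eq_complex /= eqxx /=; apply/eqP; ring.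
Qed.

Lemma zeta_prim : p.-primitive_root zeta.
Proof.
have pR : p%:R != 0 :> R by rewrite pnatr_eq0 -lt0n.
have zp : zeta ^+ p = 1.
  by rewrite zetaX /= mulfK// mulr_natl cos2pi sin2pi.
have [m zm mp] := prim_order_exists p_gt0 zp.
have m1 : m != 1%N.
  apply/eqP => m1; move: zm; rewrite m1 => /prim_expr_order; rewrite expr1 /zeta => /eqP.
  rewrite eq_complex /= => /andP[_]; rewrite gt_eqF//.
  have p0 : 0 < p%:R :> R by rewrite ltr0n.
  have pi0 := pi_gt0 R.
  (* As p is odd it exceeds 2, so 2 pi / p lies in (0, pi), where the sine is positive; thus [zeta]
     is not 1. *)
  have p3 : 2 < p%:R :> R.
    by rewrite ltr_nat ltn_neqAle prime_gt1// andbT; apply: contraTneq p_odd => <-.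
  apply: sin_gt0_pi; apply/andP; split; first by rewrite divr_gt0// mulr_gt0.
  by rewrite ltr_pdivrMr// mulrC ltr_pM2l.
by have <- : m = p by exact/(prime_nt_dvdP p_prime).
Qed.

Let zetap : zeta ^+ p = 1. Proof. exact: prim_expr_order zeta_prim. Qed.

Definition chi (x : F) : C := zeta ^+ x.

Lemma val_chi (k : nat) : zeta ^+ k = chi k%:R.
Proof. by rewrite /chi val_Fp_nat// expr_mod. Qed.

Lemma chiD x y : chi (x + y) = chi x * chi y.
Proof. by rewrite -[x in LHS]natr_Zp -[y in LHS]natr_Zp -natrD -val_chi exprD. Qed.

Lemma chi0 : chi 0 = 1. Proof. exact: expr0. Qed.

Lemma chi_eq1 x : (chi x == 1) = (x == 0).
Proof.
rewrite /chi -(expr0 zeta) (eq_prim_root_expr zeta_prim) mod0n.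
by rewrite modn_small// -[X in (_ < X)%N](Fp_cast p_prime).
Qed.

Lemma sum_chi l : \sum_x chi (x * l) = if l == 0 then p%:R else 0.
Proof.
case: eqP => [->|/eqP l0].
  under eq_bigr do rewrite mulr0 chi0.
  by rewrite sumr_const card_Fp.
have : chi l * \sum_x chi (x * l) = \sum_x chi (x * l).
  rewrite [RHS](reindex_inj (addIr 1)) mulr_sumr; apply: eq_bigr => x _.
  by rewrite mulrDl mul1r chiD mulrC.
move/eqP; rewrite -subr_eq0 -[X in _ - X]mul1r -mulrBl mulf_eq0 subr_eq0 chi_eq1 (negPf l0).
by move/eqP.
Qed.

Definition root_p : C := ((Num.sqrt p%:R)^-1)%:C%C.

Lemma root_p_sqr : root_p * root_p = p%:R^-1.
Proof.
rewrite -rmorphM -invfM -expr2 sqr_sqrtr ?ler0n// fmorphV rmorph_nat //.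
Qed.

Lemma root_p_neq0 : root_p != 0.
Proof.
apply/eqP => r0; have := root_p_sqr; rewrite r0 mul0r => /esym/eqP.
by rewrite invr_eq0 (negPf p_neq0).
Qed.

Lemma fourierE f x : fourier f x = root_p * \sum_y chi (x * y) * f y.
Proof.
rewrite ffunE; congr (_ * _); apply: eq_bigr => y _; congr (_ * _).
by rewrite -zetaX val_chi natrM !natr_Zp.
Qed.

Lemma convolution f g x : fourier f x * fourier (reflect_fun g) x =
  p%:R^-1 * \sum_l chi (x * l) * \sum_y f (y + l) * g y.
Proof.
rewrite !fourierE mulrACA root_p_sqr; congr (_ * _); rewrite mulr_suml.
transitivity (\sum_z \sum_y chi (x * (z - y)) * (f z * g y)).
  apply: eq_bigr => z _; rewrite mulr_sumr (reindex_inj oppr_inj); apply: eq_bigr => y _.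
  by rewrite ffunE opprK mulrACA -chiD -mulrDr.
rewrite exchange_big /=; transitivity (\sum_y \sum_l chi (x * l) * (f (y + l) * g y)).
  apply: eq_bigr => y _; rewrite (reindex_inj (addrI y)); apply: eq_bigr => l _.
  by rewrite addrAC subrr add0r.
by rewrite exchange_big; apply: eq_bigr => l _; rewrite mulr_sumr.
Qed.

Lemma fourier_inj (E : F -> C) : (forall x, \sum_l chi (x * l) * E l = 0) -> forall l, E l = 0.
Proof.
move=> H l0; have : \sum_x chi (x * - l0) * \sum_l chi (x * l) * E l = 0.
  by rewrite big1// => x _; rewrite H mulr0.
under eq_bigr do rewrite mulr_sumr.
rewrite exchange_big /=.
under eq_bigr => l _.
  under eq_bigr do rewrite mulrA -chiD -mulrDr.
  rewrite -mulr_suml sum_chi addrC subr_eq0.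
over.
rewrite (bigD1 l0)//= eqxx big1 ?addr0 => [/eqP|l /negPf ->]; last by rewrite mul0r.
by rewrite mulf_eq0 (negPf p_neq0) => /eqP.
Qed.

Lemma parseval f g : \sum_x fourier f x * fourier (reflect_fun g) x = \sum_x f x * g x.
Proof.
under eq_bigr do rewrite convolution.
rewrite -mulr_sumr exchange_big /= (bigD1 0)//= [X in _ + X]big1 ?addr0 => [|l /negPf l0].
  rewrite -mulr_suml sum_chi eqxx mulKf//; apply: eq_bigr => y _; by rewrite addr0.
by rewrite -mulr_suml sum_chi l0 mul0r.
Qed.

Definition inv_fun f : Fun := [ffun x => (f x)^-1].

(** The sums in [C_function] are the values off 0 of the correlation [D] of [f] with its inverse,
    and the product of the two transforms is the transform of [D]. The convention that 0 has inverse
    0 gives [inv_fun f] the right value at 0. *)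
Lemma C_functionP f : f 0 = 0 -> C_function f <-> Phi (f, inv_fun f) = Phi_target R p.
Proof.
move=> f0.
have mulE : (forall x : F, x != 0 -> f x != 0) <-> Defs.mul_fun f (inv_fun f) = indic_units R p.
  split => [fn|/ffunP H x x0].
    apply/ffunP => x; rewrite !ffunE; have [->|x0] := eqVneq x 0; first by rewrite f0 mul0r.
    by rewrite mulfV// fn.
  by apply/eqP => fx; have := H x; rewrite !ffunE fx mul0r x0 => /esym/eqP; rewrite oner_eq0.
pose D (l : F) : C := \sum_y f (y + l) * (f y)^-1.
have DE l : D l = \sum_(y | y != 0) f (y + l) * (f y)^-1.
  by rewrite /D (bigD1 0)//= f0 invr0 mulr0 add0r.
have convE x : fourier f x * fourier (reflect_fun (inv_fun f)) x = p%:R^-1 * \sum_l chi (x * l) * D l.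
  rewrite convolution; congr (_ * _); apply: eq_bigr => l _; congr (_ * _).
  by apply: eq_bigr => y _; rewrite ffunE.
(* The function whose transform is a multiple of the indicator of the non-zero elements; it is -1
   off 0, as in [C_function]. *)
pose T (l : F) : C := (if l == 0 then p%:R else 0) - 1.
have TE x : \sum_l chi (x * l) * T l = p%:R * (x != 0)%:R.
  transitivity (\sum_l (chi (x * l) * (if l == 0 then p%:R else 0) - chi (x * l))).
    by apply: eq_bigr => l _; rewrite /T mulrBr mulr1.
  rewrite sumrB (bigD1 0)//= mulr0 chi0 mul1r big1 => [|l /negPf->]; last by rewrite mulr0.
  under eq_bigr do rewrite mulrC.
  by rewrite sum_chi; case: eqP => _; rewrite addr0 ?subrr ?mulr0// subr0 mulr1.
have D0 : (forall x : F, x != 0 -> f x != 0) -> D 0 = T 0.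
  move=> fn; rewrite DE (eq_bigr (fun=> 1)) => [|y y0]; last by rewrite addr0 mulfV// fn.
  rewrite sumr_const /T eqxx; have := cardC1 (0 : F); rewrite card_Fp// => ->.
  by rewrite -subn1 natrB.
split => [[_ fn fC]|].
  congr pair; first exact/mulE.
  apply/ffunP => x; rewrite ffunE convE [RHS]ffunE.
  have DT l : D l = T l.
    have [->|l0] := eqVneq l 0; first exact: D0.
    rewrite DE /T (negPf l0) sub0r -(fC (- l)) ?oppr_eq0//.
    by apply: eq_bigr => y _; rewrite opprK.
  under eq_bigr do rewrite DT.
  by rewrite TE mulKf.
case=> /mulE fn fE; split => // l l0.
have DT : forall l, D l - T l = 0.
  apply: fourier_inj => x; under eq_bigr do rewrite mulrBr.
  rewrite sumrB TE; have := congr1 (fun h : Fun => h x) fE; rewrite ffunE convE ffunE => <-.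
  by rewrite mulVKf// subrr.
have /eqP := DT (- l); rewrite subr_eq0 DE /T oppr_eq0 (negPf l0) sub0r => /eqP <-.
by apply: eq_bigr => y _.
Qed.

Section Equivariance.
Variables (H : {group {unit F}}) (c : {unit F} -> C).
Hypothesis c_char : is_character H c.

Lemma char1 : c 1%g = 1.
Proof.
have [cM c0] := c_char; apply: (mulfI (c0 _ (group1 H))).
by rewrite mulr1 -cM ?mul1g.
Qed.

Lemma charX h k : h \in H -> c (h ^+ k)%g = c h ^+ k.
Proof.
have [cM _] := c_char; move=> hH; elim: k => [|k IH]; first exact: char1.
by rewrite expgS exprS cM ?IH// groupX.
Qed.

(** On a finite group the values of a character are roots of unity. *)
Lemma char_conj h : h \in H -> (c h)^* = (c h)^-1.
Proof.
move=> hH; have : c h ^+ #|H| = 1 by rewrite -charX// expg_cardG// char1.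
move/(congr1 Num.norm); rewrite normrX normr1 => /eqP.
rewrite pexpr_eq1 ?normr_ge0 ?cardG_gt0// => /eqP n1.
by rewrite invC_norm n1 expr1n invr1 mul1r.
Qed.

Lemma fourier_equivariant f : equivariant H c f -> equivariant H (fun h => (c h)^-1) (fourier f).
Proof.
move=> fc h hH x; have [_ c0] := c_char.
apply: (mulfI (c0 h hH)); rewrite mulVKf ?c0// !fourierE mulrCA; congr (_ * _).
have hu : val h != 0 by rewrite -unitfE; exact: valP.
rewrite mulr_sumr [RHS](reindex_inj (mulfI hu)); apply: eq_bigr => y _.
by rewrite fc// mulrCA; congr (chi _ * _); rewrite [RHS]mulrCA mulrA.
Qed.

End Equivariance.

Lemma reflect_equivariant (H : {group {unit F}}) (c : {unit F} -> C) f :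
  equivariant H c f -> equivariant H c (reflect_fun f).
Proof. by move=> fc h hH x; rewrite !ffunE -mulrN fc. Qed.

Lemma equivariant0 (H : {group {unit F}}) (c : {unit F} -> C) f : (exists2 h, h \in H & c h != 1) ->
  equivariant H c f -> f 0 = 0.
Proof.
move=> [h hH ch] /(_ h hH 0) /eqP; rewrite mulr0 -subr_eq0 -[X in X - _]mul1r -mulrBl mulf_eq0.
by rewrite subr_eq0 eq_sym (negPf ch) => /eqP.
Qed.

Definition fourier_zeros f : {set F} := [set x | fourier f x == 0]%SET.
Definition fun_zeros f : {set F} := [set x | f x == 0]%SET.

(** Chebotarev's theorem for the polynomial with coefficients [f a], whose values at the powers of
    [zeta] are the Fourier values up to a scalar. *)
Lemma uncertainty f : f != 0 -> (#|fourier_zeros f| + #|fun_zeros f| < p)%N.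
Proof.
move=> f0; pose g : {poly C} := \poly_(a < p) f a%:R.
have gE (x : F) : g`_x = f x.
  by rewrite coef_poly -{2}(Fp_cast p_prime) ltn_ord natr_Zp.
have g0 : g != 0.
  apply: contraNneq f0 => g0; apply/eqP/ffunP => x.
  by rewrite -gE g0 coef0 ffunE.
pose B : {set 'I_p} := [set b : 'I_p | fourier f b%:R == 0]%SET.
have gB (b : 'I_p) : b \in B -> root g (zeta ^+ b).
  rewrite inE fourierE mulf_eq0 (negPf root_p_neq0) /= => /eqP E; apply/eqP.
  rewrite horner_poly -[RHS]E (reindex (fun i : 'I_p => i%:R : F))/=; last first.
    exists (fun x : F => cast_ord (Fp_cast p_prime) x) => [i _|x _].
      by apply: val_inj; rewrite /= val_Fp_nat// modn_small.
    by rewrite /= natr_Zp.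
  by apply: eq_bigr => i _; rewrite mulrC -exprM val_chi natrM.
have := chebotarev p_prime zeta_prim g0 (size_poly _ _) gB.
pose io (i : 'I_p) : F := i%:R.
have io_inj : injective io.
  move=> i j /(congr1 val); rewrite /= !val_Fp_nat// !modn_small// => /val_inj//.
have io_surj (x : F) : exists i, x = io i.
  by exists (cast_ord (Fp_cast p_prime) x); rewrite /io /= natr_Zp.
have -> : #|B| = #|fourier_zeros f|.
  rewrite -(card_imset _ io_inj); apply/eq_card => x; have [i ->] := io_surj x.
  by rewrite mem_imset// !inE.
have -> : #|coef_support p g| = #|~: fun_zeros f|.
  rewrite -(card_imset _ io_inj); apply/eq_card => x; have [i ->] := io_surj x.
  rewrite mem_imset// !inE; congr (_ != _).
  by rewrite coef_poly ltn_ord.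
by have := cardsC (fun_zeros f); rewrite card_Fp//; lia.
Qed.

End Fourier.

(** * Coordinates on the space of equivariant functions *)

Lemma coset_representatives (gT : finGroupType) (H : {group gT}) N :
  #|[set: gT]%SET : H|%g = N.+1 ->
  exists (r : 'I_N.+1 -> gT) (cls : gT -> 'I_N.+1) (hh : gT -> gT),
    [/\ r ord0 = 1%g, forall x, hh x \in H, forall x, x = (hh x * r (cls x))%g &
        forall h i, h \in H -> cls (h * r i)%g = i /\ hh (h * r i)%g = h].
Proof.
move=> indexH; pose RC := rcosets H [set: gT]%SET.
have HRC : (H : {set gT}) \in RC by apply/rcosetsP; exists 1%g; rewrite ?inE// mulg1.
(* [H] is put first so that index 0 has the representative 1, the chosen element of a group. *)
pose cs := (H : {set gT}) :: rem (H : {set gT}) (enum RC).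
have csP : perm_eq (enum RC) cs by apply: perm_to_rem; rewrite mem_enum.
have size_cs : size cs = N.+1 by rewrite -(perm_size csP) -cardE.
have uniq_cs : uniq cs by rewrite -(perm_uniq csP) enum_uniq.
have mem_cs x : (H :* x)%g \in cs.
  by rewrite -(perm_mem csP) mem_enum; apply/rcosetsP; exists x; rewrite ?inE.
pose r (i : 'I_N.+1) : gT := repr (nth (H : {set gT}) cs i).
pose cls x : 'I_N.+1 := inord (index (H :* x)%g cs).
have rE (i : 'I_N.+1) : (H :* r i)%g = nth (H : {set gT}) cs i.
  have : nth (H : {set gT}) cs i \in RC by rewrite -mem_enum (perm_mem csP) mem_nth// size_cs.
  by rewrite /r => /rcosetsP[y _ ->]; apply/rcoset_eqP; exact: mem_repr_rcoset.
have cls_lt x : (index (H :* x)%g cs < N.+1)%N by rewrite -size_cs index_mem.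
have clsE x : (H :* r (cls x))%g = (H :* x)%g by rewrite rE inordK ?cls_lt// nth_index.
have clsM h i : h \in H -> cls (h * r i)%g = i.
  move=> hH; apply: ord_inj; rewrite /cls inordK ?cls_lt// rcosetM rcoset_id// rE.
  by rewrite index_uniq// size_cs.
exists r, cls, (fun x => x * (r (cls x))^-1)%g; split.
- by rewrite /r /= repr_group.
- by move=> x; rewrite -mem_rcoset clsE rcoset_refl.
- by move=> x; rewrite mulgKV.
- by move=> h i hH; split; [exact: clsM | rewrite clsM// mulgK].
Qed.

Section Extension.
Variables (R : realType) (p N : nat) (p_prime : prime p) (p_odd : odd p).
Local Notation C := R[i].
Local Notation F := 'F_p.
Local Notation U := {unit 'F_p}.
Local Notation Fun := {ffun F -> C^o}.
Variables (H : {group U}) (r : 'I_N.+1 -> U) (cls : U -> 'I_N.+1) (hh : U -> U).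
Hypotheses (r0 : r ord0 = 1%g) (hhH : forall u, hh u \in H) (uE : forall u, u = (hh u * r (cls u))%g)
  (repr_uniq : forall h i, h \in H -> cls (h * r i)%g = i /\ hh (h * r i)%g = h).

Lemma val_r0 : val (r ord0) = 1. Proof. by rewrite r0. Qed.

Definition to_unit (x : F) : U := insubd (1%g : U) x.

Lemma to_unitK (x : F) : x != 0 -> val (to_unit x) = x.
Proof. by rewrite -unitfE => xu; rewrite insubdK. Qed.

Lemma val_unit_neq0 (u : U) : val u != 0.
Proof. by rewrite -unitfE; exact: valP. Qed.

Lemma to_unit_val u : to_unit (val u) = u. Proof. exact: valKd. Qed.

Definition ext (c : U -> C) (v : 'I_N.+1 -> C) : Fun :=
  [ffun x => if x == 0 then 0 else c (hh (to_unit x)) * v (cls (to_unit x))].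

Lemma ext_unit c v u : ext c v (val u) = c (hh u) * v (cls u).
Proof. by rewrite ffunE (negPf (val_unit_neq0 u)) to_unit_val. Qed.

Lemma ext0 c v : ext c v 0 = 0. Proof. by rewrite ffunE eqxx. Qed.

Lemma ext_linear c v y : ext c v y = \sum_j ext c (fun i => (i == j)%:R) y * v j.
Proof.
rewrite ffunE; case: eqP => [->|/eqP y0]; first by rewrite big1// => j _; rewrite ext0 mul0r.
rewrite (bigD1 (cls (to_unit y)))//= ffunE (negPf y0) eqxx mulr1 big1 ?addr0// => j /negPf jy.
by rewrite ffunE (negPf y0) eq_sym jy mulr0 mul0r.
Qed.

Section Char.
Variable (c : U -> C).
Hypothesis c_char : is_character H c.

Lemma ext_repr v i : ext c v (val (r i)) = v i.
Proof.
have [E1 E2] := repr_uniq i (group1 H); rewrite mul1g in E1 E2.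
by rewrite ext_unit E1 E2 (char1 c_char) mul1r.
Qed.

Lemma ext_equivariant v : equivariant H c (ext c v).
Proof.
move=> h hH x; have [->|x0] := eqVneq x 0; first by rewrite mulr0 ext0 mulr0.
rewrite -(to_unitK x0); set u := to_unit x; rewrite -[val h * val u]/(val (h * u)%g) !ext_unit.
have [E1 E2] := repr_uniq (cls u) (groupM hH (hhH u)).
rewrite -mulgA -uE in E1 E2; rewrite E1 E2 mulrA; congr (_ * _).
by have [cM _] := c_char; rewrite cM ?hhH.
Qed.

Lemma equivariant_ext (f : Fun) : equivariant H c f -> f 0 = 0 -> ext c (fun i => f (val (r i))) = f.
Proof.
move=> fc f0; apply/ffunP => x; rewrite ffunE; case: eqP => [->//|/eqP x0].
rewrite -(fc _ (hhH _)); congr (f _).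
by have := congr1 val (uE (to_unit x)); rewrite to_unitK.
Qed.

Lemma V1_ext v : v ord0 = 1 -> V1 H c (ext c v).
Proof.
move=> v0; split; first exact: ext_equivariant.
by have := ext_repr v ord0; rewrite r0 v0.
Qed.

End Char.

(** The values may lie in any commutative monoid: complex numbers for Parseval's identity, natural
    numbers for counting zeros and units. *)
Lemma sum_invariant (W : nmodType) (phi : F -> W) : phi 0 = 0 ->
  (forall h, h \in H -> forall x, phi (val h * x) = phi x) ->
  \sum_x phi x = (\sum_i phi (val (r i))) *+ #|H|.
Proof.
move=> phi0 phiH; rewrite (bigD1 0)//= phi0 add0r.
rewrite (reindex_onto (fun u : U => val u) to_unit) => [|x x0]; last exact: to_unitK.
under eq_bigl do rewrite to_unit_val eqxx andbT val_unit_neq0.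
rewrite (partition_big cls predT)//= -sumrMnl; apply: eq_bigr => i _.
rewrite (reindex_onto (fun h => h * r i)%g (fun u => u * (r i)^-1)%g) => [|u _]; last by rewrite mulgKV.
rewrite -sumr_const; apply: eq_big => h.
  rewrite mulgK eqxx andbT; apply/eqP/idP => [hi|hH]; last by have [] := repr_uniq i hH.
  by have := uE (h * r i)%g; rewrite hi => /mulIg ->.
rewrite mulgK eqxx andbT => /eqP hi; have := uE (h * r i)%g; rewrite hi => E.
by rewrite E /= phiH.
Qed.

Lemma card_units : p = (N.+1 * #|H|).+1.
Proof.
have := @sum_invariant nat (fun x => (x != 0)%R : nat) _ _.
rewrite eqxx => /(_ erefl) E.
have hx h : h \in H -> forall x : F, (val h * x != 0) = (x != 0) :> nat.
  by move=> hH x; rewrite mulf_eq0 (negPf (val_unit_neq0 h)).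
move: E => /(_ hx); under [X in _ = X *+ _]eq_bigr do rewrite val_unit_neq0.
rewrite sum_nat_const card_ord muln1 -mulr_natr natn => E.
rewrite -[_ * _]/(N.+1 * #|H|)%N in E; rewrite -E -[LHS](card_Fp p_prime) (cardD1 (0 : F)) inE.
congr (_.+1); rewrite -sum1_card [RHS]big_mkcond /= [LHS]big_mkcond.
by apply: eq_bigr => x _; rewrite !inE andbT; case: eqP.
Qed.

Definition rep_zeros (f : Fun) : {set 'I_N.+1} := [set i | f (val (r i)) == 0]%SET.

Lemma card_zeros_invariant (f : {ffun F -> C^o}) : f 0 = 0 ->
  (forall h, h \in H -> forall x, (f (val h * x) == 0) = (f x == 0)) ->
  #|fun_zeros f| = (#|rep_zeros f| * #|H|).+1.
Proof.
move=> f0 fH.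
have := @sum_invariant nat (fun x => ((x != 0) && (f x == 0))%R : nat) _ _.
rewrite eqxx => /(_ erefl) E.
have hx h : h \in H -> forall x : F, ((val h * x != 0) && (f (val h * x) == 0)) =
    ((x != 0) && (f x == 0)) :> nat.
  by move=> hH x; rewrite mulf_eq0 (negPf (val_unit_neq0 h)) fH.
move: E => /(_ hx) E; rewrite -mulr_natr natn in E.
rewrite (cardD1 (0 : F)) inE f0 eqxx add1n; congr (_.+1).
have {}E : (\sum_(x : F) ((x != 0)%R && (f x == 0)%R : nat) =
    (\sum_i ((val (r i) != 0)%R && (f (val (r i)) == 0)%R : nat)) * #|H|)%N := E.
transitivity (\sum_(x : F) ((x != 0)%R && (f x == 0)%R : nat))%N.
  rewrite -sum1_card big_mkcond /=; apply: eq_bigr => x _; rewrite !inE; by case: (_ && _).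
rewrite E; congr (_ * _)%N; rewrite -sum1_card [RHS]big_mkcond /=.
by apply: eq_bigr => i _; rewrite inE val_unit_neq0; case: eqP.
Qed.

Section Selection.
Variable T : Type.
Implicit Types a b : 'I_N.+1 -> T.

(* Rows 0 and 1 carry the values of a and b at the trivial coset. *)
Definition sel a b (k : 'I_(N + N).+2) : T :=
  match unlift ord0 k with
  | None => a ord0
  | Some k1 => match unlift ord0 k1 with
    | None => b ord0
    | Some k2 => match fintype.split (k2 : 'I_(N + N)) with inl i => a (lift ord0 i) | inr l => b (lift ord0 l) end
    end
  end.

Lemma sel_row2 a b k : sel a b (row2 k) =
  match fintype.split k with inl i => a (lift ord0 i) | inr l => b (lift ord0 l) end.
Proof. by rewrite /sel /row2 !liftK. Qed.

End Selection.

Lemma sel2 (T1 T2 T3 : Type) (op : T1 -> T2 -> T3) a b a' b' k :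
  op (sel a b k) (sel a' b' k) = sel (fun i => op (a i) (a' i)) (fun i => op (b i) (b' i)) k.
Proof.
rewrite /sel; case: (unlift _ k) => [k1|//]; case: (unlift _ k1) => [k2|//].
by case: (fintype.split (k2 : 'I_(N + N))).
Qed.

Lemma sel_map (T1 T3 : Type) (op : T1 -> T3) a b k :
  op (sel a b k) = sel (fun i => op (a i)) (fun i => op (b i)) k.
Proof. exact: (@sel2 T1 unit T3 (fun x _ => op x) a b (fun=> tt) (fun=> tt)). Qed.

Lemma sum_sel (W : nmodType) (a b : 'I_N.+1 -> W) : \sum_k sel a b k = \sum_i a i + \sum_i b i.
Proof.
rewrite !big_ord_recl {1}/sel unlift_none {1}/sel liftK unlift_none -[RHS]addrA; congr (_ + _).
rewrite addrCA; congr (_ + _); rewrite big_split_ord; congr (_ + _); apply: eq_bigr => i _;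
  rewrite -[lift ord0 (lift ord0 _)]/(row2 _) sel_row2.
  by rewrite (unsplitK (inl i)).
by rewrite (unsplitK (inr i)).
Qed.

Definition unit_vec (j i : 'I_N.+1) : C := (i == j)%:R.

Section Transform.
Variables (c : U -> C) (TF : Fun -> Fun).
Hypothesis c_char : is_character H c.
Hypothesis TF_lin : forall v y, TF (ext c v) y = \sum_j TF (ext c (unit_vec j)) y * v j.

(** [TF] stands for the Fourier transform or for that of the reflected function, so that both
    matrices of the system arise from one construction. *)
Definition form_mx : 'M[C]_((N + N).+2, N.+1) := \matrix_(k, j)
  sel (fun i => (i == j)%:R) (fun l => TF (ext c (unit_vec j)) (val (r l))) k.

Lemma form_mxE v k : \sum_j form_mx k j * v j = sel v (fun l => TF (ext c v) (val (r l))) k.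
Proof.
have E i : \sum_j (i == j)%:R * v j = v i.
  rewrite (bigD1 i)//= eqxx mul1r big1 ?addr0// => j /negPf ij.
  by rewrite eq_sym ij mul0r.
under eq_bigr do rewrite mxE.
rewrite /sel; case: (unlift _ k) => [k1|]; last exact: E.
case: (unlift _ k1) => [k2|]; last by rewrite TF_lin.
by case: (fintype.split (k2 : 'I_(N + N))) => i; [exact: E | rewrite TF_lin].
Qed.

Hypothesis TF_zeros : forall f, f != 0 -> (#|fun_zeros (TF f)| + #|fun_zeros f| < p)%N.
Hypothesis TF0 : forall f, equivariant H c f -> TF f 0 = 0.
Hypothesis TFH : forall f, equivariant H c f ->
  forall h, h \in H -> forall x, (TF f (val h * x) == 0) = (TF f x == 0).

(** If [f] vanishes on a cosets and its transform on b cosets, both vanishing at 0 as well, then (a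
    + b) |H| + 2 < p = (N + 1) |H| + 1. *)
Lemma form_mx_few_zeros (x : 'cV[C]_N.+1) : x != 0 -> (#|zeros form_mx x| <= N)%N.
Proof.
move=> x0; pose v i := x i 0; pose f := ext c v; have fc := ext_equivariant c_char v.
have f0 : f != 0.
  apply: contraNneq x0 => f0; apply/eqP/colP => i.
  by rewrite mxE -[LHS](ext_repr c_char v) -/f f0 ffunE.
have -> : #|zeros form_mx x| = (#|rep_zeros f| +
    #|rep_zeros (TF f)|)%N.
  rewrite -!sum1_card !(big_mkcond (fun i => i \in _))/=.
  rewrite -[RHS]/((\sum_i _) + (\sum_i _))%R -sum_sel; apply: eq_bigr => k _.
  rewrite inE mxE form_mxE (sel_map (fun z : C => z == 0)) (sel_map (fun b : bool => if b then 1%N else 0%N)).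
  rewrite /sel; case: (unlift _ k) => [k1|]; last by rewrite inE /f ext_repr.
  case: (unlift _ k1) => [k2|]; last by rewrite inE.
  by case: (fintype.split (k2 : 'I_(N + N))) => i; rewrite inE ?/f ?ext_repr.
have := TF_zeros f0; rewrite (card_zeros_invariant (TF0 fc) (TFH fc)).
rewrite (@card_zeros_invariant f) ?ext0//; last first.
  move=> h hH y; have [_ c0] := c_char.
  by rewrite fc// mulf_eq0 (negPf (c0 _ hH)).
move: card_units (cardG_gt0 H); rewrite -/f.
move: #|H| #|rep_zeros f| #|rep_zeros (TF f)| => h a b pE h0 ab.
have : ((b + a) * h < N.+1 * h)%N by move: ab; rewrite pE; lia.
by rewrite ltn_pmul2r// addnC ltnS.
Qed.

End Transform.

Lemma fourier_linear (I : finType) (G : I -> Fun) (v : I -> C) (f : Fun) :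
  (forall y, f y = \sum_j G j y * v j) -> forall x, fourier f x = \sum_j fourier (G j) x * v j.
Proof.
move=> fE x; rewrite fourierE//; under eq_bigr do rewrite fE mulr_sumr.
rewrite exchange_big mulr_sumr; apply: eq_bigr => j _; rewrite fourierE// -mulrA mulr_suml.
by congr (_ * _); apply: eq_bigr => y _; rewrite mulrA.
Qed.


Lemma ext_fourier_linear c v y : fourier (ext c v) y = \sum_j fourier (ext c (unit_vec j)) y * v j.
Proof. by apply: fourier_linear => z; exact: ext_linear. Qed.

Definition fourier_reflect f : Fun := fourier (reflect_fun f).

Lemma ext_fourier_reflect_linear c v y :
  fourier_reflect (ext c v) y = \sum_j fourier_reflect (ext c (unit_vec j)) y * v j.
Proof.
apply: (fourier_linear (G := fun j => reflect_fun (ext c (unit_vec j)))) => z.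
by rewrite ffunE ext_linear; apply: eq_bigr => j _; rewrite [in RHS]ffunE.
Qed.

Lemma fourier_reflect_zeros f : f != 0 -> (#|fun_zeros (fourier_reflect f)| + #|fun_zeros f| < p)%N.
Proof.
move=> f0; have r0' : reflect_fun f != 0.
  apply: contraNneq f0 => /ffunP f0; apply/eqP/ffunP => x.
  by have := f0 (- x); rewrite !ffunE opprK.
have := uncertainty p_prime p_odd r0'; congr (_ + _ < _)%N.
rewrite -[RHS](card_imset _ oppr_inj); apply: eq_card => x.
by rewrite -[x in RHS]opprK (mem_imset _ _ oppr_inj) !inE ffunE.
Qed.

Variable c : U -> C.
Hypothesis c_char : is_character H c.
Hypothesis c_nontrivial : exists2 h, h \in H & c h != 1.

Definition cbar (h : U) : C := (c h)^*.

Lemma cbar_char : is_character H cbar.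
Proof.
have [cM c0] := c_char; split => [h k hH kH|h hH]; first by rewrite /cbar cM// rmorphM.
by rewrite /cbar conjC_eq0 c0.
Qed.

Lemma cbar_inv h : h \in H -> cbar h = (c h)^-1. Proof. exact: char_conj. Qed.

Lemma cbar_nontrivial : exists2 h, h \in H & cbar h != 1.
Proof.
have [h hH ch] := c_nontrivial; exists h => //.
by rewrite cbar_inv// invr_eq1.
Qed.

Lemma inv_nontrivial (d : U -> C) : (exists2 h, h \in H & d h != 1) -> exists2 h, h \in H & (d h)^-1 != 1.
Proof. by move=> [h hH dh]; exists h => //; rewrite invr_eq1. Qed.

Lemma fourier0 f : equivariant H c f -> fourier f 0 = 0.
Proof. by move=> /(fourier_equivariant p_prime p_odd c_char); apply: equivariant0; exact: inv_nontrivial. Qed.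

Lemma fourier_reflect_equivariant f : equivariant H cbar f ->
  equivariant H (fun h => (cbar h)^-1) (fourier_reflect f).
Proof. by move=> /reflect_equivariant; exact: (fourier_equivariant p_prime p_odd cbar_char). Qed.

Lemma fourier_reflect0 f : equivariant H cbar f -> fourier_reflect f 0 = 0.
Proof.
move=> /fourier_reflect_equivariant; apply: equivariant0; apply: inv_nontrivial; exact: cbar_nontrivial.
Qed.

Lemma eq0_equivariant (d : U -> C) f : (forall h, h \in H -> d h != 0) -> equivariant H d f ->
  forall h, h \in H -> forall x, (f (val h * x) == 0) = (f x == 0).
Proof. by move=> d0 fd h hH x; rewrite fd// mulf_eq0 (negPf (d0 h hH)). Qed.

Let Lx := form_mx c (@fourier R p).
Let Ly := form_mx cbar fourier_reflect.

Lemma few_zeros_Lx (x : 'cV[C]_N.+1) : x != 0 -> (#|zeros Lx x| <= N)%N.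
Proof.
apply: form_mx_few_zeros => // [v y|f f0|f|f fc].
- exact: ext_fourier_linear.
- exact: uncertainty.
- exact: fourier0.
- apply: eq0_equivariant (fourier_equivariant p_prime p_odd c_char fc).
  by have [_ c0] := c_char; move=> h /c0 ch; rewrite invr_eq0.
Qed.

Lemma few_zeros_Ly (x : 'cV[C]_N.+1) : x != 0 -> (#|zeros Ly x| <= N)%N.
Proof.
apply: form_mx_few_zeros => // [|v y|f f0|f|f fc].
- exact: cbar_char.
- exact: ext_fourier_reflect_linear.
- exact: fourier_reflect_zeros.
- exact: fourier_reflect0.
- apply: eq0_equivariant (fourier_reflect_equivariant fc).
  by have [_ c0] := cbar_char; move=> h /c0 ch; rewrite invr_eq0.
Qed.

Lemma mul_funE (f g : Fun) (x : F) : Defs.mul_fun f g x = f x * g x.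
Proof. exact: ffunE. Qed.

Lemma mul_equivariant (f g : Fun) : equivariant H c f -> equivariant H cbar g ->
  equivariant H (fun=> 1) (Defs.mul_fun f g).
Proof.
move=> fc gc h hH x; have [_ c0] := c_char.
by rewrite !mul_funE fc// gc// cbar_inv// mulrACA divff ?c0.
Qed.

Lemma mul_fourier_equivariant (f g : Fun) : equivariant H c f -> equivariant H cbar g ->
  equivariant H (fun=> 1) (Defs.mul_fun (fourier f) (fourier_reflect g)).
Proof.
move=> fc gc h hH x; have [_ c0] := c_char.
rewrite !mul_funE (fourier_equivariant p_prime p_odd c_char fc hH).
rewrite (fourier_reflect_equivariant gc hH) cbar_inv// invrK.
by rewrite mulrACA mulVf ?c0.
Qed.

Lemma sum_equivariant1 (f : Fun) : f 0 = 0 -> equivariant H (fun=> 1) f ->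
  \sum_x f x = (\sum_i f (val (r i))) *+ #|H|.
Proof. by move=> f0 f1; apply: sum_invariant => // h hH x; rewrite f1// mul1r. Qed.

Lemma parseval_reps (f g : Fun) : equivariant H c f -> equivariant H cbar g ->
  \sum_i f (val (r i)) * g (val (r i)) =
  \sum_i fourier f (val (r i)) * fourier_reflect g (val (r i)).
Proof.
move=> fc gc; have := parseval p_prime p_odd f g => /esym.
have := sum_equivariant1 _ (mul_equivariant fc gc).
have := sum_equivariant1 _ (mul_fourier_equivariant fc gc).
rewrite !mul_funE fourier0// (equivariant0 c_nontrivial fc) !mul0r => /(_ erefl) E1 /(_ erefl) E2.
have F1 : \sum_x f x * g x = \sum_x Defs.mul_fun f g x by apply: eq_bigr => x _; rewrite mul_funE.
have F2 : \sum_x fourier f x * fourier (reflect_fun g) x = \sum_x Defs.mul_fun (fourier f) (fourier_reflect g) x.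
  by apply: eq_bigr => x _; rewrite mul_funE.
rewrite F1 F2 E1 E2 => /eqP; rewrite -subr_eq0 -mulrnBl mulrn_eq0 gtn_eqF ?cardG_gt0//= subr_eq0 => /eqP E.
transitivity (\sum_i Defs.mul_fun f g (val (r i))); first by apply: eq_bigr => i _; rewrite mul_funE.
by rewrite E; apply: eq_bigr => i _; rewrite mul_funE.
Qed.

(** The signs of Parseval's identity, written as values minus Fourier values. *)
Definition sign_row : 'I_(N + N).+2 -> C := sel (fun=> 1) (fun=> -1).

Lemma sign_row_sum : \sum_k sign_row k = 0.
Proof. by rewrite sum_sel -big_split big1// => i _ /=; rewrite subrr. Qed.

Lemma parseval_mx i j : \sum_k sign_row k * Lx k i * Ly k j = 0.
Proof.
have fc := ext_equivariant c_char (unit_vec i); have gc := ext_equivariant cbar_char (unit_vec j).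
have := parseval_reps fc gc.
under eq_bigr do rewrite (ext_repr c_char) (ext_repr cbar_char).
move=> E; under eq_bigr do rewrite !mxE /sign_row !sel2.
rewrite sum_sel; under eq_bigr do rewrite mul1r.
rewrite E -big_split big1// => l _ /=.
by rewrite !mulN1r mulNr subrr.
Qed.


Definition val_x (u : 'rV[C]_(N + N)) (i : 'I_N.+1) : C :=
  if unlift ord0 i is Some j then u 0 (lshift N j) else 1.
Definition val_y (u : 'rV[C]_(N + N)) (i : 'I_N.+1) : C :=
  if unlift ord0 i is Some j then u 0 (rshift N j) else 1.

(* The value at the trivial coset is forced by the equality of the two sums in W1. *)
Definition val_w (u : 'rV[C]_(N + N)) (i : 'I_N.+1) : C :=
  if unlift ord0 i is Some j then u 0 (rshift N j)
  else 1 + \sum_j u 0 (lshift N j) - \sum_j u 0 (rshift N j).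

Lemma vec_xE u i : vec_x u i 0 = val_x u i.
Proof. by rewrite mxE /coord_x /val_x; case: (unlift _ _) => [j|]; rewrite ?mevX ?rmorph1. Qed.

Lemma vec_yE u i : vec_y u i 0 = val_y u i.
Proof. by rewrite mxE /coord_y /val_y; case: (unlift _ _) => [j|]; rewrite ?mevX ?rmorph1. Qed.

Definition pair_coord (fg : Fun * Fun) : 'rV[C]_(N + N) := \row_k
  match fintype.split k with
  | inl j => fg.1 (val (r (lift ord0 j)))
  | inr j => fg.2 (val (r (lift ord0 j)))
  end.

Lemma pair_coordl fg j : pair_coord fg 0 (lshift N j) = fg.1 (val (r (lift ord0 j))).
Proof. by rewrite mxE (unsplitK (inl j)). Qed.

Lemma pair_coordr fg j : pair_coord fg 0 (rshift N j) = fg.2 (val (r (lift ord0 j))).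
Proof. by rewrite mxE (unsplitK (inr j)). Qed.

Lemma ext_affine (d : U -> C) (t : C) v v1 v2 : (forall i, v i = t * v1 i + (1 - t) * v2 i) ->
  ext d v = t *: ext d v1 + (1 - t) *: ext d v2.
Proof.
move=> vE; apply/ffunP => x; rewrite !ffunE; case: eqP => _; first by rewrite !scaler0 addr0.
by rewrite vE -![_ *: _]/(_ * _); ring.
Qed.

Definition one_char : U -> C := fun=> 1.

Lemma one_char_char : is_character H one_char.
Proof. by split => [h k _ _|h _]; rewrite /one_char ?mulr1 ?oner_eq0. Qed.

Definition pt_source u : Fun * Fun := (ext c (val_x u), ext cbar (val_y u)).
Definition pt_target u : Fun * Fun := (ext one_char (val_x u), ext one_char (val_w u)).

Lemma pt_source_affine (t : C) u v :
  pt_source (t *: u + (1 - t) *: v) = t *: pt_source u + (1 - t) *: pt_source v.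
Proof.
apply: injective_projections; apply: ext_affine => i; rewrite /val_x /val_y;
  case: (unlift _ _) => [j|]; rewrite ?mxE//; ring.
Qed.

Lemma pt_target_affine (t : C) u v :
  pt_target (t *: u + (1 - t) *: v) = t *: pt_target u + (1 - t) *: pt_target v.
Proof.
apply: injective_projections; apply: ext_affine => i; rewrite /val_x /val_w;
  case: (unlift _ _) => [j|]; rewrite ?mxE//; first by ring.
under eq_bigr do rewrite !mxE.
under [X in _ - X]eq_bigr do rewrite !mxE.
by rewrite !big_split/= -!mulr_sumr; ring.
Qed.

Lemma pt_source_in u : (V1 H c `*` V1bar H c) (pt_source u).
Proof.
split; first by apply: V1_ext => //; rewrite /val_x unlift_none.
by apply: (V1_ext cbar_char); rewrite /val_y unlift_none.
Qed.

Lemma sum_ext1 v : \sum_x ext one_char v x = (\sum_i v i) *+ #|H|.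
Proof.
rewrite sum_equivariant1 ?ext0//; last exact: (ext_equivariant one_char_char).
by under eq_bigr do rewrite (ext_repr one_char_char).
Qed.

Lemma pt_target_in u : W1 H (pt_target u).
Proof.
split.
- by split; [exact: (ext_equivariant one_char_char) | exact: ext0].
- by split; [exact: (ext_equivariant one_char_char) | exact: ext0].
- transitivity (ext one_char (val_x u) (val (r ord0))); first by rewrite val_r0.
  by rewrite (ext_repr one_char_char) /val_x unlift_none.
rewrite [LHS]sum_ext1 [RHS]sum_ext1; congr (_ *+ _); rewrite !big_ord_recl /val_x /val_w !unlift_none.
under eq_bigr do rewrite liftK.
under [X in _ = _ + X]eq_bigr do rewrite liftK.
by rewrite subrK.
Qed.

Lemma pt_sourceK u : pair_coord (pt_source u) = u.
Proof.
apply/rowP => k; case: (split_ordP k) => j ->.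
  by rewrite pair_coordl /= ext_repr// /val_x liftK.
by rewrite pair_coordr /= (ext_repr cbar_char) /val_y liftK.
Qed.

Lemma pt_targetK u : pair_coord (pt_target u) = u.
Proof.
apply/rowP => k; case: (split_ordP k) => j ->.
  by rewrite pair_coordl /= (ext_repr one_char_char) /val_x liftK.
by rewrite pair_coordr /= (ext_repr one_char_char) /val_w liftK.
Qed.

Lemma pair_coord_sourceK fg : (V1 H c `*` V1bar H c) fg -> pt_source (pair_coord fg) = fg.
Proof.
case: fg => f g [[fc f1] [gc g1]]; congr pair.
  rewrite -[RHS](equivariant_ext fc (equivariant0 c_nontrivial fc)); congr ext.
  apply/funext => i; rewrite /val_x; case: unliftP => [j ->|->]; first by rewrite pair_coordl.
  by rewrite val_r0.
rewrite -[RHS](equivariant_ext gc (equivariant0 cbar_nontrivial gc)); congr ext.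
apply/funext => i; rewrite /val_y; case: unliftP => [j ->|->]; first by rewrite pair_coordr.
by rewrite val_r0.
Qed.

Lemma pair_coord_targetK fg : W1 H fg -> pt_target (pair_coord fg) = fg.
Proof.
case: fg => f g /= [[fc f0] [gc g0] f1 fgE].
have fE : ext one_char (val_x (pair_coord (f, g))) = f.
  rewrite -[RHS](equivariant_ext fc f0); congr ext.
  apply/funext => i; rewrite /val_x; case: unliftP => [j ->|->]; first by rewrite pair_coordl.
  by rewrite val_r0.
congr pair => //.
rewrite -[RHS](equivariant_ext gc g0); congr ext.
apply/funext => i; rewrite /val_w; case: unliftP => [j ->|->]; first by rewrite pair_coordr.
move: fgE; rewrite !sum_equivariant1// => /eqP.
rewrite -subr_eq0 -mulrnBl mulrn_eq0 gtn_eqF ?cardG_gt0//= subr_eq0 => /eqP.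
rewrite !big_ord_recl val_r0 f1 => E.
under eq_bigr do rewrite pair_coordl.
under [X in _ - X]eq_bigr do rewrite pair_coordr.
by rewrite E addrK.
Qed.

Definition source_coordinates : affine_coordinates (V1 H c `*` V1bar H c) (N + N) :=
  AffineCoordinates pt_source_affine pt_source_in pt_sourceK pair_coord_sourceK.
Definition target_coordinates : affine_coordinates (W1 H) (N + N) :=
  AffineCoordinates pt_target_affine pt_target_in pt_targetK pair_coord_targetK.

Lemma indic_equivariant : equivariant H (fun=> 1) (indic_units R p).
Proof. by move=> h hH x; rewrite !ffunE mul1r mulf_eq0 (negPf (val_unit_neq0 h)). Qed.

Lemma Phi_target_in : W1 H (Phi_target R p).
Proof.
by split => //=; try (by split; [exact: indic_equivariant | rewrite ffunE eqxx]); rewrite ffunE oner_eq0.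
Qed.

(** Parseval's identity is what gives the two components of [Phi] equal sums. *)
Lemma Phi_in u : W1 H (Phi (pt_source u)).
Proof.
have fc := ext_equivariant c_char (val_x u); have gc := ext_equivariant cbar_char (val_y u).
have [[_ f1] [_ g1]] := pt_source_in u.
have f0 := equivariant0 c_nontrivial fc.
have E1 := mul_equivariant fc gc; have E2 := mul_fourier_equivariant fc gc.
have z1 : Defs.mul_fun (ext c (val_x u)) (ext cbar (val_y u)) 0 = 0 by rewrite mul_funE f0 mul0r.
have z2 : Defs.mul_fun (fourier (ext c (val_x u))) (fourier_reflect (ext cbar (val_y u))) 0 = 0.
  by rewrite mul_funE fourier0// mul0r.
split; rewrite /=.
- by split.
- by split.
- by rewrite mul_funE f1 g1 mulr1.
- rewrite (sum_equivariant1 z1 E1) (sum_equivariant1 z2 E2); congr (_ *+ _).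
  under eq_bigr do rewrite mul_funE.
  by rewrite parseval_reps//; apply: eq_bigr => i _; rewrite mul_funE.
Qed.

Lemma indic_unit (u : U) : indic_units R p (val u) = 1.
Proof. by rewrite ffunE val_unit_neq0. Qed.

(** In these coordinates the generators of the multiplicity ideal are exactly the bilinear
    polynomials at t = 1. The trivial coset gives no coordinate: one value is normalised, the other
    is determined by the sums. *)
Lemma Phi_coord u k : pair_coord (Phi (pt_source u)) 0 k - pair_coord (Phi_target R p) 0 k =
  mev u (bilinear Lx Ly 1 k).
Proof.
have Ex : mev u (form_x Lx (row2 k)) = sel (val_x u) (fun l => fourier (ext c (val_x u)) (val (r l))) (row2 k).
  rewrite mev_form_x mxE; under eq_bigr do rewrite vec_xE.
  by apply: form_mxE => v y; exact: ext_fourier_linear.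
have Ey : mev u (form_y Ly (row2 k)) =
    sel (val_y u) (fun l => fourier_reflect (ext cbar (val_y u)) (val (r l))) (row2 k).
  rewrite mev_form_y mxE; under eq_bigr do rewrite vec_yE.
  by apply: form_mxE => v y; exact: ext_fourier_reflect_linear.
rewrite /bilinear rmorphB rmorphM/= mevC Ex Ey !sel_row2.
case: (split_ordP k) => j ->.
  rewrite !pair_coordl /= mul_funE (ext_repr c_char) (ext_repr cbar_char).
  by rewrite indic_unit.
by rewrite !pair_coordr /= mul_funE indic_unit.
Qed.

Lemma zero_Phi u : zero_of (span (bilinear Lx Ly 1)) u <-> Phi (pt_source u) = Phi_target R p.
Proof.
split => [u0|E].
  rewrite -(pair_coord_targetK (Phi_in u)) -(pair_coord_targetK Phi_target_in); congr pt_target.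
  apply/rowP => k; apply/eqP; rewrite -subr_eq0 Phi_coord; apply/eqP/u0; exact: span_gen.
move=> q; apply: (span_sub (J := [set q | mev u q = 0])).
  split => /=; first by rewrite rmorph0.
    by move=> a b a0 b0; rewrite rmorphD/= a0 b0 addr0.
  by move=> a b b0; rewrite rmorphM/= b0 mulr0.
by move=> k /=; rewrite -Phi_coord E subrr.
Qed.

Lemma Phi_inv (f g : Fun) : f 0 = 0 -> g 0 = 0 -> Phi (f, g) = Phi_target R p -> g = inv_fun f.
Proof.
move=> f0 g0 [/ffunP E _]; apply/ffunP => x; rewrite ffunE.
have [->|x0] := eqVneq x 0; first by rewrite g0 f0 invr0.
have := E x; rewrite mul_funE ffunE x0 => fg.
have fx : f x != 0 by apply: contra_eq_neq fg => ->; rewrite mul0r eq_sym oner_eq0.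
by apply: (mulfI fx); rewrite mulfV.
Qed.

Lemma inv_fun_V1bar f : V1 H c f -> V1bar H c (inv_fun f).
Proof.
move=> [fc f1]; split; last by rewrite ffunE f1 invr1.
by move=> h hH x; rewrite !ffunE fc// -/(cbar h) cbar_inv// invfM.
Qed.

Theorem C_function_count :
  exists (s : seq Fun) (mult : Fun -> nat),
    [/\ uniq s,
        forall f, f \in s <-> V1 H c f /\ C_function f,
        forall f, f \in s -> has_multiplicity H c f (mult f) &
        (\sum_(f <- s) mult f)%N = 'C(N + N, N)].
Proof.
have Lx0 i : Lx ord0 i = (i == ord0)%:R by rewrite mxE /sel unlift_none eq_sym.
have Ly0 i : Ly ord0 i = (i == ord0)%:R by rewrite mxE /sel unlift_none eq_sym.
have e0 : sign_row ord0 = 1 by rewrite /sign_row /sel unlift_none.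
have e1 : sign_row (lift ord0 ord0) = -1 by rewrite /sign_row /sel liftK unlift_none.
have Lelim := bilinear_eliminates Lx0 Ly0 few_zeros_Lx few_zeros_Ly e0 e1 sign_row_sum parseval_mx.
have [s [mult [us sP sm sE]]] :=
  bilinear_count Lx0 Ly0 few_zeros_Lx few_zeros_Ly e0 e1 sign_row_sum parseval_mx.
have V1_0 f : V1 H c f -> f 0 = 0 by case=> fc _; exact: equivariant0 fc.
have invE w : w \in s -> (pt_source w).2 = inv_fun (pt_source w).1.
  move=> /sP/zero_Phi; have [Vf [gc _]] := pt_source_in w.
  by apply: Phi_inv; [exact: V1_0 | exact: equivariant0 cbar_nontrivial gc].
have coordE w : w \in s -> pair_coord ((pt_source w).1, inv_fun (pt_source w).1) = w.
  by move=> /invE <-; rewrite -surjective_pairing pt_sourceK.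
have memP f : f \in [seq (pt_source w).1 | w <- s] <-> V1 H c f /\ C_function f.
  split => [/mapP[w ws ->]|[Vf]].
    have [Vf _] := pt_source_in w; split => //; apply/C_functionP => //; first exact: V1_0.
    by rewrite -invE// -surjective_pairing; exact/zero_Phi/sP.
  move=> /(C_functionP p_prime p_odd (V1_0 _ Vf)) E.
  have fgE := pair_coord_sourceK (conj Vf (inv_fun_V1bar Vf) : (V1 H c `*` V1bar H c) (f, inv_fun f)).
  apply/mapP; exists (pair_coord (f, inv_fun f)); last by rewrite fgE.
  by apply/sP/zero_Phi; rewrite fgE.
(* A solution is recorded by its first component; the second is its inverse, so the multiplicity is
   looked up at the coordinates of the pair. *)
exists [seq (pt_source w).1 | w <- s], (fun f => mult (pair_coord (f, inv_fun f))); split => //.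
- rewrite map_inj_in_uniq// => w w' ws ws' E.
  by rewrite -(coordE w ws) -(coordE w' ws') E.
- move=> f fs; have [Vf Cf] := (memP f).1 fs.
  exists (inv_fun f); split; first exact: inv_fun_V1bar.
    exact/(C_functionP p_prime p_odd (V1_0 _ Vf)).
  exists (N + N)%N, (N + N)%N, source_coordinates, target_coordinates => /=.
  have [w ws fE] := mapP fs.
  have := local_ring_dim (Lelim 1) (sm _ ws).
  rewrite fE coordE//; congr (has_quotient_dim _ (germ_ideal _ _) _).
  by apply/funext => k; apply/funext => u; rewrite -Phi_coord.
- rewrite big_map -sE big_seq [RHS]big_seq; apply: eq_bigr => w ws.
  by rewrite coordE.
Qed.

End Extension.

Theorem theorem6p6 (R : realType) (p n : nat) (H : {group {unit 'F_p}})
    (c : {unit 'F_p} -> R[i]) (p_prime : prime p) (p_odd : odd p)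
    (index_H : #|[set: {unit 'F_p}]%SET : H|%g = n)
    (c_char : is_character H c) (c_nontrivial : exists2 h, h \in H & c h != 1) :
  exists (s : seq {ffun 'F_p -> R[i]^o}) (mult : {ffun 'F_p -> R[i]^o} -> nat),
    [/\ uniq s,
        forall f, f \in s <-> V1 H c f /\ C_function f,
        forall f, f \in s -> has_multiplicity H c f (mult f) &
        (\sum_(f <- s) mult f)%N = 'C(2 * n - 2, n - 1)].
Proof.
case: n index_H => [|N] index_H; first by have := indexg_gt0 [group of [set: {unit 'F_p}]%SET] H; rewrite index_H.
have [r [cls [hh [r0 hhH uE repr_uniq]]]] := coset_representatives index_H.
have := C_function_count p_prime p_odd r0 hhH uE repr_uniq c_char c_nontrivial.
have -> : (2 * N.+1 - 2 = N + N)%N by lia.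
rewrite subn1 /=; exact.
Qed.
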